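(* In the sparse clustering model described in the context, with a $\gamma$-balanced partition $G^*$, there exist two numerical constants $c_1,c_2$ and an estimator $\hat G$ (not necessarily computable in polynomial time) such that the following holds. If $$\omega_{J^*}^2\ge c_1\gamma^2\left(\sqrt{K\log(np)}+\log(np)\right)\quad\text{and}\quad \Delta^2\ge c_2\,\gamma^{5/2}\left[\sqrt{\frac{sK}{n}\log(n)}+\log(n)\right],$$ then, with probability at least $1-4/n^2$, we have $\hat G=G^*$.
   Context: Sparse clustering model: $s\in[p]$ is known; there is an unknown $J^*\subseteq[p]$ with $|J^*|\le s$ such that the unknown means $\mu_1,\dots,\mu_K\in\mathbb R^p$ ($K\ge2$) are all supported on $J^*$ ($\mu_{kj}=0$ for $j\notin J^*$). For some $\sigma>0$ and an unknown partition $G^*=\{G_1^*,\dots,G_K^*\}$ of $[n]$, the rows $Y_1,\dots,Y_n\in\mathbb R^p$ of $Y$ are independent, with $Y_i\sim\mathcal N(\mu_k,\sigma^2I_p)$ for $i\in G_k^*$. $X=\mathbb E[Y]$, i.e. $X_{ij}=\mu_{kj}$ for $i\in G_k^*$. $\Delta^2=\min_{k\ne l}\frac{\|\mu_k-\mu_l\|^2}{2\sigma^2}$; $\omega_{J^*}^2:=\frac1{\sigma^2}\min_{j\in J^*}\sum_{i\in[n]}X_{ij}^2$; $G^*$ is $\gamma$-balanced ($\gamma\ge1$) if $\max_k|G_k^*|/\min_k|G_k^*|\le\gamma$. An estimator is a (measurable) map of the data $Y$, possibly using auxiliary randomness independent of the data, with values in the partitions of $[n]$ into $K$ groups; $\hat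 G=G^*$ means equality as unlabelled partitions. *)

(* Defs.v *)
From HB Require Import structures.
From mathcomp Require Import all_boot all_order all_algebra.
From mathcomp Require Import all_classical all_reals all_analysis.

Set Implicit Arguments.
Unset Strict Implicit.
Unset Printing Implicit Defensive.

Import Order.TTheory GRing.Theory Num.Theory.
Import numFieldNormedType.Exports.

Local Open Scope ring_scope.

(* Partitions of [n] into K (nonempty) groups, without labels. *)
Definition is_Kpartition (n K : nat) (C : {set {set 'I_n}}) : bool :=
  finset.partition C [set: 'I_n]%SET && (#|C| == K).

(* A labelled partition G_1, ..., G_K is used to attach the mean mu_k to the
   group G_k; its underlying unlabelled partition is [unlabelled G]. *)
Definition unlabelled (n K : nat) (G : 'I_K -> {set 'I_n}) : {set {set 'I_n}} :=
  [set G k | k in 'I_K]%SET.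

Definition labelled_partition (n K : nat) (G : 'I_K -> {set 'I_n}) : Prop :=
  injective G /\ finset.partition (unlabelled G) [set: 'I_n]%SET.

(* The default value n of the minimum is harmless: every group has size <= n. *)
Definition balanced (R : realType) (n K : nat) (G : 'I_K -> {set 'I_n})
    (gamma : R) : Prop :=
  (\max_(k < K) #|G k|)%N%:R / (\big[minn/n]_(k < K) #|G k|)%N%:R <= gamma.

Definition supported_on (R : realType) (K p : nat) (mu : 'M[R]_(K, p))
    (J : {set 'I_p}) : Prop :=
  forall k j, j \notin J -> mu k j = 0.

(* X_ij = mu_kj for the unique k with i in G_k. *)
Definition signal (R : realType) (n p K : nat) (G : 'I_K -> {set 'I_n})
    (mu : 'M[R]_(K, p)) : 'M[R]_(n, p) :=
  \matrix_(i < n, j < p) \sum_(k < K | i \in G k) mu k j.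

(* Minima are taken in the extended reals, the minimum over an empty index set
   being +oo. *)
Definition Delta2 (R : realType) (p K : nat) (mu : 'M[R]_(K, p)) (sigma : R)
    : \bar R :=
  \big[mine/+oo%E]_(kl : 'I_K * 'I_K | kl.1 != kl.2)
    ((\sum_(j < p) (mu kl.1 j - mu kl.2 j) ^+ 2) / (2 * sigma ^+ 2))%:E.

Definition omega2 (R : realType) (n p : nat) (X : 'M[R]_(n, p))
    (J : {set 'I_p}) (sigma : R) : \bar R :=
  \big[mine/+oo%E]_(j in J) ((\sum_(i < n) X i j ^+ 2) / sigma ^+ 2)%:E.

Definition independent_family (R : realType) (d : measure_display)
    (Omega : measurableType d) (P : probability Omega R) (I : finType)
    (d' : measure_display) (T : measurableType d') (Z : I -> Omega -> T)
    : Prop :=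
  forall (J : {set I}) (B : I -> set T),
    (forall i, measurable (B i)) ->
    P [set w | forall i, i \in J -> B i (Z i w)]%classic =
    (\prod_(i in J) P (Z i @^-1` B i)%classic)%E.

(* Q = N(m, sigma^2 I_p), the product of the laws N(m_j, sigma^2).
   The second parameter of [normal_prob] is the standard deviation. *)
Definition isotropic_normal (R : realType) (p : nat) (m : 'I_p -> R)
    (sigma : R) (Q : set (p.-tuple R) -> \bar R) : Prop :=
  forall B : 'I_p -> set R, (forall j, measurable (B j)) ->
    Q [set x | forall j, B j (tnth x j)]%classic =
    (\prod_(j < p) normal_prob (m j) sigma (B j))%E.

(* The data matrix is the n-tuple of its rows, each a p-tuple of reals. *)
Definition clustering_model (R : realType) (n p K : nat)
    (G : 'I_K -> {set 'I_n}) (mu : 'M[R]_(K, p)) (sigma : R)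
    (d : measure_display) (Omega : measurableType d) (P : probability Omega R)
    (Y : {mfun Omega >-> n.-tuple (p.-tuple R)}) : Prop :=
  independent_family P (fun (i : 'I_n) w => tnth (Y w) i) /\
  (forall k i, i \in G k ->
    isotropic_normal (mu k) sigma (pushforward P (fun w => tnth (Y w) i))).

(* [Ghat y u]: value at the data y with auxiliary randomness u.  The set of
   partitions being finite, measurability is that of the level sets. *)
Definition estimator (R : realType) (n p K : nat) (d : measure_display)
    (U : measurableType d)
    (Ghat : n.-tuple (p.-tuple R) -> U -> {set {set 'I_n}}) : Prop :=
  (forall y u, is_Kpartition K (Ghat y u)) /\
  (forall C, measurable
    [set yu : n.-tuple (p.-tuple R) * U | Ghat yu.1 yu.2 = C]%classic).

(* Main.v *)
(* The estimator maximises, over surjective labellings [f] and sets [J] of at most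
   [s] columns, the sum over [j] in [J] of |P_f Y_j|^2 - lambda, where P_f averages
   over the groups of [f] and lambda exceeds K sigma^2 by a multiple of
   sigma^2 (sqrt (K log (np)) + log (np)).  As sigma is unknown, it is estimated
   by the p - s columns of smallest norm when 2 s < p; otherwise all columns
   are kept and no penalty is needed.

   Compare [f] with the true labelling f* through the impurity
   D = sum_{i,i'} P_f(i,i') [f*_i <> f*_i'].  Projecting along [f] loses a signal
   of at least sigma^2 Delta^2 D, the squared Frobenius norm of P_f - P_f* is
   at most 2 gamma K D / n, and after a relabelling [f] is at Hamming distance
   at most 2 gamma D from f*.  So Gaussian chaos in P_f - P_f*, uniformly over
   the labellings at a given distance, is of order
   gamma D (sqrt (s K log n / n) + log n), below the signal; wrongly selected
   or forgotten columns cost at most what lambda charges for them. *)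
Require Import Defs.
From HB Require Import structures.
From mathcomp Require Import all_boot all_order all_algebra.
From mathcomp Require Import ring lra.
From mathcomp Require Import all_classical all_reals all_analysis.
From mathcomp Require Import measurable_realfun.

Set Implicit Arguments.
Unset Strict Implicit.
Unset Printing Implicit Defensive.

Import Order.TTheory GRing.Theory Num.Theory.
Import numFieldNormedType.Exports.

Local Open Scope ring_scope.

(** * Gaussian integrals *)

(** The main obstacle is the choice of Chernoff rates. A tail bound for a quadratic form in P_f -
    P_f* fixes its rate before the union bound, whereas the best rate depends on the Hamming
    distance, the number of columns and the Frobenius norm. Two rates known in advance suffice: one
    balances log n against sqrt(2 s K log n / n), the other log(np) against sqrt(K log(np)). The
    larger of the two parts of the union-bound budget decides which one to use. Uniformity over J
    would be too expensive on the columns common to J and J*. Their chaos is therefore written as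
    the chaos on the fixed set J*, which needs no union over column sets, minus the chaos on the
    forgotten columns, whose cost the penalty covers. Since labellings are surjective, every
    projection has trace K, so the chaos is centred. The variance is needed only to relative
    accuracy sqrt(log n / n): as K <= n, K times this is at most sqrt(K log n). The smallest columns
    underestimate it, which a deterministic inflation factor repairs. Four events of probability at
    most n^-2 make up 4/n^2: chaos, single columns, and the two sides of the variance estimate. *)

Lemma integral_normal_probE (R : realType) (m s : R) (f : R -> \bar R) :
  measurable_fun setT f -> (forall x, (0 <= f x)%E) ->
  (\int[normal_prob m s]_x f x =
   \int[lebesgue_measure]_x (f x * (normal_pdf m s x)%:E))%E.
Proof.
move=> mf f0; pose nu : {finite_measure set _ -> \bar R} := normal_prob m s.
have dom : nu `<< (@lebesgue_measure R) := normal_prob_dominates m s.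
rewrite -(Radon_Nikodym_SigmaFinite.change_of_variables dom) //.
have mg : measurable_fun [set: R] (Radon_Nikodym_SigmaFinite.f nu (@lebesgue_measure R)).
  exact: measurable_int (Radon_Nikodym_SigmaFinite.f_integrable dom).
have mp : measurable_fun [set: R] (fun x => (normal_pdf m s x)%:E).
  by apply/measurable_EFinP; exact: measurable_normal_pdf.
apply: ge0_ae_eq_integral => //.
- exact: emeasurable_funM.
- exact: emeasurable_funM.
- move=> x _; apply: mule_ge0 => //; exact: Radon_Nikodym_SigmaFinite.f_ge0.
- by move=> x _; rewrite mule_ge0// lee_fin normal_pdf_ge0.
(* The Radon-Nikodym derivative and the density have the same integral over every measurable set, so
   they agree almost everywhere. *)
- apply: ae_eqe_mul2l; apply: integral_ae_eq => //.
  + exact: Radon_Nikodym_SigmaFinite.f_integrable.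
  + move=> A AT mA; rewrite -Radon_Nikodym_SigmaFinite.f_integral //.
Qed.

Lemma measurable_idR (R : realType) :
  @measurable_fun _ _ (measurableTypeR R) R setT idfun.
Proof. by move=> _ A mA; rewrite setTI. Qed.

(* [normal_prob] lives on [measurableTypeR R], whose display differs from that
   of the canonical measurable structure of [R]. *)
Definition normalR (R : realType) (m s : R) : probability R R :=
  distribution (normal_prob m s : probability (measurableTypeR R) R)
    (HB.pack (idfun : measurableTypeR R -> R)
      (isMeasurableFun.Build _ _ _ _ _ (@measurable_idR R))).

(** Completing the square turns integrand times density into a constant times the density of mean
    [m + s * b / u] and standard deviation [s / sqrt u]. The parameter [u] is the inverse variance
    of the tilted law in standardized units: [u = 1] serves linear forms, [u = 1 + 2 v] negative
    squares, and a pivot serves quadratic forms. *)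
Lemma integral_normal_exp (R : realType) (m s u b : R) : 0 < s -> 0 < u ->
  (\int[normalR m s]_x
     (expR ((1 - u) / 2 * ((x - m) / s) ^+ 2 + b * ((x - m) / s)))%:E =
   ((Num.sqrt u)^-1 * expR (b ^+ 2 / (2 * u)))%:E)%E.
Proof.
move=> s0 u0; pose F x := expR ((1 - u) / 2 * ((x - m) / s) ^+ 2 + b * ((x - m) / s)).

have mF : measurable_fun [set: R] F.
  apply: measurableT_comp => //; apply: measurable_funD => //.
    apply: measurable_funM => //; apply: measurable_funX.
    by apply: measurable_funM => //; exact: measurable_funB.
  apply: measurable_funM => //; apply: measurable_funM => //.
  exact: measurable_funB.
have mEF : measurable_fun [set: R] (EFin \o F) by exact/measurable_EFinP.
rewrite (@ge0_integral_distribution _ _ _ _ _ _ _ (EFin \o F)) //; last first.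
  by move=> x; rewrite lee_fin expR_ge0.
rewrite [LHS](integral_normal_probE _ _ mEF); last first.
  by move=> x; rewrite lee_fin expR_ge0.
pose s' := s / Num.sqrt u; pose m' := m + s * b / u.
have su : 0 < Num.sqrt u by rewrite sqrtr_gt0.
have s'0 : 0 < s' by rewrite divr_gt0.
have sne : s != 0 by rewrite gt_eqF.
have s'ne : s' != 0 by rewrite gt_eqF.
under eq_integral => x _.
  have -> : ((EFin \o F) x * (normal_pdf m s x)%:E)%E =
     (((Num.sqrt u)^-1 * expR (b ^+ 2 / (2 * u)))%:E * (normal_pdf m' s' x)%:E)%E.
    rewrite -!EFinM !normal_pdfE // /F /normal_peak /normal_fun; congr EFin.
    have -> : Num.sqrt (s' ^+ 2 * pi *+ 2) = (Num.sqrt u)^-1 * Num.sqrt (s ^+ 2 * pi *+ 2).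
      rewrite /s' expr_div_n sqr_sqrtr ?ltW // -[in RHS]sqrtrV ?ltW //.
      rewrite -sqrtrM ?invr_ge0 ?ltW //; congr Num.sqrt; field.
      by rewrite gt_eqF.
    set c := Num.sqrt (s ^+ 2 * pi *+ 2).
    rewrite [((Num.sqrt u)^-1 * c)^-1]invfM invrK.
    set e1 := expR _; set e2 := expR _; set e3 := expR _; set e4 := expR _.
    have -> : (Num.sqrt u)^-1 * e3 * (Num.sqrt u / c * e4) = c^-1 * (e3 * e4).
      have cne : c != 0.
        by rewrite gt_eqF // sqrtr_gt0 mulrn_wgt0 // mulr_gt0 ?exprn_gt0 ?pi_gt0.
      by field; rewrite cne gt_eqF.
    rewrite [LHS]mulrCA; congr (_ * _); rewrite /e1 /e2 /e3 /e4.
    rewrite -!expRD; congr expR.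
    have -> : s' ^+ 2 = s ^+ 2 / u by rewrite /s' expr_div_n sqr_sqrtr ?ltW.
    rewrite /m'; field.
    by rewrite sne gt_eqF.
  over.
rewrite ge0_integralZl //.
- by rewrite integral_normal_pdf mule1.
- by apply/measurable_EFinP; exact: measurable_normal_pdf.
- by move=> x _; rewrite lee_fin normal_pdf_ge0.
Qed.

Definition box (R : realType) (N : nat) (B : 'I_N -> set R) : set (N.-tuple R) :=
  [set x | forall i, B i (tnth x i)]%classic.

Lemma measurable_box (R : realType) (N : nat) (B : 'I_N -> set R) :
  (forall i, measurable (B i)) -> measurable (box B).
Proof.
move=> mB.
rewrite (_ : box B = \bigcap_(i in [set: 'I_N]) ((fun x => tnth x i) @^-1` B i))%classic; last first.
  by apply/seteqP; split => [x Bx i _|x Bx i]; [exact: Bx|exact: Bx].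
apply: fin_bigcap_measurable => // i _; rewrite -[X in measurable X]setTI.
exact: measurable_tnth.
Qed.

(** Boxes are stable under intersection and generate the sigma-algebra of tuples, the preimage of a
    coordinate being a box with one constrained side. *)
Lemma tuple_measure_unique (R : realType) (N : nat)
    (m1 m2 : {measure set (N.-tuple R) -> \bar R}) :
  (m1 setT < +oo)%E ->
  (forall B, (forall i, measurable (B i)) -> m1 (box B) = m2 (box B)) ->
  forall A, measurable A -> m1 A = m2 A.
Proof.
move=> m1oo m12 A mA.
pose G : set (set (N.-tuple R)) :=
  [set C | exists B : 'I_N -> set R, (forall i, measurable (B i)) /\ C = box B]%classic.
have GT : G setT.
  by exists (fun=> setT); split=> //; apply/seteqP; split.
apply: (measure_unique G (fun=> setT)) => //.
- apply/seteqP; split.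
    apply: smallest_sub; first exact: smallest_sigma_algebra.
    rewrite -bigcup_seq => C [i _ [B mB <-]].
    apply: sub_sigma_algebra; exists (fun j => if j == i then B else setT).
    split=> [j|]; first by case: ifP.
    rewrite setTI; apply/seteqP; split=> [x Bx j|x /(_ i)]; last by rewrite eqxx.
    by case: ifP => // /eqP ->.
  apply: smallest_sub; first exact: sigma_algebra_measurable.
  by move=> C [B [mB ->]]; exact: measurable_box.
- move=> _ _ [B [mB ->]] [B' [mB' ->]]; exists (fun i => B i `&` B' i)%classic.
  split; first by move=> i; exact: measurableI.
  apply/seteqP; split=> [x [Bx B'x] i|x Bx]; first by split.
  by split=> i; case: (Bx i).
- by apply/seteqP; split=> // x _; exists 0%N.
- by move=> _ [B [mB ->]]; exact: m12.
Qed.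

Section Independence.
Local Open Scope ereal_scope.
Context (R : realType) (d : measure_display) (Omega : measurableType d)
  (P : probability Omega R).

(** For fixed [A], both sides of the product formula are finite measures in the second variable, so
    agreement on boxes extends to all measurable sets. The joint law is then a product measure, and
    Tonelli applies. *)
Lemma integral_indep_pair (N : nat) (Z : Omega -> R) (V : Omega -> N.-tuple R)
    (nu : probability R R) (h : R * N.-tuple R -> \bar R) :
  measurable_fun setT Z -> measurable_fun setT V ->
  (forall A B, measurable A -> (forall i, measurable (B i)) ->
    P [set w | A (Z w) /\ box B (V w)]%classic =
    nu A * P [set w | box B (V w)]%classic) ->
  measurable_fun setT h -> (forall z, 0 <= h z) ->
  \int[P]_w h (Z w, V w) = \int[P]_w \int[nu]_x h (x, V w).
Proof.
move=> mZ mV ZV mh h0.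
have mZV : measurable_fun setT (fun w => (Z w, V w)) by exact: measurable_fun_pair.
pose ZV_ : {mfun Omega >-> (R * N.-tuple R)%type} := HB.pack (fun w => (Z w, V w)) (isMeasurableFun.Build _ _ _ _ _ mZV).
pose V_ : {mfun Omega >-> N.-tuple R} := HB.pack V (isMeasurableFun.Build _ _ _ _ _ mV).
pose m2 : probability (N.-tuple R) R := distribution P V_.
pose m' : probability (R * N.-tuple R)%type R := distribution P ZV_.
have eqm X : measurable X -> (nu \x m2) X = m' X.
  apply: product_measure_unique => A B mA mB.
  have mZA : measurable (Z @^-1` A) by rewrite -[X in measurable X]setTI; exact: mZ.
  pose n1 : {measure set (N.-tuple R) -> \bar R} := pushforward (mrestr P mZA) V_.
  pose n2 : {measure set (N.-tuple R) -> \bar R} := mscale (NngNum (fine_ge0 (measure_ge0 nu A))) m2.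
  have : n1 mV B = n2 B.
    apply: tuple_measure_unique mB => [|B' mB'].
      rewrite /n1 /= /pushforward /mrestr.
      have mI : measurable (V @^-1` setT `&` Z @^-1` A)%classic.
        by rewrite preimage_setT classical_sets.setTI.
      by apply: (le_lt_trans (probability_le1 P mI)); rewrite ltry.
    rewrite -[LHS]/(P ((V @^-1` box B') `&` (Z @^-1` A))%classic).
    rewrite -[RHS]/((fine (nu A))%:E * P (V @^-1` box B')%classic).
    rewrite fineK ?fin_num_measure // -ZV //.
    by congr (P _); apply/seteqP; split=> w [].
  rewrite -[X in X = _ -> _]/(P ((V @^-1` B) `&` (Z @^-1` A))%classic).
  rewrite -[X in _ = X -> _]/((fine (nu A))%:E * P (V @^-1` B)%classic).
  rewrite fineK ?fin_num_measure // => e1; rewrite -[RHS]e1.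
  by congr (P _); apply/seteqP; split=> w [].
transitivity (\int[nu \x m2]_z h z).
  rewrite -(@ge0_integral_pushforward _ _ _ _ _ _ mZV P setT h) //.
  by apply: eq_measure_integral => X mX _; exact: (esym (eqm X mX)).
rewrite fubini_tonelli2 //.
rewrite (@ge0_integral_pushforward _ _ _ _ _ _ mV P setT) //.
- exact: measurable_fun_fubini_tonelli_G.
- by move=> v _; exact: integral_ge0.
Qed.

End Independence.

(** * Independent Gaussian families *)

(** One product formula carries both independence and the normal marginals: a coordinate is dropped
    by taking [B i = setT]. *)
Definition gaussian_family (R : realType) (d : measure_display)
    (Omega : measurableType d) (P : probability Omega R) (N : nat)
    (Z : 'I_N -> Omega -> R) (m : 'I_N -> R) (s : R) : Prop :=
  (forall i, measurable_fun setT (Z i)) /\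
  (forall B : 'I_N -> set R, (forall i, measurable (B i)) ->
    P [set w | forall i, B i (Z i w)]%classic =
    (\prod_(i < N) normal_prob (m i) s (B i))%E).

Definition tail_tuple (R : realType) (Omega : Type) (N : nat)
    (Z : 'I_N.+1 -> Omega -> R) (w : Omega) : N.-tuple R :=
  [tuple Z (lift ord0 i) w | i < N].

Section GaussianFamily.
Context (R : realType) (d : measure_display) (Omega : measurableType d)
  (P : probability Omega R).

Lemma gaussian_family_tail (N : nat) (Z : 'I_N.+1 -> Omega -> R) m s :
  gaussian_family P Z m s ->
  gaussian_family P (fun i => Z (lift ord0 i)) (fun i => m (lift ord0 i)) s.
Proof.
case=> mZ lawZ; split=> [i|B mB]; first exact: mZ.
pose C i := if unlift ord0 i is Some j then B j else setT.
have mC i : measurable (C i) by rewrite /C; case: unliftP.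
transitivity (P [set w | forall i, C i (Z i w)]%classic).
  congr (P _); apply/seteqP; split=> w /= H i.
    by rewrite /C; case: unliftP => // j ->; exact: H.
  by have := H (lift ord0 i); rewrite /C liftK.
rewrite lawZ // big_ord_recl {1}/C unlift_none.
rewrite (probability_setT (normal_prob (m ord0) s)) mul1e.
by apply: eq_bigr => i _; rewrite /C liftK.
Qed.

Lemma measurable_tail_tuple (N : nat) (Z : 'I_N.+1 -> Omega -> R) :
  (forall i, measurable_fun setT (Z i)) -> measurable_fun setT (tail_tuple Z).
Proof.
move=> mZ; apply/measurable_fun_tnthP => i.
rewrite (_ : _ \o _ = Z (lift ord0 i)) //.
by apply/funext => w /=; rewrite tnth_mktuple.
Qed.

Lemma integral_gaussian_step (N : nat) (Z : 'I_N.+1 -> Omega -> R) m s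
    (h : R * N.-tuple R -> \bar R) :
  gaussian_family P Z m s -> measurable_fun setT h -> (forall z, 0 <= h z)%E ->
  (\int[P]_w h (Z ord0 w, tail_tuple Z w) =
   \int[P]_w \int[normalR (m ord0) s]_x h (x, tail_tuple Z w))%E.
Proof.
move=> gZ mh h0; have [mZ lawZ] := gZ; have [_ lawT] := gaussian_family_tail gZ.
apply: integral_indep_pair => //; first exact: measurable_tail_tuple.
move=> A B mA mB.
have boxE w : box B (tail_tuple Z w) <-> forall i, B i (Z (lift ord0 i) w).
  by split=> H i; have := H i; rewrite tnth_mktuple.
pose C i := if unlift ord0 i is Some j then B j else A.
have mC i : measurable (C i) by rewrite /C; case: unliftP.
transitivity (P [set w | forall i, C i (Z i w)]%classic).
  congr (P _); apply/seteqP; split=> [w [Aw /boxE Bw] i|w /= H].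
    by rewrite /C; case: unliftP => [j ->|->].
  split; first by have := H ord0; rewrite /C unlift_none.
  by apply/boxE => i; have := H (lift ord0 i); rewrite /C liftK.
rewrite lawZ // big_ord_recl {1}/C unlift_none.
under eq_bigr do rewrite /C liftK.
rewrite -lawT //.
by congr (_ * P _)%E; apply/seteqP; split=> w /boxE.
Qed.

Lemma integral_gaussian_step_le (N : nat) (Z : 'I_N.+1 -> Omega -> R) m s
    (h : R * N.-tuple R -> \bar R) (g : N.-tuple R -> \bar R) :
  gaussian_family P Z m s -> measurable_fun setT h -> (forall z, 0 <= h z)%E ->
  measurable_fun setT g ->
  (forall v, \int[normalR (m ord0) s]_x h (x, v) <= g v)%E ->
  (\int[P]_w h (Z ord0 w, tail_tuple Z w) <= \int[P]_w g (tail_tuple Z w))%E.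
Proof.
move=> gZ mh h0 mg hg; rewrite (integral_gaussian_step gZ) //.
have mT := measurable_tail_tuple gZ.1.
have int0 v : (0 <= \int[normalR (m ord0) s]_x h (x, v))%E by exact: integral_ge0.
apply: ge0_le_integral => //.
- have mG := measurable_fun_fubini_tonelli_G (m1 := normalR (m ord0) s) h mh h0.
  exact: (measurableT_comp mG mT).
- exact: (measurableT_comp mg mT).
Qed.

Lemma integral_gaussian_prod (N : nat) (Z : 'I_N -> Omega -> R) m s
    (h : 'I_N -> R -> R) (c : 'I_N -> R) :
  gaussian_family P Z m s -> (forall i, measurable_fun setT (h i)) ->
  (forall i x, 0 <= h i x) ->
  (forall i, \int[normalR (m i) s]_x (h i x)%:E <= (c i)%:E)%E ->
  (\int[P]_w (\prod_i h i (Z i w))%:E <= (\prod_i c i)%:E)%E.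
Proof.
elim: N => [|N IH] in Z m h c * => gZ mh h0 hc.
  under eq_integral do rewrite big_ord0.
  rewrite big_ord0 (integral_cst P measurableT) mul1e.
  exact: (probability_le1 P measurableT).
have [mZ _] := gZ.
pose g (v : N.-tuple R) := \prod_(i < N) h (lift ord0 i) (tnth v i).
have g0 v : 0 <= g v by apply: prodr_ge0 => i _; exact: h0.
have mg : measurable_fun setT g.
  apply: measurable_prod => i _; apply: measurableT_comp; first exact: mh.
  exact: measurable_tnth.
pose H (z : R * N.-tuple R) := (h ord0 z.1 * g z.2)%:E.
have mH : measurable_fun setT H.
  apply/measurable_EFinP; apply: measurable_funM; exact: measurableT_comp.
have gE w : g (tail_tuple Z w) = \prod_(i < N) h (lift ord0 i) (Z (lift ord0 i) w).
  by apply: eq_bigr => i _; rewrite tnth_mktuple.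
rewrite (_ : (fun w => _) = fun w => H (Z ord0 w, tail_tuple Z w)); last first.
  by apply/funext => w; rewrite big_ord_recl /H /= gE.
have c0 : 0 <= c ord0.
  rewrite -lee_fin; apply: le_trans (hc ord0); apply: integral_ge0 => x _.
  by rewrite lee_fin.
have mgT : measurable_fun setT (fun v => (g v)%:E) by exact/measurable_EFinP.
rewrite big_ord_recl EFinM.
apply: (@le_trans _ _ (\int[P]_w ((c ord0)%:E * (g (tail_tuple Z w))%:E)))%E.
  apply: (integral_gaussian_step_le (g := fun v => (c ord0)%:E * (g v)%:E)%E gZ) => //.
  - by move=> z; rewrite lee_fin mulr_ge0.
  - exact: emeasurable_funM.
  - move=> v; rewrite /H /=.
    under eq_integral do rewrite mulrC EFinM.
    rewrite ge0_integralZl //.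
    + by rewrite muleC; apply: lee_wpmul2r; [rewrite lee_fin|exact: hc].
    + by apply/measurable_EFinP; exact: mh.
    + by move=> x _; rewrite lee_fin.
    + by rewrite lee_fin.
rewrite ge0_integralZl //; last 2 first.
- exact: (measurableT_comp mgT (measurable_tail_tuple mZ)).
- by move=> w _; rewrite lee_fin.
apply: lee_wpmul2l => //.
under eq_integral do rewrite gE.
apply: (IH _ _ (fun i => h (lift ord0 i)) (fun i => c (lift ord0 i))
  (gaussian_family_tail gZ)) => i; first exact: mh.
- exact: h0.
- exact: hc.
Qed.

End GaussianFamily.

(** * Exponential moments of Gaussian quadratic forms *)

Section SchurComplement.
Context (R : realType) (N : nat) (M W : 'I_N.+1 -> 'I_N.+1 -> R) (c : R).
Hypotheses (c0 : 0 < c) (symM : forall i j, M i j = M j i).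
Hypothesis posM : forall x : 'I_N.+1 -> R,
  c * \sum_i x i ^+ 2 <= \sum_i \sum_j x i * x j * M i j.
Hypothesis WM : forall i k, \sum_j W i j * M j k = (i == k)%:R.

Local Notation l := (lift ord0).
Local Notation mu := (M ord0 ord0).

Definition schur (i j : 'I_N) : R := M (l i) (l j) - M ord0 (l i) * M ord0 (l j) / mu.

Lemma quad_recl (x : 'I_N.+1 -> R) :
  \sum_i \sum_j x i * x j * M i j =
  x ord0 ^+ 2 * mu + 2 * x ord0 * (\sum_i x (l i) * M ord0 (l i)) +
  \sum_i \sum_j x (l i) * x (l j) * M (l i) (l j).
Proof.
rewrite big_ord_recl big_ord_recl /=.
under [X in _ + X = _]eq_bigr => i _ do rewrite big_ord_recl.
rewrite big_split /= addrA; congr (_ + _).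
rewrite -expr2 -addrA; congr (_ + _).
have -> : \sum_(i < N) x ord0 * x (l i) * M ord0 (l i) =
    x ord0 * \sum_i x (l i) * M ord0 (l i).
  by rewrite mulr_sumr; apply: eq_bigr => i _; rewrite mulrA.
have -> : \sum_(i < N) x (l i) * x ord0 * M (l i) ord0 =
    x ord0 * \sum_i x (l i) * M ord0 (l i).
  rewrite mulr_sumr; apply: eq_bigr => i _.
  by rewrite symM mulrA [x ord0 * _]mulrC.
by rewrite -mulrA mulr_natl mulr2n.
Qed.

Lemma pivot_gt0 : 0 < mu.
Proof.
have := posM (fun i => (i == ord0)%:R); rewrite quad_recl big_ord_recl.
rewrite [X in _ * (_ + X)]big1 ?addr0 => [|i _]; last by rewrite expr0n.
rewrite [X in _ <= _ + X]big1 ?addr0 => [|i _]; last first.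
  by rewrite big1 // => j _; rewrite !mul0r.
rewrite [X in _ + _ * X]big1 => [|i _]; last by rewrite mul0r.
by rewrite mulr0 addr0 eqxx expr1n mulr1 mul1r; exact: lt_le_trans.
Qed.

Lemma schur_sym i j : schur i j = schur j i.
Proof. by rewrite /schur symM; congr (_ - _ / _); rewrite mulrC. Qed.

Lemma quad_schur (y : 'I_N -> R) :
  \sum_i \sum_j y i * y j * schur i j =
  \sum_i \sum_j y i * y j * M (l i) (l j) - (\sum_i y i * M ord0 (l i)) ^+ 2 / mu.
Proof.
rewrite expr2 -mulrA mulr_suml -sumrB; apply: eq_bigr => i _.
rewrite mulrA mulr_sumr mulr_suml -sumrB; apply: eq_bigr => j _.
by rewrite /schur; ring.
Qed.

(** The Schur complement at [y] is the minimum of the full form over the eliminated coordinate,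
    attained at [- t / mu]; evaluating there transfers the lower bound [c]. *)
Lemma schur_pos (y : 'I_N -> R) :
  c * \sum_i y i ^+ 2 <= \sum_i \sum_j y i * y j * schur i j.
Proof.
rewrite quad_schur; set t := \sum_i y i * M ord0 (l i).
pose x i := if unlift ord0 i is Some j then y j else - t / mu.
have x0 : x ord0 = - t / mu by rewrite /x unlift_none.
have xl i : x (l i) = y i by rewrite /x liftK.
have := posM x; rewrite quad_recl big_ord_recl x0.
under eq_bigr do rewrite xl.
under [X in _ <= _ + _ * X + _]eq_bigr do rewrite xl.
under [X in _ <= _ + X]eq_bigr do under eq_bigr do rewrite !xl.
rewrite -/t => H; apply: le_trans (le_trans H _).
  by apply: ler_wpM2l; [exact: ltW|rewrite lerDr sqr_ge0].
rewrite le_eqVlt; apply/orP; left; apply/eqP; field.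
by rewrite gt_eqF // pivot_gt0.
Qed.

(** Column [ord0] of [W M = 1] expresses the sum of [W (l i) (l j) * M ord0 (l j)] as
    [- W (l i) ord0 * mu], which supplies exactly the term missing from column [l k]. *)
Lemma schur_inv i k : \sum_j W (l i) (l j) * schur j k = (i == k)%:R.
Proof.
have m0 : mu != 0 by rewrite gt_eqF // pivot_gt0.
have := WM (l i) (l k); have := WM (l i) ord0.
rewrite (_ : (l i == ord0) = false) // !big_ord_recl (inj_eq (@lift_inj _ ord0)) => e0 <-.
have e1 : \sum_(j < N) W (l i) (l j) * M ord0 (l j) = - W (l i) ord0 * mu.
  apply/eqP; rewrite mulNr -addr_eq0 addrC; apply/eqP; rewrite -[RHS]e0.
  by congr (_ + _); apply: eq_bigr => j _; rewrite symM.
transitivity (\sum_(j < N) W (l i) (l j) * M (l j) (l k) -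
  (\sum_(j < N) W (l i) (l j) * M ord0 (l j)) * M ord0 (l k) / mu).
  by rewrite !mulr_suml -sumrB; apply: eq_bigr => j _; rewrite /schur; ring.
by rewrite e1; field.
Qed.

(** At the vector [z], row [ord0] of [W] minus the first basis vector over [mu], the form [M] takes
    the value [W ord0 ord0 - mu^-1], which positivity makes nonnegative. *)
Lemma pivot_inv_le : mu^-1 <= W ord0 ord0.
Proof.
have m0 : mu != 0 by rewrite gt_eqF // pivot_gt0.
pose d0 (i : 'I_N.+1) : R := (i == ord0)%:R.
have sumd (f : 'I_N.+1 -> R) : \sum_i d0 i * f i = f ord0.
  rewrite (bigD1 ord0) //= /d0 eqxx mul1r big1 ?addr0 // => i /negbTE ->.
  by rewrite mul0r.
pose z i := W ord0 i - d0 i / mu.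
have zM j : \sum_i z i * M i j = d0 j - M ord0 j / mu.
  transitivity (\sum_i W ord0 i * M i j - (\sum_i d0 i * M i j) / mu).
    by rewrite mulr_suml -sumrB; apply: eq_bigr => i _; rewrite /z; ring.
  by rewrite WM sumd /d0 eq_sym.
have := posM z; rewrite exchange_big /=.
under [X in _ <= X]eq_bigr => j _.
  rewrite (_ : \sum_i _ = z j * \sum_i z i * M i j); last first.
    by rewrite mulr_sumr; apply: eq_bigr => i _; ring.
  rewrite zM; over.
have -> : \sum_i z i * (d0 i - M ord0 i / mu) = W ord0 ord0 - mu^-1.
  transitivity (\sum_i d0 i * z i - (\sum_i z i * M i ord0) / mu).
    rewrite mulr_suml -sumrB; apply: eq_bigr => i _; rewrite symM; ring.
  by rewrite sumd zM /z /d0 eqxx mulfV // subrr mul0r subr0 mul1r.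
move=> H; rewrite -subr_ge0; apply: le_trans H.
by apply: mulr_ge0; [exact: ltW|apply: sumr_ge0 => i _; exact: sqr_ge0].
Qed.

End SchurComplement.

Section QuadraticExponential.
Context (R : realType) (d : measure_display) (Omega : measurableType d)
  (P : probability Omega R).

(** After squaring, this is [w <= expR (w - 1)]. *)
Lemma inv_sqrt_le_exp (u w : R) : 0 < u -> u^-1 <= w ->
  (Num.sqrt u)^-1 <= expR ((w - 1) / 2).
Proof.
move=> u0 uw; rewrite -(@ler_pXn2r _ 2%N) // ?nnegrE ?invr_ge0 ?sqrtr_ge0 ?expR_ge0 //.
rewrite exprVn sqr_sqrtr ?(ltW u0) // -expRM_natl mulrCA mulfV // mulr1.
by have := expR_ge1Dx (w - 1); rewrite addrC subrK; exact: le_trans.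
Qed.

(* Integrating out one coordinate replaces [M] by its Schur complement, whose
   inverse is the corresponding principal submatrix of [W = M^-1]; the factor
   gained is the square root of the inverse pivot, and that inverse is at most
   the diagonal entry of [W]. *)
Lemma integral_gaussian_quad (N : nat) (Z : 'I_N -> Omega -> R) m s
    (M W : 'I_N -> 'I_N -> R) (c : R) :
  gaussian_family P Z m s -> 0 < s -> 0 < c ->
  (forall i j, M i j = M j i) ->
  (forall x : 'I_N -> R,
    c * \sum_i x i ^+ 2 <= \sum_i \sum_j x i * x j * M i j) ->
  (forall i k, \sum_j W i j * M j k = (i == k)%:R) ->
  (\int[P]_w (expR ((\sum_i ((Z i w - m i) / s) ^+ 2 -
     \sum_i \sum_j (Z i w - m i) / s * ((Z j w - m j) / s) * M i j) / 2))%:E <=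
   (expR (\sum_i (W i i - 1) / 2))%:E)%E.
Proof.
move=> + s0 c0; elim: N => [|N IH] in Z m M W * => gZ symM posM WM.
  under eq_integral do rewrite !big_ord0 subrr mul0r expR0.
  rewrite big_ord0 expR0 (integral_cst P measurableT) mul1e.
  exact: (probability_le1 P measurableT).
pose l := @lift N.+1 ord0; pose mu := M ord0 ord0.
have mu0 : 0 < mu by exact: pivot_gt0 posM.
pose v' (v : N.-tuple R) i := (tnth v i - m (l i)) / s.
pose b v := \sum_i v' v i * M ord0 (l i).
pose q v := \sum_i v' v i ^+ 2 - \sum_i \sum_j v' v i * v' v j * M (l i) (l j).
have mv' i : measurable_fun setT (fun v => v' v i).
  apply: measurable_funM => //; apply: measurable_funB => //.
  exact: measurable_tnth.
have mb : measurable_fun setT b.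
  by apply: measurable_sum => i; exact: measurable_funM.
have mq : measurable_fun setT q.
  apply: measurable_funB; first by apply: measurable_sum => i; exact: measurable_funX.
  apply: measurable_sum => i; apply: measurable_sum => j.
  by apply: measurable_funM => //; exact: measurable_funM.
pose f (z : R * N.-tuple R) := expR ((1 - mu) / 2 * ((z.1 - m ord0) / s) ^+ 2
   + (- b z.2) * ((z.1 - m ord0) / s)).
have mf : measurable_fun setT f.
  apply: measurableT_comp => //.
  have mx : measurable_fun setT (fun z : R * N.-tuple R => (z.1 - m ord0) / s).
    by apply: measurable_funM => //; exact: measurable_funB.
  apply: measurable_funD; apply: measurable_funM => //.
    exact: measurable_funX.
  by apply: measurableT_comp => //; exact: measurableT_comp.
pose g v := ((Num.sqrt mu)^-1 * expR (b v ^+ 2 / (2 * mu)) * expR (q v / 2))%:E.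
pose h (z : R * N.-tuple R) := (f z * expR (q z.2 / 2))%:E.
have mh : measurable_fun setT h.
  apply/measurable_EFinP; apply: measurable_funM => //.
  apply: measurableT_comp => //; apply: measurable_funM => //.
  exact: measurableT_comp.
have mg : measurable_fun setT g.
  apply/measurable_EFinP; apply: measurable_funM => //.
    apply: measurable_funM => //; apply: measurableT_comp => //.
    by apply: measurable_funM => //; exact: measurable_funX.
  by apply: measurableT_comp => //; exact: measurable_funM.
have hg v : (\int[normalR (m ord0) s]_x h (x, v) <= g v)%E.
  under eq_integral do rewrite /h /= mulrC EFinM.
  rewrite ge0_integralZl //.
  - by rewrite /f /= integral_normal_exp // sqrrN /g -EFinM mulrC.
  - by apply/measurable_EFinP; exact: (measurableT_comp mf (pair2_measurable v)).
  - by move=> x _; rewrite lee_fin expR_ge0.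
have h0 z : (0 <= h z)%E by rewrite lee_fin mulr_ge0 ?expR_ge0.
pose e w i := (Z i w - m i) / s.
have eT w i : v' (tail_tuple Z w) i = e w (l i) by rewrite /v' tnth_mktuple.
have bE w : b (tail_tuple Z w) = \sum_i e w (l i) * M ord0 (l i).
  by apply: eq_bigr => i _; rewrite eT.
have qE w : q (tail_tuple Z w) = \sum_i e w (l i) ^+ 2 -
    \sum_i \sum_j e w (l i) * e w (l j) * M (l i) (l j).
  congr (_ - _); apply: eq_bigr => i _; rewrite ?eT //.
  by apply: eq_bigr => j _; rewrite !eT.
rewrite (_ : (fun w => _) = fun w => h (Z ord0 w, tail_tuple Z w)); last first.
  apply/funext => w; rewrite /h /f /= -expRD; congr (expR _)%:E.
  rewrite bE qE -/(e w ord0) [in LHS](quad_recl symM (e w)) big_ord_recl -/mu.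
  have alg (x a t r : R) : (x ^+ 2 + a - (x ^+ 2 * mu + 2 * x * t + r)) / 2 =
      (1 - mu) / 2 * x ^+ 2 + - t * x + (a - r) / 2 by field.
  exact: alg.
apply: le_trans (integral_gaussian_step_le gZ mh h0 mg hg) _.
have := IH (fun i => Z (l i)) (fun i => m (l i)) (schur M)
  (fun i j => W (l i) (l j)) (gaussian_family_tail gZ) (schur_sym symM)
  (schur_pos c0 symM posM) (schur_inv c0 symM posM WM).
set F := fun w => (expR _)%:E => IHF.
(* The factor exp (b^2 / (2 mu)) left by completing the square is exactly what turns the remaining
   block of [M] into its Schur complement. *)
have gE w : g (tail_tuple Z w) = ((Num.sqrt mu)^-1%:E * F w)%E.
  have alg (x y r a : R) : x ^+ 2 / (2 * mu) + (a - r) / 2 =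
      (a - (r - x ^+ 2 / mu)) / 2 by field; rewrite gt_eqF.
  rewrite /g /F -EFinM -mulrA -expRD bE qE.
  rewrite (quad_schur M (fun i => e w (l i))).
  congr (_ * expR _)%:E; exact: alg.
have mF : measurable_fun setT F.
  apply/measurable_EFinP; apply: measurableT_comp => //; apply: measurable_funM => //.
  have me i : measurable_fun setT (fun w => e w (l i)).
    by apply: measurable_funM => //; apply: measurable_funB => //; exact: gZ.1.
  apply: measurable_funB; first by apply: measurable_sum => i; exact/measurable_funX/me.
  apply: measurable_sum => i; apply: measurable_sum => j.
  by apply: measurable_funM => //; apply: measurable_funM; exact: me.
have F0 w : (0 <= F w)%E by rewrite lee_fin expR_ge0.
rewrite (eq_integral (fun w => (Num.sqrt mu)^-1%:E * F w)%E); last by move=> w _; exact: gE.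
rewrite ge0_integralZl //.
rewrite big_ord_recl expRD EFinM.
apply: lee_pmul => //.
- exact: integral_ge0.
- by rewrite lee_fin; apply: inv_sqrt_le_exp => //; exact: pivot_inv_le posM WM.
Qed.

End QuadraticExponential.

Lemma row_quadE (R : realType) (N : nat) (M : 'M[R]_N) (x : 'rV[R]_N) :
  (x *m M *m x^T) 0 0 = \sum_i \sum_j x 0 i * x 0 j * M i j.
Proof.
rewrite exchange_big mxE /=; apply: eq_bigr => j _; rewrite !mxE mulr_suml.
by apply: eq_bigr => i _; ring.
Qed.

Section ResolventTrace.
Context (R : realType) (N : nat) (A : 'M[R]_N).
Hypotheses (symA : A^T = A).
Hypothesis smallA : forall x : 'rV[R]_N,
  (x *m A *m x^T) 0 0 <= (x *m x^T) 0 0 / 4.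

Let M := 1%:M - 2 *: A.

Lemma sqnormE (x : 'rV[R]_N) : (x *m x^T) 0 0 = \sum_i x 0 i ^+ 2.
Proof. by rewrite mxE; apply: eq_bigr => i _; rewrite mxE expr2. Qed.

Lemma sqnorm_ge0 (x : 'rV[R]_N) : 0 <= (x *m x^T) 0 0.
Proof. by rewrite sqnormE sumr_ge0 // => i _; exact: sqr_ge0. Qed.

Lemma resolvent_pos (x : 'rV[R]_N) : (x *m x^T) 0 0 / 2 <= (x *m M *m x^T) 0 0.
Proof.
rewrite /M mulmxBr mulmx1 mulmxBl -scalemxAr -scalemxAl [X in _ <= X]mxE.
rewrite [X in _ + X]mxE [X in _ - X]mxE.
by have := smallA x; lra.
Qed.

Lemma resolvent_unit : M \in unitmx.
Proof.
rewrite -row_free_unit; apply/row_freeP.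
have: kermx M = 0.
  apply/row_matrixP => i; rewrite row0; set x := row i _.
  have xM : x *m M = 0.
    by rewrite /x -row_mul mulmx_ker row0.
  have := resolvent_pos x; rewrite xM mul0mx [X in _ <= X]mxE => H.
  have := sqnorm_ge0 x => H'.
  have {H H'} : (x *m x^T) 0 0 = 0 by lra.
  rewrite sqnormE => /eqP; rewrite psumr_eq0 => [/allP H|j _]; last exact: sqr_ge0.
  apply/rowP => j; apply/eqP; have := H j (mem_index_enum _).
  by rewrite sqrf_eq0 => /eqP ->; rewrite mxE.
by move=> /eqP; rewrite kermx_eq0 => /row_freeP.
Qed.

(** With y = x W, positivity of [M] gives |y|^2 <= 2 <x, y>; expanding |y - 2 x|^2 >= 0 then gives
    <x, y> <= 2 |x|^2. *)
Lemma resolvent_le (x : 'rV[R]_N) :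
  (x *m invmx M *m x^T) 0 0 <= 2 * (x *m x^T) 0 0.
Proof.
set y := x *m invmx M.
have yM : y *m M = x by rewrite /y mulmxKV // resolvent_unit.
clearbody y.
have yxE : (y *m x^T) 0 0 = \sum_i y 0 i * x 0 i.
  by rewrite mxE; apply: eq_bigr => i _; rewrite mxE.
have xyE : (x *m y^T) 0 0 = (y *m x^T) 0 0.
  by rewrite yxE mxE; apply: eq_bigr => i _; rewrite mxE mulrC.
have := resolvent_pos y; rewrite yM xyE yxE !sqnormE => H1.
have : 0 <= \sum_i (y 0 i - 2 * x 0 i) ^+ 2.
  by apply: sumr_ge0 => i _; exact: sqr_ge0.
have -> : \sum_i (y 0 i - 2 * x 0 i) ^+ 2 =
    \sum_i y 0 i ^+ 2 - 4 * (\sum_i y 0 i * x 0 i) + 4 * \sum_i x 0 i ^+ 2.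
  by rewrite !mulr_sumr -sumrB -big_split; apply: eq_bigr => i _ /=; ring.
lra.
Qed.

(** Expanding the inverse W of 1 - 2 A on both sides gives W = 1 + 2 A + 4 A W A; each diagonal
    entry of A W A is the form W at a row of A, at most twice its squared norm. *)
Lemma resolvent_trace :
  \sum_i (invmx M i i - 1) / 2 <= \sum_i A i i + 4 * \sum_i \sum_j A i j ^+ 2.
Proof.
pose W := invmx M; have uM := resolvent_unit.
have W1 : W = 1%:M + 2 *: (A *m W).
  have : M *m W = 1%:M by rewrite mulmxV.
  by rewrite /M mulmxBl mul1mx -scalemxAl => <-; rewrite subrK.
have W2 : W = 1%:M + 2 *: (W *m A).
  have : W *m M = 1%:M by rewrite mulVmx.
  by rewrite /M mulmxBr mulmx1 -scalemxAr => <-; rewrite subrK.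
have WE : W = 1%:M + 2 *: A + 4 *: (A *m W *m A).
  rewrite {1}W1 {1}W2 mulmxDr mulmx1 -scalemxAr scalerDr scalerA addrA mulmxA.
  by rewrite -natrM.
rewrite mulr_sumr -big_split /=; apply: ler_sum => i _.
rewrite -/W WE !mxE eqxx /=.
have -> : \sum_j (A *m W) i j * A j i = (row i A *m W *m (row i A)^T) 0 0.
  rewrite -row_mul mxE; apply: eq_bigr => j _.
  congr (_ * _); first by rewrite [RHS]mxE.
  by rewrite !mxE -[in LHS]symA mxE.
have := resolvent_le (row i A); rewrite -/W sqnormE.
have -> : \sum_j row i A 0 j ^+ 2 = \sum_j A i j ^+ 2.
  by apply: eq_bigr => j _; rewrite mxE.
by lra.
Qed.

End ResolventTrace.

Section GaussianMGF.
Context (R : realType) (d : measure_display) (Omega : measurableType d)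
  (P : probability Omega R) (I : finType) (Z : I -> Omega -> R) (m : I -> R)
  (s : R).

(** The law of [gaussian_family] over any finite index type: matrix entries are indexed by pairs,
    whereas the elimination of coordinates runs over ordinals. *)
Definition gaussian_field : Prop :=
  (forall a, measurable_fun setT (Z a)) /\
  (forall B : I -> set R, (forall a, measurable (B a)) ->
    P [set w | forall a, B a (Z a w)]%classic =
    (\prod_a normal_prob (m a) s (B a))%E).

Hypotheses (gZ : gaussian_field) (s0 : 0 < s).

Definition standardized a w := (Z a w - m a) / s.
Local Notation e := standardized.

Lemma measurable_standardized a : measurable_fun setT (e a).
Proof.
by apply: measurable_funM => //; apply: measurable_funB => //; exact: gZ.1.
Qed.

Lemma gaussian_field_family :
  gaussian_family P (fun i : 'I_#|I| => Z (enum_val i)) (fun i => m (enum_val i)) s.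
Proof.
have [mZ lawZ] := gZ; split=> [i|B mB]; first exact: mZ.
pose B' a := B (enum_rank a).
have B'E i : B' (enum_val i) = B i by rewrite /B' enum_valK.
transitivity (P [set w | forall a, B' a (Z a w)]%classic).
  congr (P _); apply/seteqP; split=> w H a; first by rewrite -(enum_rankK a) B'E.
  by rewrite -B'E.
rewrite lawZ; last by move=> a; exact: mB.
rewrite (reindex (@enum_val I predT)) /=; last exact: onW_bij (enum_val_bij _).
by apply: eq_bigr => i _; rewrite B'E.
Qed.

(** For M = 1 - 2 A the exponent (|e|^2 - e^T M e) / 2 is e^T A e. This is a Laplace bound of
    Hanson-Wright type: trace plus four times the squared Frobenius norm, as long as the form [A] is
    at most 1/4. *)
Lemma integral_exp_quad (A : I -> I -> R) :
  (forall a b, A a b = A b a) ->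
  (forall x : I -> R, \sum_a \sum_b x a * x b * A a b <= (\sum_a x a ^+ 2) / 4) ->
  (\int[P]_w (expR (\sum_a \sum_b e a w * e b w * A a b))%:E <=
   (expR (\sum_a A a a + 4 * \sum_a \sum_b A a b ^+ 2))%:E)%E.
Proof.
move=> symA smallA; pose v := @enum_val I predT.
have vbij := onW_bij (fun=> true) (enum_val_bij I).
pose B : 'M[R]_#|I| := \matrix_(i, j) A (v i) (v j).
have sumE (F : I -> R) : \sum_a F a = \sum_(i < #|I|) F (v i).
  exact: (reindex _ vbij).
have sum2E (F : I -> I -> R) : \sum_a \sum_b F a b =
    \sum_(i < #|I|) \sum_(j < #|I|) F (v i) (v j).
  by rewrite sumE; apply: eq_bigr => i _; rewrite sumE.
have symB : B^T = B by apply/matrixP => i j; rewrite !mxE symA.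
have smallB (x : 'rV[R]_#|I|) : (x *m B *m x^T) 0 0 <= (x *m x^T) 0 0 / 4.
  have := smallA (fun a => x 0 (enum_rank a)).
  rewrite sum2E sumE row_quadE sqnormE.
  rewrite (eq_bigr (fun i => \sum_j x 0 i * x 0 j * B i j)) => [|i _]; last first.
    by apply: eq_bigr => j _; rewrite !enum_valK mxE.
  by rewrite [X in _ <= X / 4](eq_bigr (fun i => x 0 i ^+ 2)) // => i _; rewrite enum_valK.
pose M := 1%:M - 2 *: B.
have H : (\int[P]_w (expR ((\sum_i e (v i) w ^+ 2 -
    \sum_i \sum_j e (v i) w * e (v j) w * M i j) / 2))%:E <=
    (expR (\sum_i (invmx M i i - 1) / 2))%:E)%E.
  apply: (integral_gaussian_quad (c := 2^-1) gaussian_field_family s0) => //.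
  - by move=> i j; rewrite !mxE symA eq_sym.
  - move=> x; have := resolvent_pos smallB (\row_i x i).
    rewrite -/M sqnormE mulrC.
    have -> : (\row_i x i *m M *m (\row_i x i)^T) 0 0 =
        \sum_i \sum_j x i * x j * M i j.
      rewrite row_quadE; apply: eq_bigr => i _; apply: eq_bigr => j _.
      by rewrite ![(\row_i x i) _ _]mxE.
    by under eq_bigr do rewrite mxE.
  - move=> i k; have /matrixP/(_ i k) := mulVmx (resolvent_unit smallB).
    by rewrite !mxE.
have -> : (\int[P]_w (expR (\sum_a \sum_b e a w * e b w * A a b))%:E =
  \int[P]_w (expR ((\sum_i e (v i) w ^+ 2 -
    \sum_i \sum_j e (v i) w * e (v j) w * M i j) / 2))%:E)%E.
  apply: eq_integral => w _; congr (expR _)%:E.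
  rewrite sum2E -sumrB mulr_suml; apply: eq_bigr => i _.
  have -> : e (v i) w ^+ 2 = \sum_j (i == j)%:R * (e (v i) w * e (v j) w).
    rewrite (bigD1 i) //= eqxx mul1r big1 ?addr0 // => j /negbTE.
    by rewrite eq_sym => ->; rewrite mul0r.
  rewrite -sumrB mulr_suml; apply: eq_bigr => j _.
  by rewrite !mxE; field.
apply: le_trans H _; rewrite lee_fin ler_expR.
apply: le_trans (resolvent_trace symB smallB) _.
rewrite sum2E sumE le_eqVlt; apply/orP; left; apply/eqP.
congr (_ + 4 * _); first by apply: eq_bigr => i _; rewrite mxE.
by apply: eq_bigr => i _; apply: eq_bigr => j _; rewrite mxE.
Qed.

End GaussianMGF.

(** * Tail bounds *)

(** Stated through a measurable superset, so that failure events with quantifiers inside need no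
    measurability proof of their own. *)
Definition rare (R : realType) (d : measure_display) (Omega : measurableType d)
    (P : probability Omega R) (A : set Omega) (c : R) : Prop :=
  exists B : set Omega, [/\ measurable B, (A `<=` B)%classic & (P B <= c%:E)%E].

Section Rare.
Context (R : realType) (d : measure_display) (Omega : measurableType d)
  (P : probability Omega R).

Lemma rareW (A : set Omega) (c c' : R) : c <= c' -> rare P A c -> rare P A c'.
Proof. by move=> cc' [B [mB AB PB]]; exists B; split=> //; exact: le_trans PB _. Qed.

Lemma rare_sub (A A' : set Omega) (c : R) :
  (A `<=` A')%classic -> rare P A' c -> rare P A c.
Proof. by move=> AA' [B [mB AB PB]]; exists B; split=> // w /AA'/AB. Qed.

Lemma rareU (A A' : set Omega) (c c' : R) :
  rare P A c -> rare P A' c' -> rare P (A `|` A')%classic (c + c').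
Proof.
move=> [B [mB AB PB]] [B' [mB' AB' PB']]; exists (B `|` B')%classic; split.
- exact: measurableU.
- exact: setUSS.
- by apply: le_trans (measureU2 _ mB mB') _; rewrite EFinD leeD.
Qed.

Lemma rare_bigU (I : finType) (Q : pred I) (A : I -> set Omega) (c : I -> R) :
  (forall i, Q i -> rare P (A i) (c i)) ->
  rare P [set w | exists2 i, Q i & A i w]%classic (\sum_(i | Q i) c i).
Proof.
move=> rA.
have aux (r : seq I) : rare P [set w | exists2 i, (i \in r) && Q i & A i w]%classic
    (\sum_(i <- r | Q i) c i).
  elim: r => [|i r IH].
    rewrite big_nil; exists set0; split=> //; first by move=> w [].
    by rewrite measure0.
  rewrite big_cons; case: ifP => Qi.
    apply: rare_sub (rareU (rA i Qi) IH) => w [j]; rewrite inE.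
    by move=> /andP[/orP[/eqP -> _|jr Qj]] Aj; [left|right; exists j => //; rewrite jr].
  apply: rare_sub IH => w [j]; rewrite inE => /andP[/orP[/eqP ->|jr Qj]] Aj.
    by rewrite Qi in Aj.
  by exists j => //; rewrite jr.
apply: rare_sub (aux (index_enum I)) => w [i Qi Ai].
by exists i => //; rewrite mem_index_enum.
Qed.

Lemma rare_prob (A : set Omega) (c : R) : measurable A ->
  rare P (~` A)%classic c -> ((1 - c)%:E <= P A)%E.
Proof.
move=> mA [B [mB AB PB]].
have : (P (~` A)%classic <= c%:E)%E.
  by apply: le_trans PB; apply: le_measure; rewrite ?inE //; exact: measurableC.
rewrite probability_setC //.
have [r ->] : exists r, P A = r%:E by exists (fine (P A)); rewrite fineK ?fin_num_measure.
by rewrite -EFinB !lee_fin; lra.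
Qed.

End Rare.

Section Tails.
Context (R : realType) (d : measure_display) (Omega : measurableType d)
  (P : probability Omega R).

Lemma measurable_le_set (f g : Omega -> R) :
  measurable_fun setT f -> measurable_fun setT g ->
  measurable [set w | f w <= g w]%classic.
Proof.
move=> mf mg.
rewrite (_ : [set _ | _]%classic = ((fun w => g w - f w) @^-1` `[0, +oo[)%classic).
  by rewrite -[X in measurable X]setTI; apply: measurable_funB.
by apply/seteqP; split=> w /=; rewrite in_itv /= andbT subr_ge0.
Qed.

Lemma exp_tail (F : Omega -> R) (c x : R) :
  measurable_fun setT F -> (\int[P]_w (expR (F w))%:E <= (expR c)%:E)%E ->
  rare P [set w | c + x <= F w]%classic (expR (- x)).
Proof.
move=> mF cF; set A := [set _ | _]%classic.
have mA : measurable A by exact: measurable_le_set.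
exists A; split=> //.
have mexp : measurable_fun setT (fun w => (expR (F w))%:E).
  by apply/measurable_EFinP; exact: measurableT_comp.
have -> : P A = (\int[P]_w (\1_A w)%:E)%E by rewrite integral_indic // setIT.
apply: (@le_trans _ _ (\int[P]_w ((expR (- (c + x)))%:E * (expR (F w))%:E))%E).
  apply: ge0_le_integral => //.
  - exact/measurable_EFinP/measurable_indic.
  - exact: emeasurable_funM.
  - move=> w _; rewrite -EFinM lee_fin -expRD indicE.
    case: (boolP (w \in A)) => [|_]; last exact: expR_ge0.
    by rewrite inE /A /= => cxF; rewrite -expR0 ler_expR addrC subr_ge0.
rewrite ge0_integralZl //.
apply: le_trans (lee_wpmul2l _ cF) _; first by rewrite lee_fin expR_ge0.
by rewrite -EFinM -expRD lee_fin ler_expR; lra.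
Qed.

Context (I : finType) (Z : I -> Omega -> R) (m : I -> R) (s : R).
Hypotheses (gZ : gaussian_field P Z m s) (s0 : 0 < s).
Local Notation e := (standardized Z m s).

Lemma integral_field_prod (h : I -> R -> R) (c : I -> R) :
  (forall a, measurable_fun setT (h a)) -> (forall a x, 0 <= h a x) ->
  (forall a, \int[normalR (m a) s]_x (h a x)%:E <= (c a)%:E)%E ->
  (\int[P]_w (\prod_a h a (Z a w))%:E <= (\prod_a c a)%:E)%E.
Proof.
move=> mh h0 hc.
have vbij := onW_bij (fun=> true) (enum_val_bij I).
rewrite (reindex _ vbij) /=.
rewrite (eq_integral (fun w => (\prod_(i < #|I|)
  h (enum_val i) (Z (enum_val i) w))%:E)); last by move=> w _; rewrite (reindex _ vbij).
by apply: (integral_gaussian_prod (h := fun i => h (enum_val i))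
  (gaussian_field_family gZ)).
Qed.

Lemma integral_exp_linear (b : I -> R) :
  (\int[P]_w (expR (\sum_a b a * e a w))%:E <=
   (expR ((\sum_a b a ^+ 2) / 2))%:E)%E.
Proof.
rewrite (eq_integral (fun w => (\prod_a expR (b a * ((Z a w - m a) / s)))%:E)).
  rewrite mulr_suml expR_sum.
  apply: (integral_field_prod (h := fun a x => expR (b a * ((x - m a) / s)))).
  - move=> a; apply: measurableT_comp => //; apply: measurable_funM => //.
    by apply: measurable_funM => //; exact: measurable_funB.
  - by move=> a x; exact: expR_ge0.
  - move=> a; have := @integral_normal_exp R (m a) s 1 (b a) s0 ltr01.
    rewrite sqrtr1 invr1 mul1r mulr1 => <-; rewrite le_eqVlt; apply/orP; left.
    by apply/eqP; apply: eq_integral => x _; rewrite subrr !mul0r add0r.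
by move=> w _; rewrite expR_sum.
Qed.

(** A nonzero mean can only decrease the integral: completing the square leaves a factor exp (- v
    k^2 / u), at most 1. Lower tails of column norms thus hold whatever signal the columns carry. *)
Lemma integral_normal_expN (mm v : R) : 0 <= v ->
  (\int[normalR mm s]_x (expR (- (v * (x / s) ^+ 2)))%:E <=
   ((Num.sqrt (1 + 2 * v))^-1)%:E)%E.
Proof.
move=> v0; pose u := 1 + 2 * v; pose k := mm / s.
have u0 : 0 < u by rewrite /u; lra.
rewrite (eq_integral (fun x : R => ((expR (- (v * k ^+ 2)))%:E * (expR ((1 - u) / 2 * ((x - mm) / s) ^+ 2 + (- 2 * v * k) * ((x - mm) / s)))%:E)%E)); last first.
  move=> x _; rewrite -EFinM -expRD; congr (expR _)%:E.
  by rewrite /u /k; field; rewrite gt_eqF.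
rewrite ge0_integralZl //.
- rewrite integral_normal_exp // -EFinM lee_fin mulrCA ler_piMr ?invr_ge0 ?sqrtr_ge0 //.
  rewrite -expRD -[leRHS]expR0 ler_expR.
  have -> : - (v * k ^+ 2) + (- 2 * v * k) ^+ 2 / (2 * u) = - (v * k ^+ 2 / u).
    by rewrite /u; field; rewrite gt_eqF.
  by rewrite oppr_le0; apply: divr_ge0; [rewrite mulr_ge0 // sqr_ge0|exact: ltW].
- apply/measurable_EFinP; apply: measurableT_comp => //.
  have mx : measurable_fun setT (fun x : R => (x - mm) / s).
    by apply: measurable_funM => //; exact: measurable_funB.
  by apply: measurable_funD; apply: measurable_funM => //; exact: measurable_funX.
Qed.

Lemma integral_exp_sqnorm (S : {set I}) (v : R) : 0 <= v ->
  (\int[P]_w (expR (- (v * \sum_(a in S) (Z a w / s) ^+ 2)))%:E <=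
   (expR (- (#|S|%:R / 2 * ln (1 + 2 * v))))%:E)%E.
Proof.
move=> v0; pose h a x := if a \in S then expR (- (v * (x / s) ^+ 2)) else 1.
rewrite (eq_integral (fun w => (\prod_a h a (Z a w))%:E)); last first.
  move=> w _; rewrite -mulNr mulr_sumr expR_sum /h big_mkcond /=.
  by congr (_)%:E; apply: eq_bigr => a _; case: ifP => //; rewrite mulNr.
have u0 : 0 < 1 + 2 * v by lra.
apply: (@le_trans _ _ (\prod_a (if a \in S then (Num.sqrt (1 + 2 * v))^-1 else 1))%:E).
  apply: integral_field_prod => [a|a x|a].
  - rewrite /h; case: (a \in S) => //; apply: measurableT_comp => //.
    apply: measurableT_comp => //; apply: measurable_funM => //.
    by apply: measurable_funX; exact: measurable_funM.
  - by rewrite /h; case: (a \in S) => //; exact: expR_ge0.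
  - rewrite /h; case: (a \in S); first exact: integral_normal_expN.
    rewrite (integral_cst _ measurableT) mul1e.
    exact: (probability_le1 _ measurableT).
rewrite -big_mkcond /= prodr_const lee_fin.
have -> : (Num.sqrt (1 + 2 * v))^-1 = expR (- (ln (1 + 2 * v) / 2)).
  by rewrite -powR12_sqrt ?ltW // /powR gt_eqF // expRN mulrC.
rewrite -expRM_natl ler_expR le_eqVlt; apply/orP; left; apply/eqP; ring.
Qed.

End Tails.

(** * Projections attached to a labelling *)

Section Projection.
Context (R : realType) (n K : nat).
Implicit Types (f g : 'I_n -> 'I_K) (y : 'I_n -> R).

Definition clsize f k := #|[set j | f j == k]|.

(* Entries of the orthogonal projection onto the vectors that are constant on
   the level sets of [f]. *)
Definition level_proj f (i j : 'I_n) : R := (f i == f j)%:R / (clsize f (f i))%:R.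

Lemma clsize_gt0 f i : 0 < (clsize f (f i))%:R :> R.
Proof. by rewrite ltr0n card_gt0; apply/set0Pn; exists i; rewrite inE. Qed.

Lemma proj_sym f i j : level_proj f i j = level_proj f j i.
Proof. by rewrite /level_proj eq_sym; case: eqP => [->|_]; rewrite ?mul0r. Qed.

Lemma proj_ge0 f i j : 0 <= level_proj f i j.
Proof. by rewrite divr_ge0. Qed.

Lemma sum_eqf f k : \sum_i (k == f i)%:R = (clsize f k)%:R :> R.
Proof.
rewrite -natr_sum; congr _%:R; rewrite /clsize -sum1_card big_mkcond /=.
by rewrite [RHS]big_mkcond; apply: eq_bigr => i _; rewrite inE eq_sym; case: eqP.
Qed.

Lemma proj_row f i : \sum_j level_proj f i j = 1.
Proof. by rewrite -mulr_suml sum_eqf divff // gt_eqF // clsize_gt0. Qed.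

Lemma proj_idem f i k : \sum_j level_proj f i j * level_proj f j k = level_proj f i k.
Proof.
transitivity (\sum_j level_proj f i j * level_proj f i k).
  apply: eq_bigr => j _; rewrite /level_proj.
  by case: eqP => [->|_] //; rewrite !mul0r.
by rewrite -mulr_suml proj_row mul1r.
Qed.

Lemma proj_const f y : (forall i j, f i = f j -> y i = y j) ->
  forall i, \sum_j level_proj f i j * y j = y i.
Proof.
move=> yf i; rewrite -[RHS]mul1r -(proj_row f i) mulr_suml.
apply: eq_bigr => j _; rewrite /level_proj; case: eqP => [/yf ->//|_].
by rewrite !mul0r.
Qed.

Lemma proj_trace f : (forall k, exists i, f i = k) -> \sum_i level_proj f i i = K%:R.
Proof.
move=> surj; rewrite (partition_big f predT) //= -[in RHS](card_ord K).
rewrite -sum1_card natr_sum; apply: eq_bigr => k _.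
have [i0 fi0] := surj k.
transitivity (\sum_(i < n | f i == k) (clsize f k)%:R^-1 : R).
  by apply: eq_bigr => i /eqP <-; rewrite /level_proj eqxx mul1r.
rewrite sumr_const -[_ *+ _]mulr_natl -cardsE -/(clsize f k) divff //.
by rewrite -fi0 gt_eqF // clsize_gt0.
Qed.

(** This is |P_f y|^2, by idempotence; written this way it is linear in the kernel. *)
Definition quad f y := \sum_i \sum_j level_proj f i j * (y i * y j).

(** As the rows of the projection sum to 1, the residual energy is a Dirichlet form. A pair merged
    by [f] but separated in truth thus pays its own squared distance. *)
Lemma sqr_sub_quad f y :
  \sum_i y i ^+ 2 - quad f y = (\sum_i \sum_j level_proj f i j * (y i - y j) ^+ 2) / 2.
Proof.
have e1 : \sum_i \sum_j level_proj f i j * y i ^+ 2 = \sum_i y i ^+ 2.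
  by apply: eq_bigr => i _; rewrite -mulr_suml proj_row mul1r.
have e2 : \sum_i \sum_j level_proj f i j * y j ^+ 2 = \sum_i y i ^+ 2.
  rewrite exchange_big -[RHS]e1; apply: eq_bigr => j _; apply: eq_bigr => i _.
  by rewrite proj_sym.
have -> : \sum_i \sum_j level_proj f i j * (y i - y j) ^+ 2 =
    \sum_i \sum_j level_proj f i j * y i ^+ 2 + \sum_i \sum_j level_proj f i j * y j ^+ 2
    - 2 * quad f y.
  rewrite mulr_sumr -big_split -sumrB; apply: eq_bigr => i _ /=.
  rewrite mulr_sumr -big_split -sumrB; apply: eq_bigr => j _ /=; ring.
by rewrite e1 e2; field.
Qed.

Lemma quad_le f y : quad f y <= \sum_i y i ^+ 2.
Proof.
rewrite -subr_ge0 sqr_sub_quad divr_ge0 // sumr_ge0 // => i _.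
by rewrite sumr_ge0 // => j _; rewrite mulr_ge0 ?proj_ge0 ?sqr_ge0.
Qed.

Lemma quad_sqr f y : quad f y = \sum_i (\sum_j level_proj f i j * y j) ^+ 2.
Proof.
have -> : \sum_i (\sum_j level_proj f i j * y j) ^+ 2 =
    \sum_i \sum_j \sum_k (level_proj f j i * level_proj f i k) * (y j * y k).
  apply: eq_bigr => i _; rewrite expr2 mulr_suml; apply: eq_bigr => j _.
  rewrite mulr_sumr; apply: eq_bigr => k _; rewrite (proj_sym f i j); ring.
rewrite exchange_big; apply: eq_bigr => j _; rewrite exchange_big.
by apply: eq_bigr => k _; rewrite -mulr_suml proj_idem.
Qed.

Lemma quad_ge0 f y : 0 <= quad f y.
Proof. by rewrite quad_sqr sumr_ge0 // => i _; exact: sqr_ge0. Qed.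

Definition resid f y i := y i - \sum_j level_proj f i j * y j.

Lemma resid_sqr f y : \sum_i resid f y i ^+ 2 = \sum_i y i ^+ 2 - quad f y.
Proof.
have -> : \sum_i resid f y i ^+ 2 = \sum_i y i ^+ 2
    - 2 * (\sum_i \sum_j level_proj f i j * (y i * y j)) +
    \sum_i (\sum_j level_proj f i j * y j) ^+ 2.
  rewrite mulr_sumr -sumrB -big_split; apply: eq_bigr => i _ /=.
  have -> : \sum_j level_proj f i j * (y i * y j) = y i * \sum_j level_proj f i j * y j.
    by rewrite mulr_sumr; apply: eq_bigr => j _; ring.
  by rewrite /resid; ring.
by rewrite -quad_sqr -/(quad f y); ring.
Qed.

(* Controls both the signal lost by projecting along [f] instead of [g] and
   the distance between the two projections. *)
Definition impurity f g := \sum_i \sum_j level_proj f i j * (g i != g j)%:R.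

(** Both projections have squared norm K, which leaves 2 (K - <P_f, P_g>). Writing K as the sum of
    P_f(i,j) P_g(i,i) cancels all pairs with [g i = g j]; every other pair costs at most P_f(i,j) /
    b. *)
Lemma proj_frobenius f g (b : R) :
  (forall k, exists i, f i = k) -> (forall k, exists i, g i = k) ->
  0 < b -> (forall k, b <= (clsize g k)%:R) ->
  \sum_i \sum_j (level_proj f i j - level_proj g i j) ^+ 2 <= 2 * impurity f g / b.
Proof.
move=> sf sg b0 bg.
have sq h : (forall k, exists i, h i = k) -> \sum_i \sum_j level_proj h i j ^+ 2 = K%:R.
  move=> sh; rewrite -(proj_trace sh); apply: eq_bigr => i _.
  rewrite -[RHS](proj_idem h); apply: eq_bigr => j _.
  by rewrite (proj_sym h j i) expr2.
have trg : \sum_i \sum_j level_proj f i j * level_proj g i i = K%:R.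
  rewrite -(proj_trace sg); apply: eq_bigr => i _.
  by rewrite -mulr_suml proj_row mul1r.
have -> : \sum_i \sum_j (level_proj f i j - level_proj g i j) ^+ 2 =
    \sum_i \sum_j level_proj f i j ^+ 2 + \sum_i \sum_j level_proj g i j ^+ 2 -
    2 * \sum_i \sum_j level_proj f i j * level_proj g i j.
  rewrite mulr_sumr -big_split -sumrB; apply: eq_bigr => i _ /=.
  rewrite mulr_sumr -big_split -sumrB; apply: eq_bigr => j _ /=; ring.
rewrite !sq // -trg -mulrA.
have -> : forall a c : R, a + a - 2 * c = 2 * (a - c) by move=> *; ring.
apply: ler_wpM2l => //; rewrite -sumrB mulr_suml; apply: ler_sum => i _.
rewrite -sumrB mulr_suml; apply: ler_sum => j _.
rewrite -mulrBr -mulrA; apply: ler_wpM2l; first exact: proj_ge0.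
rewrite /level_proj eqxx -mulrBl; case: eqP => /= _; first by rewrite subrr !mul0r.
by rewrite subr0 !mul1r lef_pV2 ?posrE ?clsize_gt0.
Qed.

End Projection.

(** * Matching two labellings up to a permutation of the labels *)

Section PartialInjection.
Local Open Scope set_scope.

(** The complements of [B] and of its image have the same cardinality and are matched in the order
    of enumeration. *)
Lemma extend_partial_injection (T : finType) (B : {set T}) (h : T -> T) :
  {in B &, injective h} ->
  exists2 p : T -> T, injective p & {in B, p =1 h}.
Proof.
move=> injh; pose C := h @: B.
have cardC : #|~: B| = #|~: C|.
  have := cardsC B; have := cardsC C; rewrite card_in_imset // => <-.
  by move/addnI.
case: (set_0Vmem (~: B)) => [B0|[x0 _]].
  have BT x : x \in B by move/setP/(_ x): B0; rewrite !inE => /negbFE.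
  by exists h => // x y /injh; apply.
pose p x := if x \in B then h x else nth x0 (enum (~: C)) (index x (enum (~: B))).
have pB x : x \in B -> p x \in C by move=> xB; rewrite /p xB; exact: imset_f.
have idx x : x \notin B -> (index x (enum (~: B)) < size (enum (~: C)))%N.
  by move=> xB; rewrite -cardE -cardC cardE index_mem mem_enum inE.
have pNB x : x \notin B -> p x \notin C.
  move=> xB; rewrite /p (negbTE xB).
  by have := mem_nth x0 (idx _ xB); rewrite mem_enum inE.
exists p; last by move=> x xB; rewrite /p xB.
move=> x y; case: (boolP (x \in B)) (boolP (y \in B)) => xB [] yB pxy.
- by move: pxy; rewrite /p xB yB; exact: injh.
- by have := pNB _ yB; rewrite -pxy pB.
- by have := pNB _ xB; rewrite pxy pB.
- move: pxy; rewrite /p (negbTE xB) (negbTE yB) => /eqP.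
  rewrite nth_uniq ?enum_uniq ?idx // => /eqP.
  have xE : x \in enum (~: B) by rewrite mem_enum inE.
  have yE : y \in enum (~: B) by rewrite mem_enum inE.
  by move=> e; rewrite -(nth_index x0 xE) e nth_index.
Qed.

End PartialInjection.

Section Relabeling.
Context (R : realType) (n K : nat).
Implicit Types (f g : 'I_n -> 'I_K).

Definition hamming f g := #|[set i | f i != g i]%SET|.

Lemma card_preim_set f (S : {set 'I_K}) :
  #|[set i | f i \in S]%SET| = (\sum_(k in S) clsize f k)%N.
Proof.
rewrite -sum1_card (partition_big f (mem S)) /=; last by move=> i; rewrite inE.
apply: eq_bigr => k kS; rewrite /clsize -sum1_card; apply: eq_bigl => i.
by rewrite !inE andbC; case: eqP => [->|]; rewrite ?kS.
Qed.

(** The quantity [n] minus the impurity sums, over the points, the fraction of their [f]-group that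
    shares their [g]-label. That fraction is at most the share of the majority label, and summing
    this share over a group counts its majority points. *)
Lemma majority_impurity f g (l : 'I_K -> 'I_K) :
  (forall k k', #|[set i | (f i == k) && (g i == k')]%SET| <=
                #|[set i | (f i == k) && (g i == l k)]%SET|)%N ->
  #|[set i | l (f i) != g i]%SET|%:R <= impurity R f g :> R.
Proof.
move=> lmax; pose m k := #|[set i | (f i == k) && (g i == l k)]%SET|.
have impE : impurity R f g = n%:R - \sum_i \sum_j level_proj R f i j * (g i == g j)%:R :> R.
  have -> : n%:R = \sum_(i < n) 1 :> R by rewrite sumr_const card_ord.
  rewrite -sumrB; apply: eq_bigr => i _.
  rewrite -[X in _ = X - _](proj_row R f i) -sumrB; apply: eq_bigr => j _.
  by case: eqP => _ /=; rewrite ?mulr1 ?mulr0 ?subrr ?subr0.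
have rowE i : \sum_j level_proj R f i j * (g i == g j)%:R =
    #|[set j | (f j == f i) && (g j == g i)]%SET|%:R / (clsize f (f i))%:R :> R.
  rewrite -sum1_card natr_sum mulr_suml [RHS]big_mkcond; apply: eq_bigr => j _.
  rewrite /level_proj inE [f i == _]eq_sym [g i == _]eq_sym.
  by case: eqP; case: eqP; rewrite ?mul0r ?mulr0 ?mulr1.
have : \sum_i \sum_j level_proj R f i j * (g i == g j)%:R <=
    #|[set i | l (f i) == g i]%SET|%:R :> R.
  apply: (@le_trans _ _ (\sum_i (m (f i))%:R / (clsize f (f i))%:R)).
    apply: ler_sum => i _; rewrite rowE ler_wpM2r ?invr_ge0 //.
    by rewrite ler_nat lmax.
  rewrite (partition_big f predT) //=.
  rewrite -sum1_card natr_sum (partition_big f predT) //=.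
  apply: ler_sum => k _.
  have [i0 fi0|nok] := pickP (fun i => f i == k); last first.
    by rewrite big_pred0 // sumr_ge0.
  have fk0 : 0 < (clsize f k)%:R :> R by rewrite -(eqP fi0) clsize_gt0.
  rewrite (eq_bigr (fun=> (m k)%:R / (clsize f k)%:R)) => [|i /eqP -> //].
  rewrite sumr_const -[_ *+ _]mulr_natr -cardsE -/(clsize f k) divfK ?gt_eqF //.
  rewrite -natr_sum ler_nat sum1_card; apply: subset_leq_card.
  apply/fintype.subsetP => i; rewrite !inE => /andP[/eqP fi /eqP gi]. by rewrite unfold_in inE fi gi !eqxx.
rewrite impE => H; rewrite lerBrDr -lerBrDl; apply: le_trans H _.
have : (#|[set i | l (f i) == g i]%SET| + #|[set i | l (f i) != g i]%SET|)%N = n.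
  rewrite -[RHS](card_ord n) -(cardsC [set i | l (f i) == g i]%SET); congr (_ + _)%N.
  by apply: eq_card => i; rewrite !inE.
by move/(congr1 (fun k => k%:R : R)) <-; rewrite natrD addrK.
Qed.

(* Send each group of [f] to its majority group of [g].  This map is injective
   outside the groups of [g] hit several times, which are at most as many as
   the groups never hit; by balance the former weigh at most [gamma] times the
   latter, all of whose points are misclassified. *)
Lemma relabeling f g (b gamma : R) :
  (forall k, exists i, f i = k) ->
  0 <= gamma -> (forall k, b <= (clsize g k)%:R <= gamma * b) ->
  exists2 p : 'I_K -> 'I_K, injective p &
    (hamming (p \o f) g)%:R <= (1 + gamma) * impurity R f g.
Proof.
move=> surj gamma0 bal.
pose cnt k k' := #|[set i | (f i == k) && (g i == k')]%SET|.
have lmaxP k : exists l, [forall k', (cnt k k' <= cnt k l)%N].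
  have [//|l _ lmax] := @arg_maxnP _ k predT (cnt k).
  by exists l; apply/forallP => k'; exact: lmax.
pose l k := xchoose (lmaxP k).
have lmax k k' : (cnt k k' <= cnt k (l k))%N.
  by move/forallP: (xchooseP (lmaxP k)); apply.
have eD := majority_impurity lmax.
set e := #|_|%:R in eD.
pose pre k' := #|[set k | l k == k']%SET|.
pose A := [set k | pre (l k) == 1%N]%SET.
have lA : {in A &, injective l}.
  move=> k1 k2; rewrite !inE => /cards1P[k0 e0] _ l12.
  have : k1 \in [set k | l k == l k1]%SET by rewrite inE.
  have : k2 \in [set k | l k == l k1]%SET by rewrite inE l12.
  by rewrite e0 !inE => /eqP -> /eqP ->.
have [p injp pA] := extend_partial_injection lA.
exists p => //.
pose Z := [set k' | pre k' == 0%N]%SET; pose M := [set k' | (1 < pre k')%N]%SET.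
have MZ : (#|M| <= #|Z|)%N.
  have sumpre : (\sum_k' pre k' = K)%N.
    rewrite -[RHS](card_ord K) -sum1_card [RHS](partition_big l predT) //=.
    apply: eq_bigr => k' _; rewrite /pre -sum1_card; apply: eq_bigl => k.
    by rewrite inE.
  (* The numbers of preimages sum to K, one per label on average, and pre + [pre = 0] >= 1 +
     [pre > 1] holds for each label. *)
  have : (\sum_k' (pre k' + (k' \in Z)) >= \sum_k' (1 + (k' \in M)))%N.
    by apply: leq_sum => k' _; rewrite !inE; case: (pre k') => [|[|m]].
  rewrite !big_split /= sumpre sum1_card card_ord leq_add2l.
  have sumb (S : {set 'I_K}) : (\sum_k' (k' \in S) = #|S|)%N.
    by rewrite -sum1_card [RHS]big_mkcond; apply: eq_bigr => k' _; case: ifP.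
  by rewrite !sumb.
have MN : #|[set i | g i \in M]%SET|%:R <= gamma * #|[set i | g i \in Z]%SET|%:R :> R.
  have [->|[k0 _]] := set_0Vmem M.
    by rewrite (eq_card0 (A := [set i | _]%SET)) => [|i]; rewrite ?inE ?mulr_ge0.
  have gb0 : 0 <= gamma * b by have /andP[_] := bal k0; exact: le_trans.
  rewrite !card_preim_set !natr_sum mulr_sumr.
  apply: (@le_trans _ _ (\sum_(k in Z) gamma * b)); last first.
    by apply: ler_sum => k _; apply: ler_wpM2l => //; have /andP[] := bal k.
  apply: (@le_trans _ _ (\sum_(k in M) gamma * b)).
    by apply: ler_sum => k _; have /andP[] := bal k.
  by rewrite !sumr_const ler_wpMn2l.
have Ze : (#|[set i | g i \in Z]%SET| <= #|[set i | l (f i) != g i]%SET|)%N.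
  apply: subset_leq_card; apply/fintype.subsetP => i; rewrite !inE => /eqP z.
  apply/eqP => lfi; have := cards0_eq z => /setP/(_ (f i)).
  by rewrite !inE lfi eqxx.
have ham : (hamming (p \o f) g <= #|[set i | l (f i) != g i]%SET| + #|[set i | g i \in M]%SET|)%N.
  apply: leq_trans (leq_card_setU _ _); apply: subset_leq_card.
  apply/fintype.subsetP => i; rewrite !inE /=; case: (eqVneq (l (f i)) (g i)) => //= lfi.
  apply: contraNT; rewrite -leqNgt -lfi => pre1; rewrite pA //.
  rewrite inE eqn_leq pre1 card_gt0; apply/set0Pn; exists (f i).
  by rewrite inE.
apply: (@le_trans _ _ (e + gamma * e)).
  apply: le_trans (_ : (#|[set i | l (f i) != g i]%SET| + #|[set i | g i \in M]%SET|)%:R <= _).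
    by rewrite ler_nat.
  rewrite natrD lerD2l; apply: le_trans MN _.
  by rewrite ler_wpM2l // ler_nat.
by rewrite mulrDl mul1r lerD // ler_wpM2l.
Qed.

End Relabeling.

Lemma measurable_sum_in (R : realType) (d : measure_display)
    (T : measurableType d) (J : finType) (S : {set J}) (h : J -> T -> R) :
  (forall j, measurable_fun setT (h j)) ->
  measurable_fun setT (fun x => \sum_(j in S) h j x).
Proof.
move=> mh; under eq_fun do rewrite big_mkcond.
by apply: measurable_sum => j; case: (j \in S).
Qed.

(** * Tails of linear and quadratic functions of the noise matrix *)

Section NoiseTails.
Context (R : realType) (d : measure_display) (Omega : measurableType d)
  (P : probability Omega R) (n p : nat) (Z : 'I_n * 'I_p -> Omega -> R)
  (X : 'I_n * 'I_p -> R) (s : R).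
Hypotheses (gZ : gaussian_field P Z X s) (s0 : 0 < s).
Local Notation e := (standardized Z X s).

Lemma pair_sum (F : 'I_n * 'I_p -> R) : \sum_a F a = \sum_j \sum_i F (i, j).
Proof.
by rewrite [RHS]exchange_big pair_bigA; apply: eq_bigr => -[i j] _.
Qed.

(** The kernel [v B] repeated on the columns of [T] is a block-diagonal form bounded by 1/4. The
    inequality is not divided by the rate [v], so that a negative [v] yields the lower tail. *)
Lemma kernel_tail (B : 'I_n -> 'I_n -> R) (T : {set 'I_p}) (v x : R) :
  (forall i j, B i j = B j i) ->
  (forall y : 'I_n -> R, `|\sum_i \sum_i' B i i' * (y i * y i')| <= \sum_i y i ^+ 2) ->
  `|v| <= 4^-1 ->
  rare P [set w | v * (#|T|%:R * \sum_i B i i) +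
        4 * v ^+ 2 * (#|T|%:R * \sum_i \sum_i' B i i' ^+ 2) + x <=
      v * \sum_(j in T) \sum_i \sum_i' B i i' * (e (i, j) w * e (i', j) w)]%classic
   (expR (- x)).
Proof.
move=> symB smallB v4.
pose A (a b : 'I_n * 'I_p) := (a.2 == b.2)%:R * (a.2 \in T)%:R * (v * B a.1 b.1).
have sumA (F : 'I_n * 'I_p -> 'I_n * 'I_p -> R) :
    \sum_a \sum_b (a.2 == b.2)%:R * (a.2 \in T)%:R * F a b =
    \sum_(j in T) \sum_i \sum_i' F (i, j) (i', j).
  rewrite pair_sum [RHS]big_mkcond; apply: eq_bigr => j _ /=.
  rewrite -[RHS]mulrb -[RHS]mulr_natl mulr_sumr; apply: eq_bigr => i _.
  rewrite pair_sum (bigD1 j) //= [X in _ + X]big1 ?addr0 => [|j' j'j]; last first.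
    by rewrite big1 // => i' _; rewrite eq_sym (negbTE j'j) !mul0r.
  by rewrite mulr_sumr; apply: eq_bigr => i' _; rewrite eqxx mul1r.
have sumTc (c : R) : \sum_(j in T) c = #|T|%:R * c.
  by rewrite sumr_const mulr_natl.
have quadA (x' : 'I_n * 'I_p -> R) : \sum_a \sum_b x' a * x' b * A a b =
    v * \sum_(j in T) \sum_i \sum_i' B i i' * (x' (i, j) * x' (i', j)).
  transitivity (\sum_a \sum_b (a.2 == b.2)%:R * (a.2 \in T)%:R *
      (v * (B a.1 b.1 * (x' a * x' b)))).
    by apply: eq_bigr => a _; apply: eq_bigr => b _; rewrite /A; ring.
  rewrite sumA mulr_sumr; apply: eq_bigr => j _; rewrite mulr_sumr.
  by apply: eq_bigr => i _; rewrite mulr_sumr.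
have symA a b : A a b = A b a.
  rewrite /A symB eq_sym; case: eqP => [<-//|_]; by rewrite !mul0r.
have smallA (x' : 'I_n * 'I_p -> R) :
    \sum_a \sum_b x' a * x' b * A a b <= (\sum_a x' a ^+ 2) / 4.
  rewrite quadA mulrC mulr_suml pair_sum mulr_suml big_mkcond; apply: ler_sum => j _ /=.
  have H := smallB (fun i => x' (i, j)).
  case: ifP => _; last first.
    by rewrite sumr_ge0 // => i _; rewrite divr_ge0 // sqr_ge0.
  rewrite -mulr_suml.
  by apply: le_trans (ler_norm _) _; rewrite normrM ler_pM.
have H := integral_exp_quad gZ s0 symA smallA.
have -> : v * (#|T|%:R * \sum_i B i i) +
    4 * v ^+ 2 * (#|T|%:R * \sum_i \sum_i' B i i' ^+ 2) =
    \sum_a A a a + 4 * \sum_a \sum_b A a b ^+ 2.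
  congr (_ + _).
    rewrite pair_sum -sumTc mulr_sumr big_mkcond; apply: eq_bigr => j _ /=.
    rewrite /A; case: (j \in T) => /=; last by rewrite big1 // => i _; rewrite mulr0 mul0r.
    by rewrite mulr_sumr; apply: eq_bigr => i _; rewrite eqxx !mul1r.
  rewrite -mulrA -sumTc; congr (_ * _).
  transitivity (\sum_a \sum_b (a.2 == b.2)%:R * (a.2 \in T)%:R * (v * B a.1 b.1) ^+ 2).
    rewrite sumA mulr_sumr; apply: eq_bigr => j _; rewrite mulr_sumr.
    apply: eq_bigr => i _; rewrite mulr_sumr; apply: eq_bigr => i' _ /=; ring.
  apply: eq_bigr => a _; apply: eq_bigr => b _.
  by rewrite /A !exprMn; case: eqP; case: (_ \in T) => //= _; rewrite ?expr0n ?expr1n ?mul0r.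
rewrite (_ : [set w | _]%classic = [set w | \sum_a A a a + 4 * \sum_a \sum_b A a b ^+ 2 + x
    <= \sum_a \sum_b e a w * e b w * A a b]%classic); last first.
  by apply/seteqP; split=> w /=; rewrite quadA.
apply: exp_tail H.
apply: measurable_sum => a; apply: measurable_sum => b.
by apply: measurable_funM => //; apply: measurable_funM; exact: (measurable_standardized gZ).
Qed.

(** The Laplace bound at - b / 2 has exponent |b|^2 / 8; multiplied by 4 this is half of |b|^2, so
    the cross term costs only half of the signal that it competes with. *)
Lemma linear_tail (b : 'I_n * 'I_p -> R) (x : R) :
  rare P [set w | (\sum_a b a ^+ 2) / 2 + 4 * x <= - 2 * \sum_a b a * e a w]%classic
   (expR (- x)).
Proof.
have H := integral_exp_linear gZ s0 (fun a => - (b a / 2)).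
have mF : measurable_fun setT (fun w => \sum_a - (b a / 2) * e a w).
  by apply: measurable_sum => a; apply: measurable_funM => //; exact: (measurable_standardized gZ).
apply: rare_sub (exp_tail x mF H).
have e1 : \sum_a (- (b a / 2)) ^+ 2 = (\sum_a b a ^+ 2) / 4.
  by rewrite mulr_suml; apply: eq_bigr => a _; field.
have e2 w : \sum_a - (b a / 2) * e a w = - (\sum_a b a * e a w) / 2.
  by rewrite -sumrN mulr_suml; apply: eq_bigr => a _; field.
by move=> w /=; rewrite e1 e2; lra.
Qed.

Lemma sqnorm_lower_tail (S : {set 'I_p}) (a : R) : 0 < a ->
  rare P [set w | \sum_(j in S) \sum_i Z (i, j) w ^+ 2 <=
        s ^+ 2 * (n * #|S|)%:R * expR (- a)]%classic
   (expR (- ((n * #|S|)%:R / 2 * (a - 1 + expR (- a))))).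
Proof.
(* The optimal Chernoff rate for this threshold, characterised by 1 + 2 v = exp a. *)
move=> a0; pose v := (expR a - 1) / 2.
have v0 : 0 < v by have := expR_gt1 a; rewrite a0 => /idP; rewrite /v; lra.
pose S' := [set ij : 'I_n * 'I_p | ij.2 \in S]%SET.
have cardS' : #|S'| = (n * #|S|)%N.
  rewrite -[n in RHS](card_ord n) -cardsT -cardsX; apply: eq_card => -[i j].
  by rewrite !inE.
have sumS' w : \sum_(c in S') (Z c w / s) ^+ 2 =
    (\sum_(j in S) \sum_i Z (i, j) w ^+ 2) / s ^+ 2.
  rewrite big_mkcond pair_sum mulr_suml [RHS]big_mkcond; apply: eq_bigr => j _ /=.
  case: (boolP (j \in S)) => jS; last by rewrite big1 // => i _; rewrite inE (negbTE jS).
  by rewrite mulr_suml; apply: eq_bigr => i _; rewrite inE jS expr_div_n.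
have H := integral_exp_sqnorm gZ s0 S' (ltW v0).
have mF : measurable_fun setT (fun w => - (v * \sum_(c in S') (Z c w / s) ^+ 2)).
  apply: measurableT_comp => //; apply: measurable_funM => //.
  apply: measurable_sum_in => c; apply: measurable_funX; apply: measurable_funM => //.
  exact: gZ.1.
apply: rare_sub (exp_tail _ mF H).
have -> : 1 + 2 * v = expR a by rewrite /v; field.
rewrite expRK cardS'; set N := (n * #|S|)%:R.
have s20 : 0 < s ^+ 2 by rewrite exprn_gt0.
have eE : expR a * expR (- a) = 1 by rewrite -expRD subrr expR0.
have E1 (u : R) : (u <= s ^+ 2 * N * expR (- a)) =
   (- (N / 2 * a) + N / 2 * (a - 1 + expR (- a)) <= - (v * (u / s ^+ 2))).
  have -> : - (N / 2 * a) + N / 2 * (a - 1 + expR (- a)) = - (v * (N * expR (- a))).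
    have -> : v * (N * expR (- a)) = N / 2 * (expR a * expR (- a) - expR (- a)).
      by rewrite /v; field.
    by rewrite eE; field.
  by rewrite lerN2 ler_pM2l // ler_pdivrMr // [_ * s ^+ 2]mulrC mulrA.
by move=> w /=; rewrite sumS' E1.
Qed.

End NoiseTails.

(** * The criterion and its noise levels *)

Section Criterion.
Context (R : realType) (n p K : nat).
Implicit Types (f g : 'I_n -> 'I_K) (J : {set 'I_p}).

Definition crit f (lam : R) (Y : 'I_n -> 'I_p -> R) J :=
  \sum_(j in J) (quad f (Y^~ j) - lam).

Lemma quad_add f (s : R) (x y : 'I_n -> R) :
  quad f (fun i => x i + s * y i) =
  quad f x + 2 * s * \sum_i (x i - resid f x i) * y i + s ^+ 2 * quad f y.
Proof.
have e1 : \sum_i (x i - resid f x i) * y i = \sum_i \sum_j level_proj R f i j * (y i * x j).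
  apply: eq_bigr => i _; rewrite /resid opprB addrC subrK mulr_suml.
  by apply: eq_bigr => j _; ring.
have e2 : \sum_i (x i - resid f x i) * y i = \sum_i \sum_j level_proj R f i j * (x i * y j).
  rewrite e1 exchange_big; apply: eq_bigr => j _; apply: eq_bigr => i _.
  by rewrite proj_sym mulrCA mulrC mulrA.
have -> : forall t : R, 2 * s * t = s * t + s * t by move=> t; ring.
rewrite {1}e1 e2 /quad !mulr_sumr -!big_split; apply: eq_bigr => i _ /=.
by rewrite !mulr_sumr -!big_split; apply: eq_bigr => j _ /=; ring.
Qed.

Context (fs : 'I_n -> 'I_K) (X E : 'I_n -> 'I_p -> R) (s lam a x1 q0 qS qM : R)
  (J0 : {set 'I_p}).
Hypotheses (s0 : 0 < s)
  (Xfs : forall i i' j, fs i = fs i' -> X i j = X i' j)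
  (XJ0 : forall i j, j \notin J0 -> X i j = 0).

Definition data i j := X i j + s * E i j.
Definition quad_gap g (T : {set 'I_p}) :=
  \sum_(j in T) (quad g (E^~ j) - quad fs (E^~ j)).

(** On the common columns the cross term uses up half of the lost signal, and the chaos is that of
    [J0] minus that of the forgotten set [M]. On [M] the term X^2 / 4 pays for the residual, which
    never exceeds X^2. A quarter of the total residual is left. *)
Lemma crit_gap g J :
  let M := J0 :\: J in let S := J :\: J0 in
  - 2 * s * (\sum_(j in J0 :&: J) \sum_i resid g (X^~ j) i * E i j) <=
    (\sum_(j in J0 :&: J) \sum_i resid g (X^~ j) i ^+ 2) / 2 + 4 * s ^+ 2 * x1 ->
  quad_gap g J0 <= q0 -> quad_gap g S <= qS -> - quad_gap g M <= qM ->
  (forall j, j \in S -> s ^+ 2 * quad fs (E^~ j) - lam <= - (s ^+ 2 * a)) ->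
  (forall j, j \in M -> lam - quad fs (data^~ j) <=
     - ((\sum_i X i j ^+ 2) / 4) - s ^+ 2 * a) ->
  crit g lam data J - crit fs lam data J0 <=
  - ((\sum_j \sum_i resid g (X^~ j) i ^+ 2) / 4) +
  s ^+ 2 * (4 * x1 + q0 + qS + qM - a * (#|S| + #|M|)%:R).
Proof.
move=> M S lin gap0 gapS gapM colS colM.
have quadX j : quad fs (X^~ j) = \sum_i X i j ^+ 2.
  rewrite quad_sqr; apply: eq_bigr => i _.
  by rewrite (@proj_const _ _ _ fs (X^~ j)) // => i1 i2; exact: Xfs.
have quad_fs j : quad fs (data^~ j) = \sum_i X i j ^+ 2 +
   2 * s * \sum_i X i j * E i j + s ^+ 2 * quad fs (E^~ j).
  rewrite /data quad_add quadX; congr (_ + _ * _ + _); apply: eq_bigr => i _.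
  by rewrite /resid (@proj_const _ _ _ fs (X^~ j)) ?subrr ?subr0 // => i1 i2; exact: Xfs.
have quad_g j : quad g (data^~ j) = \sum_i X i j ^+ 2 - \sum_i resid g (X^~ j) i ^+ 2 +
   2 * s * \sum_i X i j * E i j - 2 * s * (\sum_i resid g (X^~ j) i * E i j)
   + s ^+ 2 * quad g (E^~ j).
  rewrite /data quad_add resid_sqr.
  have -> : \sum_i (X i j - resid g (X^~ j) i) * E i j =
      \sum_i X i j * E i j - \sum_i resid g (X^~ j) i * E i j.
    by rewrite -sumrB; apply: eq_bigr => i _; rewrite mulrBl.
  by ring.
have residS j : j \notin J0 -> \sum_i resid g (X^~ j) i ^+ 2 = 0.
  move=> jJ; rewrite resid_sqr /quad !big1 ?subrr // => i _; last first.
    by rewrite XJ0 // expr0n.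
  by rewrite big1 // => k _; rewrite !XJ0 // !mul0r mulr0.
have residM j : \sum_i resid g (X^~ j) i ^+ 2 <= \sum_i X i j ^+ 2.
  by rewrite resid_sqr lerBlDr lerDl quad_ge0.
have XS j : j \notin J0 -> data^~ j = (fun i => 0 + s * E i j).
  by move=> jJ; apply/funext => i; rewrite /data XJ0.
have splitJ (F : 'I_p -> R) : \sum_(j in J) F j =
    \sum_(j in J0 :&: J) F j + \sum_(j in S) F j.
  by rewrite (big_setID J0) /= finset.setIC.
have splitJ0 (F : 'I_p -> R) : \sum_(j in J0) F j =
    \sum_(j in J0 :&: J) F j + \sum_(j in M) F j.
  by rewrite (big_setID J).
have splitT : \sum_j \sum_i resid g (X^~ j) i ^+ 2 =
    \sum_(j in J0 :&: J) \sum_i resid g (X^~ j) i ^+ 2 +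
    \sum_(j in M) \sum_i resid g (X^~ j) i ^+ 2.
  rewrite -splitJ0 [RHS]big_mkcond; apply: eq_bigr => j _.
  by case: ifP => // /negbT /residS.
set I := J0 :&: J.
have gI : \sum_(j in I) (quad g (data^~ j) - lam) - \sum_(j in I) (quad fs (data^~ j) - lam)
   = - \sum_(j in I) \sum_i resid g (X^~ j) i ^+ 2
     - 2 * s * (\sum_(j in I) \sum_i resid g (X^~ j) i * E i j)
     + s ^+ 2 * quad_gap g I.
  rewrite /quad_gap !mulr_sumr -!sumrN -!big_split /=; apply: eq_bigr => j _.
  by rewrite quad_g quad_fs; ring.
have gS : \sum_(j in S) (quad g (data^~ j) - lam) =
   s ^+ 2 * quad_gap g S + \sum_(j in S) (s ^+ 2 * quad fs (E^~ j) - lam).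
  rewrite /quad_gap mulr_sumr -big_split /=; apply: eq_bigr => j.
  rewrite inE => /andP[jJ0 _]; rewrite quad_g residS //.
  have X0 (F : 'I_n -> R) : \sum_i X i j * F i = 0.
    by rewrite big1 // => i _; rewrite XJ0 // mul0r.
  have -> : \sum_i X i j ^+ 2 = 0 by under eq_bigr do rewrite expr2; exact: X0.
  rewrite X0; have -> : \sum_i resid g (X^~ j) i * E i j = 0.
    rewrite big1 // => i _.
    have /eqP := residS _ jJ0; rewrite psumr_eq0; last by move=> k _; exact: sqr_ge0.
    by move=> /allP/(_ i (mem_index_enum _)); rewrite sqrf_eq0 => /eqP ->; rewrite mul0r.
  by ring.
have bS : \sum_(j in S) (s ^+ 2 * quad fs (E^~ j) - lam) <= - (s ^+ 2 * a) * #|S|%:R.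
  rewrite mulr_natr -sumr_const; exact: ler_sum.
have bM : - \sum_(j in M) (quad fs (data^~ j) - lam) <=
    - ((\sum_(j in M) \sum_i resid g (X^~ j) i ^+ 2) / 4) - (s ^+ 2 * a) * #|M|%:R.
  rewrite mulr_natr -sumr_const mulr_suml -!sumrN -big_split /=; apply: ler_sum => j jM.
  rewrite opprB; apply: le_trans (colM _ jM) _; rewrite lerD2r lerN2.
  by rewrite ler_wpM2r // invr_ge0.
have gap0E : quad_gap g J0 = quad_gap g I + quad_gap g M by exact: splitJ0.
rewrite /crit splitJ splitJ0 splitT natrD.
have r0 : 0 <= \sum_(j in I) \sum_i resid g (X^~ j) i ^+ 2.
  by apply: sumr_ge0 => j _; apply: sumr_ge0 => i _; exact: sqr_ge0.
have s2 : 0 < s ^+ 2 by rewrite exprn_gt0.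
have k0 := ler_wpM2l (ltW s2) gap0.
have kS := ler_wpM2l (ltW s2) gapS.
have kM := ler_wpM2l (ltW s2) gapM.
rewrite gap0E in k0.
move: lin gI gS bS bM r0 k0 kS kM; rewrite -/I.
set u1 := \sum_(j in I) (quad g _ - lam); set u2 := \sum_(j in S) (quad g _ - lam).
set u3 := \sum_(j in I) (quad fs _ - lam); set u4 := \sum_(j in M) (quad fs _ - lam).
set rI := \sum_(j in I) _; set rM := \sum_(j in M) _; set ell := \sum_(j in I) _.
rewrite !mulrBr !mulrDr !mulrN.
lra.
Qed.

End Criterion.

Section NoiseLevels.
Context (R : realType).
Implicit Types (a b c t x : R).

(** The quotient balances a budget divided by the rate against a variance proxy multiplied by it;
    the cap 1/4 is the range of the Laplace bound. *)
Definition rate b a : R := Num.min 4^-1 (a / b).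

Lemma rate_gt0 a b : 0 < a -> 0 < b -> 0 < rate b a.
Proof. by move=> a0 b0; rewrite lt_min invr_gt0 ltr0n divr_gt0. Qed.

Lemma rate_le4 a b : rate b a <= 4^-1.
Proof. by rewrite ge_min lexx. Qed.

Lemma rate_inv_le a b x : 0 < a -> 0 < b -> 0 <= x ->
  x / rate b a <= x * (4 + b / a).
Proof.
move=> a0 b0 x0; apply: ler_wpM2l => //.
have ba : 0 < b / a by rewrite divr_gt0.
rewrite /rate minEle; case: ifP => _.
  by rewrite invrK lerDl ltW.
by rewrite invf_div lerDr.
Qed.

Lemma rate_le a b x : 0 <= x -> rate b a * x <= a / b * x.
Proof. by move=> x0; apply: ler_wpM2r => //; rewrite ge_min lexx orbT. Qed.

(* The rate l/q turns a budget x = d l into d (4 l + q), and a variance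
   proxy t F <= s (2 h K/n) into 8 h q, where q^2 = s K l / n. *)
Lemma noise_fixed (n K s l d h F t C : R) :
  0 < n -> 0 < K -> 0 < s -> 0 < l -> 0 <= C -> 0 <= d -> d <= 2 * h ->
  0 <= F -> F <= 2 * h * K / n -> 0 <= t -> t <= s ->
  forall q, q = Num.sqrt (s * K / n * l) ->
  C * (d * l) / rate q l + 4 * rate q l * (t * F) <= (8 * C + 8) * h * (q + l).
Proof.
move=> n0 K0 s0 l0 C0 d0 dh F0 Fh t0 ts q qE.
have sKl : 0 < s * K / n * l by rewrite mulr_gt0 // divr_gt0 // mulr_gt0.
have q0 : 0 < q by rewrite qE sqrtr_gt0.
have q2 : q * q = s * K / n * l by rewrite qE -expr2 sqr_sqrtr // ltW.
have h0 : 0 <= h by lra.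
have -> : (8 * C + 8) * h * (q + l) =
    (4 * C * (2 * h)) * (q + l) + 8 * h * (q + l) by ring.
apply: lerD.
  apply: le_trans (rate_inv_le l0 q0 _) _; first by rewrite !mulr_ge0 // ltW.
  have -> : C * (d * l) * (4 + q / l) = C * d * (4 * l + q) by field; rewrite gt_eqF.
  apply: (@le_trans _ _ (C * (2 * h) * (4 * (q + l)))); last by rewrite le_eqVlt; apply/orP; left; apply/eqP; ring.
  apply: ler_pM => //.
  - by rewrite mulr_ge0.
  - by rewrite addr_ge0 // ?mulr_ge0 // ltW.
  - exact: ler_wpM2l.
  - lra.
rewrite -mulrA; apply: (@le_trans _ _ (4 * (l / q * (s * (2 * h * K / n))))).
  apply: ler_wpM2l => //; apply: le_trans (rate_le _ _ _) _; first by rewrite mulr_ge0.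
  by apply: ler_wpM2l; [rewrite divr_ge0 // ltW|exact: ler_pM].
have -> : 4 * (l / q * (s * (2 * h * K / n))) = 8 * h * ((s * K / n * l) / q).
  by field; rewrite !gt_eqF.
rewrite -q2 mulfK ?gt_eqF //; apply: ler_wpM2l; first by rewrite mulr_ge0.
by rewrite lerDl ltW.
Qed.

(** With w^2 = K L, the rate L / w turns the budget t L into t (4 L + w) and, as F <= 2 K, the
    variance proxy into 8 t w. *)
Lemma noise_sparse (K L F t C : R) : 0 < K -> 0 < L -> 0 <= C -> 0 <= t ->
  0 <= F -> F <= 2 * K ->
  forall w, w = Num.sqrt (K * L) ->
  C * (t * L) / rate w L + 4 * rate w L * (t * F) <= (4 * C + 8) * t * (w + L).
Proof.
move=> K0 L0 C0 t0 F0 FK w wE.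
have w0 : 0 < w by rewrite wE sqrtr_gt0 mulr_gt0.
have w2 : w * w = K * L by rewrite wE -expr2 sqr_sqrtr // ltW // mulr_gt0.
have -> : (4 * C + 8) * t * (w + L) = (C * t) * (4 * (w + L)) + 8 * t * (w + L).
  by ring.
apply: lerD.
  apply: le_trans (rate_inv_le L0 w0 _) _; first by rewrite !mulr_ge0 // ltW.
  have -> : C * (t * L) * (4 + w / L) = C * t * (4 * L + w) by field; rewrite gt_eqF.
  by apply: ler_wpM2l; [rewrite mulr_ge0|lra].
rewrite -mulrA; apply: (@le_trans _ _ (4 * (L / w * (t * (2 * K))))).
  apply: ler_wpM2l => //; apply: le_trans (rate_le _ _ _) _; first by rewrite mulr_ge0.
  by apply: ler_wpM2l; [rewrite divr_ge0 // ltW|exact: ler_wpM2l].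
have -> : 4 * (L / w * (t * (2 * K))) = 8 * t * ((K * L) / w).
  by field; rewrite !gt_eqF.
rewrite -w2 mulfK ?gt_eqF //; apply: ler_wpM2l; first by rewrite mulr_ge0.
by rewrite lerDl ltW.
Qed.

(** The budget is at most twice the larger of [d * l] and [t * L]; the rate tuned to that part then
    applies with [2 * C] in place of [C]. *)
Lemma noise_mixed (n K s l L d h F t C : R) :
  0 < n -> 0 < K -> 0 < s -> 0 < l -> 0 < L -> 0 <= C -> 0 <= d -> d <= 2 * h ->
  0 <= F -> F <= 2 * h * K / n -> F <= 2 * K -> 0 <= t -> t <= s ->
  forall q w, q = Num.sqrt (s * K / n * l) -> w = Num.sqrt (K * L) ->
  exists2 u, u \in [:: rate q l; rate w L] &
  C * (d * l + t * L) / u + 4 * u * (t * F) <=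
  (16 * C + 8) * h * (q + l) + (8 * C + 8) * t * (w + L).
Proof.
move=> n0 K0 s0 l0 L0 C0 d0 dh F0 Fh FK t0 ts q w qE wE.
have C20 : 0 <= 2 * C by rewrite mulr_ge0.
have q0 : 0 <= q by rewrite qE sqrtr_ge0.
have w0 : 0 <= w by rewrite wE sqrtr_ge0.
have h0 : 0 <= h by lra.
have H1 := noise_fixed n0 K0 s0 l0 C20 d0 dh F0 Fh t0 ts qE.
have H2 := noise_sparse K0 L0 C20 t0 F0 FK wE.
have sKl : 0 < s * K / n * l by rewrite mulr_gt0 // divr_gt0 // mulr_gt0.
have r1 : 0 < rate q l by rewrite rate_gt0 // qE sqrtr_gt0.
have r2 : 0 < rate w L by rewrite rate_gt0 // wE sqrtr_gt0 mulr_gt0.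
case: (leP (t * L) (d * l)) => tLdl.
  exists (rate q l); first by rewrite inE eqxx.
  apply: le_trans (le_trans H1 _).
    rewrite lerD2r; apply: ler_wpM2r; first by rewrite invr_ge0 ltW.
    have -> : 2 * C * (d * l) = C * (d * l + d * l) by ring.
    by apply: ler_wpM2l => //; rewrite lerD2l.
  have -> : (8 * (2 * C) + 8) = 16 * C + 8 :> R by ring.
  by rewrite lerDl !mulr_ge0 ?addr_ge0 ?mulr_ge0 // ltW.
exists (rate w L); first by rewrite !inE eqxx orbT.
apply: le_trans (le_trans H2 _).
  rewrite lerD2r; apply: ler_wpM2r; first by rewrite invr_ge0 ltW.
  have -> : 2 * C * (t * L) = C * (t * L + t * L) by ring.
  by apply: ler_wpM2l => //; rewrite lerD2r ltW.
have -> : (4 * (2 * C) + 8) = 8 * C + 8 :> R by ring.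
by rewrite lerDr !mulr_ge0 ?addr_ge0 ?mulr_ge0 // ltW.
Qed.

End NoiseLevels.

(** * Deterministic recovery from the noise bounds *)

Section Recovery.
Context (R : realType) (n p K : nat).
Implicit Types (f g : 'I_n -> 'I_K).

Definition proj_dist f g : R :=
  \sum_i \sum_j (level_proj R f i j - level_proj R g i j) ^+ 2.

Lemma proj_dist_ge0 f g : 0 <= proj_dist f g.
Proof. by apply: sumr_ge0 => i _; apply: sumr_ge0 => j _; exact: sqr_ge0. Qed.

Lemma proj_dist_le f g :
  (forall k, exists i, f i = k) -> (forall k, exists i, g i = k) ->
  proj_dist f g <= 2 * K%:R.
Proof.
move=> sf sg.
have sq (h : 'I_n -> 'I_K) : (forall k, exists i, h i = k) -> \sum_i \sum_j level_proj R h i j ^+ 2 = K%:R.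
  move=> sh; rewrite -[RHS](proj_trace R sh); apply: eq_bigr => i _.
  rewrite -[RHS](proj_idem R h); apply: eq_bigr => j _.
  by rewrite (proj_sym R h j i) expr2.
rewrite mulr_natl mulr2n -{1}(sq _ sf) -(sq _ sg) -big_split; apply: ler_sum => i _ /=.
rewrite -big_split; apply: ler_sum => j _ /=.
have := mulr_ge0 (proj_ge0 R f i j) (proj_ge0 R g i j).
set u := level_proj R f i j; set v := level_proj R g i j => uv.
by have -> : (u - v) ^+ 2 = u ^+ 2 + v ^+ 2 - 2 * (u * v) by [ring]; lra.
Qed.

Context (fs g : 'I_n -> 'I_K) (X E : 'I_n -> 'I_p -> R)
  (s lam b gamma Delta s2 l L : R) (J0 J : {set 'I_p}).
Hypotheses (s0 : 0 < s)
  (Xfs : forall i i' j, fs i = fs i' -> X i j = X i' j)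
  (XJ0 : forall i j, j \notin J0 -> X i j = 0).
Hypotheses (sfs : forall k, exists i, fs i = k) (sg : forall k, exists i, g i = k)
  (n0 : (0 < n)%N) (b0 : 0 < b) (gamma0 : 0 <= gamma)
  (bfs : forall k, b <= (clsize fs k)%:R) (nb : n%:R <= K%:R * (gamma * b))
  (l0 : 0 < l) (L0 : 0 < L) (s20 : 0 < s2).

Local Notation d := (hamming g fs)%:R.
Local Notation D := (impurity R g fs).
Local Notation M := (J0 :\: J).
Local Notation S := (J :\: J0).
Let q := Num.sqrt (s2 * K%:R / n%:R * l).
Let w := Num.sqrt (K%:R * L).

Hypotheses (ham : d <= 2 * (gamma * D))
  (sepX : forall i i', fs i != fs i' ->
    2 * s ^+ 2 * Delta <= \sum_j (X i j - X i' j) ^+ 2)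
  (DeltaE : 2016 * gamma * (q + l) < Delta)
  (cardJ0 : #|J0|%:R <= s2) (cardS : #|S|%:R <= s2).

(** In the Dirichlet form of the residual, summed over the columns, a pair merged by [g] across true
    groups pays half the squared distance of its means, at least sigma^2 Delta. *)
Lemma impurity_resid :
  s ^+ 2 * Delta * D <= \sum_j \sum_i resid g (X^~ j) i ^+ 2.
Proof.
under eq_bigr do rewrite resid_sqr sqr_sub_quad.
rewrite -mulr_suml exchange_big /= ler_pdivlMr // /impurity mulr_sumr mulr_suml.
apply: ler_sum => i _; rewrite exchange_big mulr_sumr mulr_suml /=.
apply: ler_sum => i' _; rewrite -mulr_sumr mulrCA -mulrA.
apply: ler_wpM2l; first exact: proj_ge0.
case: (eqVneq (fs i) (fs i')) => /= [_|ii'].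
  by rewrite mulr0 mul0r sumr_ge0 // => j _; exact: sqr_ge0.
by apply: le_trans (sepX ii'); rewrite mulr1 mulrC mulrA.
Qed.

(** If [g] differs from [fs], the Hamming distance is at least 1, which forces a positive impurity.
    The strict separation [DeltaE] then makes the criterion of [(g, J)] strictly smaller than that
    of the truth. *)
Lemma recovery :
  - 2 * s * (\sum_(j in J0 :&: J) \sum_i resid g (X^~ j) i * E i j) <=
    (\sum_(j in J0 :&: J) \sum_i resid g (X^~ j) i ^+ 2) / 2
    + 4 * s ^+ 2 * (10 * (d * l + #|M|%:R * L)) ->
  rate q l * quad_gap fs E g J0 <=
    4 * rate q l ^+ 2 * (#|J0|%:R * proj_dist g fs) + 10 * (d * l) ->
  (forall T v, T \in [:: S; M] ->
    v \in [:: rate q l; - rate q l; rate w L; - rate w L] ->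
    v * quad_gap fs E g T <=
    4 * v ^+ 2 * (#|T|%:R * proj_dist g fs) + 10 * (d * l + #|T|%:R * L)) ->
  (forall j, j \in S ->
    s ^+ 2 * quad fs (E^~ j) - lam <= - (s ^+ 2 * (128 * (w + L)))) ->
  (forall j, j \in M -> lam - quad fs ((data X E s)^~ j) <=
     - ((\sum_i X i j ^+ 2) / 4) - s ^+ 2 * (128 * (w + L))) ->
  crit fs lam (data X E s) J0 <= crit g lam (data X E s) J ->
  g =1 fs.
Proof.
move=> lin gap0 gap colS colM opt.
have [/eqP|dpos] := posnP (hamming g fs).
  rewrite cards_eq0 => /eqP/setP H i; have := H i.
  by rewrite !inE => /negbFE/eqP.
exfalso; move: opt; apply/negP; rewrite -ltNge -subr_lt0.
have s2p : 0 < s ^+ 2 by rewrite exprn_gt0.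
have d1 : 1 <= d :> R by rewrite ler1n.
pose h := gamma * D; have hamh : d <= 2 * h := ham.
have h0 : 0 < h by lra.
have D0 : 0 < D.
  rewrite lt0r; apply/andP; split; last first.
    apply: sumr_ge0 => i _; apply: sumr_ge0 => j _; apply: mulr_ge0 => //.
    exact: proj_ge0.
  by apply: contraTneq h0 => D0; rewrite /h D0 mulr0 ltxx.
have nR : 0 < n%:R :> R by rewrite ltr0n.
have K0 : 0 < K%:R :> R.
  by rewrite ltr0n; move: (g (Ordinal n0)) => k; apply: leq_trans (ltn_ord k).
have F0 := proj_dist_ge0 g fs; have F2 := proj_dist_le sg sfs.
have Fh : proj_dist g fs <= 2 * h * K%:R / n%:R.
  apply: le_trans (proj_frobenius sg sfs b0 bfs) _.
  rewrite ler_pdivlMr // mulrAC ler_pdivrMr //.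
  have -> : 2 * h * K%:R * b = 2 * D * (K%:R * (gamma * b)) by rewrite /h; ring.
  by apply: ler_wpM2l => //; rewrite mulr_ge0 // ltW.
have cardM : #|M|%:R <= s2.
  by apply: le_trans cardJ0; rewrite ler_nat subset_leq_card // finset.subsetDl.
have C0 : 0 <= 10 :> R by [].
have q0 : 0 < q by rewrite sqrtr_gt0 mulr_gt0 // divr_gt0 // mulr_gt0.
have w0 : 0 < w by rewrite sqrtr_gt0 mulr_gt0.
have r10 : 0 < rate q l by exact: rate_gt0.
have r20 : 0 < rate w L by exact: rate_gt0.
have N0 := noise_fixed nR K0 s20 l0 C0 (ler0n R _) hamh F0 Fh (ler0n R _) cardJ0 (erefl q).
have gap0' : quad_gap fs E g J0 <= (8 * 10 + 8) * h * (q + l).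
  apply: le_trans N0; rewrite -(ler_pM2l r10); apply: le_trans gap0 _.
  by rewrite le_eqVlt; apply/orP; left; apply/eqP; field; rewrite gt_eqF.
have gapT T : T \in [:: S; M] -> #|T|%:R <= s2 -> `|quad_gap fs E g T| <=
    (16 * 10 + 8) * h * (q + l) + (8 * 10 + 8) * #|T|%:R * (w + L).
  move=> TSM cT.
  have [u uin H] := noise_mixed nR K0 s20 l0 L0 C0 (ler0n R _) hamh F0 Fh F2
    (ler0n R _) cT (erefl q) (erefl w).
  have u0 : 0 < u by move: uin; rewrite !inE => /orP[] /eqP ->.
  apply: le_trans H; rewrite ler_norml; apply/andP; split.
    have : (- u) * quad_gap fs E g T <= _ := gap T (- u) TSM _.
    rewrite sqrrN => H; rewrite -(ler_pM2l u0) mulrN lerNl -mulNr.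
    apply: le_trans (H _) _.
      by move: uin; rewrite !inE => /orP[] /eqP ->; rewrite eqxx ?orbT.
    by rewrite le_eqVlt; apply/orP; left; apply/eqP; field; rewrite gt_eqF.
  rewrite -(ler_pM2l u0); apply: le_trans (gap T u TSM _) _.
    by move: uin; rewrite !inE => /orP[] /eqP ->; rewrite eqxx ?orbT.
  by rewrite le_eqVlt; apply/orP; left; apply/eqP; field; rewrite gt_eqF.
have gapS := le_trans (ler_norm _) (gapT S (mem_head _ _) cardS).
have MSM : M \in [:: S; M] by rewrite !inE eqxx orbT.
have gapM := gapT M MSM cardM; rewrite -normrN in gapM.
have gapM' := le_trans (ler_norm _) gapM.
apply: le_lt_trans (crit_gap s0 Xfs XJ0 lin gap0' gapS gapM' colS colM) _.
have sig := impurity_resid.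
rewrite natrD; set cS : R := #|S|%:R; set cM : R := #|M|%:R.
have cM0 : 0 <= cM := ler0n _ _; have cS0 : 0 <= cS := ler0n _ _.
have dl : d * l <= 2 * h * (q + l).
  by apply: ler_pM => //; [exact: ltW|rewrite lerDr ltW].
have cML : cM * L <= cM * (w + L) by apply: ler_wpM2l => //; rewrite lerDr ltW.
have cSL : 0 <= cS * (w + L) by rewrite mulr_ge0 // addr_ge0 // ltW.
have main : 2016 * h * (q + l) < Delta * D.
  have -> : 2016 * h * (q + l) = 2016 * gamma * (q + l) * D by rewrite /h; ring.
  by rewrite ltr_pM2r.
(* In units of h (q + l) the noise is 80 + 88 + 168 + 168 = 504 = 2016 / 4. A forgotten column costs
   40 + 88 = 128 units of w + L and a wrongly selected one 88. *)
have : 4 * (10 * (d * l + cM * L)) + (8 * 10 + 8) * h * (q + l) +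
    ((16 * 10 + 8) * h * (q + l) + (8 * 10 + 8) * cS * (w + L)) +
    ((16 * 10 + 8) * h * (q + l) + (8 * 10 + 8) * cM * (w + L)) -
    128 * (w + L) * (cS + cM) < Delta * D / 4.
  move: dl cML cSL main; set A := h * (q + l); set B := w + L.
  have -> : 2 * h * (q + l) = 2 * A by rewrite /A; ring.
  have -> : 2016 * h * (q + l) = 2016 * A by rewrite /A; ring.
  have -> : (8 * 10 + 8) * h * (q + l) = 88 * A by rewrite /A; ring.
  have -> : (16 * 10 + 8) * h * (q + l) = 168 * A by rewrite /A; ring.
  have -> : (8 * 10 + 8) * cS * B = 88 * (cS * B) by ring.
  have -> : (8 * 10 + 8) * cM * B = 88 * (cM * B) by ring.
  have -> : 128 * B * (cS + cM) = 128 * (cS * B) + 128 * (cM * B) by ring.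
  lra.
rewrite -(ltr_pM2l s2p) => main2.
rewrite -[s ^+ 2 * Delta * D]mulrA in sig.
have e4 : s ^+ 2 * (Delta * D / 4) = s ^+ 2 * (Delta * D) / 4 by rewrite mulrA.
lra.
Qed.

End Recovery.

(** * Union bounds *)

Section WeightSums.
Context (R : realType).

Lemma expr1D_le (a : R) (N : nat) : 0 <= a -> N%:R * a <= 2^-1 ->
  (1 + a) ^+ N <= 1 + 2 * (N%:R * a).
Proof.
move=> a0; elim: N => [|N IH] Na; first by rewrite expr0 mul0r mulr0 addr0.
have NaS : N%:R * a + a <= 2^-1 by move: Na; rewrite -natr1 mulrDl mul1r.
have Na0 : 0 <= N%:R * a by rewrite mulr_ge0.
have Na1 : N%:R * a <= 2^-1 by lra.
rewrite exprSr; apply: (@le_trans _ _ ((1 + 2 * (N%:R * a)) * (1 + a))).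
  by apply: ler_wpM2r; [lra|exact: IH].
have -> : N.+1%:R * a = N%:R * a + a by rewrite -natr1 mulrDl mul1r.
have : 2 * (N%:R * a) * a <= 2 * 2^-1 * a.
  by apply: ler_wpM2r => //; apply: ler_wpM2l.
by rewrite mulfV // mul1r; set u := N%:R * a; lra.
Qed.

Lemma sum_expr_card (p : nat) (v : R) :
  \sum_(T : {set 'I_p}) v ^+ #|T| = (1 + v) ^+ p.
Proof.
transitivity (\prod_(j < p) (v + 1)); last by rewrite prodr_const card_ord addrC.
rewrite bigA_distr; apply: eq_big => // T _.
by rewrite -big_mkcond /= prodr_const.
Qed.

(** The weight factors over the points: each contributes 1 for its true label and [v] for each of
    the others. *)
Lemma sum_expr_hamming (n K : nat) (fs : 'I_n -> 'I_K) (v : R) : 0 <= v ->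
  \sum_(g : {ffun 'I_n -> 'I_K}) v ^+ hamming g fs <= (1 + K%:R * v) ^+ n.
Proof.
move=> v0.
have -> : \sum_(g : {ffun 'I_n -> 'I_K}) v ^+ hamming g fs =
    \prod_(i < n) \sum_(k < K) (if k != fs i then v else 1).
  rewrite bigA_distr_bigA; apply: eq_bigr => g _.
  by rewrite -big_mkcond /= prodr_const /hamming cardsE.
rewrite -[n in leRHS](card_ord n) -prodr_const; apply: ler_prod => i _.
apply/andP; split; first by apply: sumr_ge0 => k _; case: ifP.
rewrite (bigD1 (fs i)) //= eqxx lerD2l.
apply: (@le_trans _ _ (\sum_(k < K) v)); last by rewrite sumr_const card_ord mulr_natl.
rewrite [leRHS](bigD1 (fs i)) //= -[leLHS]add0r; apply: lerD => //.
by apply: ler_sum => k ->.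
Qed.

(** Excluding the true labelling removes the term 1 of the expansion, which leaves a factor of order
    n K v; the sum over column sets stays below 2. *)
Lemma sum_weights (n p K : nat) (fs : 'I_n -> 'I_K) (v v' : R) :
  0 <= v -> 0 <= v' -> n%:R * (K%:R * v) <= 2^-1 -> p%:R * v' <= 2^-1 ->
  \sum_(gT : {ffun 'I_n -> 'I_K} * {set 'I_p} | gT.1 != finfun fs)
    v ^+ hamming gT.1 fs * v' ^+ #|gT.2| <= 4 * (n%:R * (K%:R * v)).
Proof.
move=> v0 v'0 nKv pv'.
have Kv0 : 0 <= K%:R * v by rewrite mulr_ge0.
rewrite (eq_bigl (fun gT => (gT.1 != finfun fs) && predT gT.2)) => [|gT]; last by rewrite andbT.
rewrite -(pair_big (fun g => g != finfun fs) predT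
  (fun (g : {ffun 'I_n -> 'I_K}) (T : {set 'I_p}) => v ^+ hamming g fs * v' ^+ #|T|)) /=.
under eq_bigr do rewrite -mulr_sumr sum_expr_card.
rewrite -mulr_suml.
have h1 : \sum_(g : {ffun 'I_n -> 'I_K} | g != finfun fs) v ^+ hamming g fs <=
    2 * (n%:R * (K%:R * v)).
  have := le_trans (sum_expr_hamming fs v0) (expr1D_le Kv0 nKv).
  rewrite (bigD1 (finfun fs)) //= (_ : hamming _ _ = 0%N) ?expr0 ?lerD2l //.
  by apply: eq_card0 => i; rewrite !inE ffunE eqxx.
have h2 : (1 + v') ^+ p <= 2.
  by apply: le_trans (expr1D_le v'0 pv') _; lra.
have -> : 4 * (n%:R * (K%:R * v)) = 2 * (n%:R * (K%:R * v)) * 2 by ring.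
apply: ler_pM => //; first by apply: sumr_ge0 => g _; exact: exprn_ge0.
by rewrite exprn_ge0 // addr_ge0.
Qed.

End WeightSums.

(** * Uniform control of the chaos over labellings and column sets *)

Section NoiseEvents.
Context (R : realType) (d : measure_display) (Omega : measurableType d)
  (P : probability Omega R) (n p K : nat) (Z : 'I_n * 'I_p -> Omega -> R)
  (X : 'I_n -> 'I_p -> R) (s : R) (fs : 'I_n -> 'I_K).
Hypotheses (gZ : gaussian_field P Z (fun ij => X ij.1 ij.2) s) (s0 : 0 < s).

Definition noise w i j := standardized Z (fun ij => X ij.1 ij.2) s (i, j) w.
Local Notation E := noise.

(** Each projection has a form between 0 and |y|^2, so the difference is a kernel bounded by 1. The
    trace term vanishes once both labellings are surjective. *)
Lemma rare_gap (g : 'I_n -> 'I_K) (T : {set 'I_p}) (v x : R) : `|v| <= 4^-1 ->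
  rare P [set w | v * (#|T|%:R * \sum_i (level_proj R g i i - level_proj R fs i i)) +
        4 * v ^+ 2 * (#|T|%:R * proj_dist R g fs) + x <= v * quad_gap fs (E w) g T]%classic
    (expR (- x)).
Proof.
move=> v4; pose B i i' := level_proj R g i i' - level_proj R fs i i'.
have quadB (y : 'I_n -> R) : \sum_i \sum_i' B i i' * (y i * y i') = quad g y - quad fs y.
  rewrite /quad -sumrB; apply: eq_bigr => i _; rewrite -sumrB.
  by apply: eq_bigr => i' _; rewrite /B mulrBl.
apply: rare_sub (@kernel_tail _ _ _ P _ _ _ _ _ gZ s0 B T v x _ _ v4).
- move=> w /=; rewrite (_ : quad_gap _ _ _ _ = \sum_(j in T) \sum_i \sum_i'
    B i i' * (E w i j * E w i' j)) //.
  by apply: eq_bigr => j _; rewrite quadB.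
- by move=> i i'; rewrite /B ![level_proj R _ i i']proj_sym.
- move=> y; rewrite quadB ler_norml.
  have := quad_le g y; have := quad_le fs y; have := quad_ge0 g y; have := quad_ge0 fs y.
  by set t := \sum_i _; lra.
Qed.

Lemma rare_inner (r : 'I_n -> 'I_p -> R) (T : {set 'I_p}) (x : R) :
  rare P [set w | (\sum_(j in T) \sum_i r i j ^+ 2) / 2 + 4 * s ^+ 2 * x <=
      - 2 * s * (\sum_(j in T) \sum_i r i j * E w i j)]%classic (expR (- x)).
Proof.
pose b (ij : 'I_n * 'I_p) := if ij.2 \in T then r ij.1 ij.2 / s else 0.
have e1 : \sum_a b a ^+ 2 = (\sum_(j in T) \sum_i r i j ^+ 2) / s ^+ 2.
  rewrite pair_sum mulr_suml [RHS]big_mkcond; apply: eq_bigr => j _ /=.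
  rewrite /b /=; case: (j \in T); last by rewrite big1 // => i _; rewrite expr0n.
  by rewrite mulr_suml; apply: eq_bigr => i _; rewrite expr_div_n.
have e2 w : \sum_a b a * standardized Z (fun ij => X ij.1 ij.2) s a w =
    (\sum_(j in T) \sum_i r i j * E w i j) / s.
  rewrite pair_sum mulr_suml [RHS]big_mkcond; apply: eq_bigr => j _ /=.
  rewrite /b /=; case: (j \in T); last by rewrite big1 // => i _; rewrite mul0r.
  by rewrite mulr_suml; apply: eq_bigr => i _; rewrite mulrAC.
apply: rare_sub (@linear_tail _ _ _ P _ _ _ _ _ gZ s0 b x) => w /=.
rewrite e1 e2; set A := \sum_(j in T) _; set C := \sum_(j in T) _.
have s2 : 0 < s ^+ 2 by rewrite exprn_gt0.
rewrite -(ler_pM2l s2) => H; rewrite -(ler_pM2l s2).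
have -> : s ^+ 2 * (A / s ^+ 2 / 2 + 4 * x) = A / 2 + 4 * s ^+ 2 * x.
  by field; rewrite gt_eqF.
have -> : s ^+ 2 * (-2 * (C / s)) = - 2 * s * C by field; rewrite gt_eqF.
by move: H; rewrite ler_pM2l.
Qed.

(* The budget [x] pays for the union bound over the labellings at a given
   Hamming distance and over the sets of columns of a given size. *)
Definition deviations (J0 : {set 'I_p}) (l L q w : R) (o : Omega)
    (gT : {ffun 'I_n -> 'I_K} * {set 'I_p}) : Prop :=
  let g := gT.1 in let T := gT.2 in
  let x := 10 * ((hamming g fs)%:R * l + #|T|%:R * L) in
  let tr := \sum_i (level_proj R g i i - level_proj R fs i i) in
  let gap v := v * (#|T|%:R * tr) + 4 * v ^+ 2 * (#|T|%:R * proj_dist R g fs) + x <=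
    v * quad_gap fs (E o) g T in
  [\/ (\sum_(j in J0 :\: T) \sum_i resid g (X^~ j) i ^+ 2) / 2 + 4 * s ^+ 2 * x <=
      - 2 * s * (\sum_(j in J0 :\: T) \sum_i resid g (X^~ j) i * E o i j),
    T = finset.set0 /\
      rate q l * (#|J0|%:R * tr) + 4 * rate q l ^+ 2 * (#|J0|%:R * proj_dist R g fs) + x
        <= rate q l * quad_gap fs (E o) g J0,
    gap (rate q l) \/ gap (- rate q l) | gap (rate w L) \/ gap (- rate w L)].

(** Each pair has six tails, each of weight v^hamming v'^|T| with v = n^-10 and v' = (np)^-10. With
    K <= n the total is at most 24 n^-8, and n^6 >= 64. *)
Lemma rare_deviations (J0 : {set 'I_p}) (l L q w : R) :
  (1 < n)%N -> (K <= n)%N -> (0 < p)%N -> l = ln n%:R -> L = ln (n * p)%:R ->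
  0 < q -> 0 < w ->
  rare P [set o | exists2 gT, gT.1 != finfun fs & deviations J0 l L q w o gT]%classic
    (n%:R ^- 2).
Proof.
move=> n1 Kn p0 lE LE q0 w0.
have n0 : 0 < n%:R :> R by rewrite ltr0n ltnW.
have np0 : 0 < (n * p)%:R :> R by rewrite ltr0n muln_gt0 ltnW.
have np1 : (1 < n * p)%N by rewrite (leq_trans n1) // leq_pmulr.
have l0 : 0 < l by rewrite lE ln_gt0 // ltr1n.
have L0 : 0 < L by rewrite LE ln_gt0 // ltr1n.
have rate_small (a b : R) : 0 < a -> 0 < b -> `|rate b a| <= 4^-1.
  by move=> a0 b0; rewrite ger0_norm ?rate_le4 // ltW // rate_gt0.
pose x (gT : {ffun 'I_n -> 'I_K} * {set 'I_p}) : R :=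
  10 * ((hamming gT.1 fs)%:R * l + #|gT.2|%:R * L).
have rdev gT : rare P [set o | deviations J0 l L q w o gT]%classic (6 * expR (- x gT)).
  have -> : 6 * expR (- x gT) = expR (- x gT) + expR (- x gT) +
      ((expR (- x gT) + expR (- x gT)) + (expR (- x gT) + expR (- x gT))) by ring.
  apply: rare_sub; last first.
    apply: rareU; [apply: rareU|apply: rareU; apply: rareU].
    - exact: (rare_inner (fun i j => resid gT.1 (X^~ j) i) (J0 :\: gT.2) (x gT)).
    - exact: (rare_gap gT.1 J0 (x gT) (rate_small _ _ l0 q0)).
    - exact: (rare_gap gT.1 gT.2 (x gT) (rate_small _ _ l0 q0)).
    - by apply: (rare_gap gT.1 gT.2 (v := - rate q l) (x gT)); rewrite normrN rate_small.
    - exact: (rare_gap gT.1 gT.2 (x gT) (rate_small _ _ L0 w0)).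
    - by apply: (rare_gap gT.1 gT.2 (v := - rate w L) (x gT)); rewrite normrN rate_small.
  move=> o /= [H|[_ H]|[H|H]|[H|H]].
  - by left; left.
  - by left; right.
  - by right; left; left.
  - by right; left; right.
  - by right; right; left.
  - by right; right; right.
apply: rareW (rare_bigU (fun gT _ => rdev gT)).
rewrite -mulr_sumr.
pose v := expR (- (10 * l)); pose v' := expR (- (10 * L)).
have vE : v = n%:R ^- 10 by rewrite /v expRN expRM_natl lE lnK.
have v'E : v' = (n * p)%:R ^- 10 by rewrite /v' expRN expRM_natl LE lnK.
under eq_bigr => gT _.
  have -> : expR (- x gT) = v ^+ hamming gT.1 fs * v' ^+ #|gT.2|.
    by rewrite /v /v' -!expRM_natl -expRD; congr expR; rewrite /x; ring.
  over.
have n2 : 2 <= n%:R :> R by rewrite ler_nat.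
have np2 : 2 <= (n * p)%:R :> R by rewrite ler_nat.
have KR : K%:R <= n%:R :> R by rewrite ler_nat.
have pR : p%:R <= (n * p)%:R :> R by rewrite ler_nat leq_pmull // ltnW.
have pow (a : R) (k : nat) : 2 <= a -> 2 ^+ k <= a ^+ k.
  by move=> a2; apply: lerXn2r; rewrite ?nnegrE // (le_trans _ a2).
have nKv : n%:R * (K%:R * v) <= n%:R ^- 8.
  rewrite vE; apply: (@le_trans _ _ (n%:R * (n%:R * n%:R ^- 10))).
    by rewrite !ler_wpM2l // ?ler_wpM2r // invr_ge0 exprn_ge0 // ltW.
  by rewrite le_eqVlt; apply/orP; left; apply/eqP; field; rewrite gt_eqF.
have n8 : n%:R ^- 8 <= 2^-1 :> R.
  rewrite lef_pV2 ?posrE ?exprn_gt0 //; apply: le_trans (pow _ 8%N n2); lra.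
have pv' : p%:R * v' <= 2^-1.
  rewrite v'E; apply: (@le_trans _ _ ((n * p)%:R * (n * p)%:R ^- 10)).
    by rewrite ler_wpM2r // invr_ge0 exprn_ge0 // ltW.
  have -> : (n * p)%:R * (n * p)%:R ^- 10 = (n * p)%:R ^- 9 :> R.
    have powV (a : R) : 0 < a -> a * a ^- 10 = a ^- 9 by move=> a0; field; rewrite gt_eqF.
    exact: powV.
  rewrite lef_pV2 ?posrE ?exprn_gt0 //; apply: le_trans (pow _ 9%N np2); lra.
have := @sum_weights R n p K fs v v' (expR_ge0 _) (expR_ge0 _) (le_trans nKv n8) pv'.
move=> /(ler_wpM2l (ler0n R 6)) /le_trans; apply.
apply: (@le_trans _ _ (6 * (4 * n%:R ^- 8))); first by rewrite !ler_wpM2l.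
have -> : n%:R ^- 8 = n%:R ^- 2 * n%:R ^- 6 :> R by field; rewrite gt_eqF.
rewrite mulrA mulrCA ler_piMr ?invr_ge0 ?exprn_ge0 ?(ltW n0) //.
rewrite ler_pdivrMr ?exprn_gt0 // mul1r; apply: le_trans (pow _ 6%N n2); lra.
Qed.

End NoiseEvents.

Section ColumnEvents.
Context (R : realType) (d : measure_display) (Omega : measurableType d)
  (P : probability Omega R) (n p K : nat) (Z : 'I_n * 'I_p -> Omega -> R)
  (X : 'I_n -> 'I_p -> R) (s : R) (fs : 'I_n -> 'I_K).
Hypotheses (gZ : gaussian_field P Z (fun ij => X ij.1 ij.2) s) (s0 : 0 < s)
  (sfs : forall k, exists i, fs i = k) (K0 : (0 < K)%N).
Local Notation E := (noise Z X s).

Lemma rare_quad_fs (j : 'I_p) (L w : R) : 0 < L -> w = Num.sqrt (K%:R * L) ->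
  rare P [set o | 24 * (w + L) < `|quad fs ((E o)^~ j) - K%:R|]%classic
    (2 * expR (- (4 * L))).
Proof.
move=> L0 wE; have KR : 0 < K%:R :> R by rewrite ltr0n.
have w0 : 0 < w by rewrite wE sqrtr_gt0 mulr_gt0.
have u0 : 0 < rate w L by exact: rate_gt0.
have frob : \sum_i \sum_i' level_proj R fs i i' ^+ 2 = K%:R.
  rewrite -[RHS](proj_trace R sfs); apply: eq_bigr => i _.
  rewrite -[RHS](proj_idem R fs); apply: eq_bigr => i' _.
  by rewrite (proj_sym R fs i' i) expr2.
have KF : K%:R <= 2 * K%:R :> R by rewrite ler_peMl ?ler1n // ltW.
(* The projection has trace and squared Frobenius norm K. Taking C = 4 and t = 1 gives 24 = 4 * 4 +
   8; the budget 4 L leaves a tail of (np)^-4, enough for a union over the columns. *)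
have ns := noise_sparse KR L0 (ler0n R 4) ler01 (ltW KR) KF wE.
have bound : 4 * L + 4 * rate w L ^+ 2 * K%:R <= rate w L * (24 * (w + L)).
  have {ns} : 4 * L / rate w L + 4 * rate w L * K%:R <= 24 * (w + L).
    by move: ns; rewrite !mul1r mulr1; have -> : 4 * 4 + 8 = 24 :> R by ring.
  rewrite -(ler_pM2l u0); apply: le_trans.
  by rewrite le_eqVlt; apply/orP; left; apply/eqP; field; rewrite gt_eqF.
have tail v : `|v| <= 4^-1 -> rare P [set o | v * K%:R + 4 * v ^+ 2 * K%:R + 4 * L
    <= v * quad fs ((E o)^~ j)]%classic (expR (- (4 * L))).
  move=> v4; have := @kernel_tail _ _ _ P _ _ _ _ _ gZ s0 (level_proj R fs) [set j]%SET
    v (4 * L) (proj_sym R fs) _ v4.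
  rewrite cards1 !mul1r frob (proj_trace R sfs) => H.
  apply: rare_sub (H _); [move=> o /=|move=> y]; first by rewrite big_set1.
  by rewrite -/(quad fs y) ger0_norm ?quad_ge0 // quad_le.
have r4 : `|rate w L| <= 4^-1 by rewrite ger0_norm ?rate_le4 // ltW.
have -> : 2 * expR (- (4 * L)) = expR (- (4 * L)) + expR (- (4 * L)) by ring.
apply: rare_sub (rareU (tail _ r4) (tail (- rate w L) _)); last by rewrite normrN.
move=> o /=; set Q := quad fs _; rewrite lter_normr => /orP[] H; [left|right].
- have := H; rewrite -(ltr_pM2l u0) => H'; lra.
- have := H; rewrite -(ltr_pM2l u0) sqrrN => H'; lra.
Qed.

Lemma rare_columns (L w : R) : (1 < n)%N -> (0 < p)%N -> L = ln (n * p)%:R ->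
  w = Num.sqrt (K%:R * L) ->
  rare P [set o | exists2 j, xpredT j &
      24 * (w + L) < `|quad fs ((E o)^~ j) - K%:R| \/
      (\sum_i X i j ^+ 2) / 2 + 16 * s ^+ 2 * L <= - 2 * s * \sum_i X i j * E o i j]%classic
    (n%:R ^- 2).
Proof.
move=> n1 p0 LE wE.
have n0 : 0 < n%:R :> R by rewrite ltr0n ltnW.
have np0 : 0 < (n * p)%:R :> R by rewrite ltr0n muln_gt0 ltnW.
have L0 : 0 < L by rewrite LE ln_gt0 // ltr1n (leq_trans n1) // leq_pmulr.
have rcol j : rare P [set o | 24 * (w + L) < `|quad fs ((E o)^~ j) - K%:R| \/
      (\sum_i X i j ^+ 2) / 2 + 16 * s ^+ 2 * L <= - 2 * s * \sum_i X i j * E o i j]%classic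
    (3 * expR (- (4 * L))).
  have -> : 3 * expR (- (4 * L)) = 2 * expR (- (4 * L)) + expR (- (4 * L)) by ring.
  apply: rare_sub (rareU (rare_quad_fs j L0 wE) (rare_inner gZ s0 X [set j]%SET (4 * L))).
  move=> o /= [H|H]; [by left|right; rewrite !big_set1].
  by have -> : 4 * s ^+ 2 * (4 * L) = 16 * s ^+ 2 * L by ring.
apply: rareW (rare_bigU (fun j _ => rcol j)).
rewrite sumr_const card_ord -[_ *+ _]mulr_natl expRN expRM_natl LE lnK ?posrE //.
have pR : 1 <= p%:R :> R by rewrite ler1n.
have nR : 2 <= n%:R :> R by rewrite ler_nat.
have n4 : 4 <= n%:R ^+ 2 :> R.
  have -> : 4 = 2 ^+ 2 :> R by ring.
  by apply: lerXn2r; rewrite ?nnegrE // ltW.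
have p3 : 1 <= p%:R ^+ 3 :> R by rewrite exprn_ege1.
have pne : p%:R != 0 :> R by rewrite gt_eqF // (lt_le_trans _ pR).
rewrite natrM exprMn.
have -> : p%:R * (3 / (n%:R ^+ 4 * p%:R ^+ 4)) = n%:R ^- 2 * (3 / n%:R ^+ 2 / p%:R ^+ 3) :> R.
  by field; rewrite pne gt_eqF.
rewrite ler_piMr ?invr_ge0 ?exprn_ge0 ?(ltW n0) //.
rewrite ler_pdivrMr ?(lt_le_trans _ p3) // mul1r; apply: le_trans p3.
rewrite ler_pdivrMr ?(lt_le_trans _ n4) // mul1r; lra.
Qed.

(** Identity kernel at the rate z / 4, with N = n |S|: the variance term z^2 N / 4 and the budget 3
    l <= 3 z^2 N add up to (z / 4) (13 z N). *)
Lemma rare_variance_upper (S : {set 'I_p}) (z l : R) : (1 < n)%N -> (0 < #|S|)%N ->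
  l = ln n%:R -> z = Num.sqrt (l / n%:R) ->
  rare P [set o | (n * #|S|)%:R * (1 + 13 * z) <
      \sum_(j in S) \sum_i E o i j ^+ 2]%classic (n%:R ^- 2).
Proof.
move=> n1 S0 lE zE.
have n0 : 0 < n%:R :> R by rewrite ltr0n ltnW.
have m1 : 1 <= #|S|%:R :> R by rewrite ler1n.
have l0 : 0 < l by rewrite lE ln_gt0 // ltr1n.
have ln1 : l <= n%:R by rewrite lE ltW // ln_sublinear.
have z0 : 0 < z by rewrite zE sqrtr_gt0 divr_gt0.
have z2 : z ^+ 2 = l / n%:R by rewrite zE sqr_sqrtr // ltW // divr_gt0.
have z1 : z <= 1 by rewrite zE -[leRHS]sqrtr1 ler_sqrt // ler_pdivrMr // mul1r.
have lz : l = z ^+ 2 * n%:R by rewrite z2 divfK // gt_eqF.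
pose B (i i' : 'I_n) : R := (i == i')%:R.
have sumB (F : 'I_n -> 'I_n -> R) : \sum_i \sum_i' B i i' * F i i' = \sum_i F i i.
  apply: eq_bigr => i _; rewrite (bigD1 i) //= /B eqxx mul1r big1 ?addr0 // => i' i'i.
  by rewrite eq_sym (negbTE i'i) mul0r.
have := @kernel_tail _ _ _ P _ _ _ _ _ gZ s0 B S (z / 4) (3 * l) _ _ _.
have -> : \sum_i B i i = n%:R.
  by under eq_bigr do rewrite /B eqxx; rewrite sumr_const card_ord.
have -> : \sum_i \sum_i' B i i' ^+ 2 = n%:R.
  transitivity (\sum_i \sum_i' B i i' * (1 : R)).
    apply: eq_bigr => i _; apply: eq_bigr => i' _.
    by rewrite /B mulr1; case: eqP; rewrite ?expr1n ?expr0n.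
  by rewrite sumB sumr_const card_ord.
move=> H; apply: rareW (rare_sub _ (H _ _ _)).
- rewrite expRN expRM_natl lE lnK ?posrE // lef_pV2 ?posrE ?exprn_gt0 //.
  by rewrite exprS ler_peMl ?exprn_ge0 ?(ltW n0) // ler1n ltnW.
- move=> o /=; rewrite natrM; set Q := \sum_(j in S) _ => HQ.
  have -> : \sum_(j in S) \sum_i \sum_i' B i i' *
      (standardized Z (fun ij => X ij.1 ij.2) s (i, j) o *
       standardized Z (fun ij => X ij.1 ij.2) s (i', j) o) = Q.
    by apply: eq_bigr => j _; rewrite sumB; apply: eq_bigr => i _; rewrite expr2.
  have nm : 0 < n%:R * #|S|%:R :> R by rewrite mulr_gt0 // ltr0n.
  have : z / 4 * (n%:R * #|S|%:R * (1 + 13 * z)) <= z / 4 * Q.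
    by rewrite ler_wpM2l // ?ltW // divr_gt0.
  apply: le_trans.
  have -> : z / 4 * (#|S|%:R * n%:R) + 4 * (z / 4) ^+ 2 * (#|S|%:R * n%:R) + 3 * l =
    z / 4 * (n%:R * #|S|%:R) + z ^+ 2 / 4 * (n%:R * #|S|%:R) + 3 * z ^+ 2 * n%:R.
    by rewrite lz; field.
  have -> : z / 4 * (n%:R * #|S|%:R * (1 + 13 * z)) =
     z / 4 * (n%:R * #|S|%:R) + z ^+ 2 / 4 * (n%:R * #|S|%:R) +
     3 * z ^+ 2 * (n%:R * #|S|%:R) by field.
  rewrite lerD2l; apply: ler_wpM2l; first by rewrite mulr_ge0 // sqr_ge0.
  by rewrite ler_peMr // ltW.
- by move=> i i'; rewrite /B eq_sym.
- move=> y; rewrite sumB ger0_norm; last by apply: sumr_ge0 => i _; rewrite -expr2 sqr_ge0.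
  by apply: ler_sum => i _; rewrite expr2.
- by rewrite ger0_norm; [lra|rewrite divr_ge0 // ltW].
Qed.

(** Either 7 z >= 1 and a - 1 is already large enough, or a <= 2 and exp (- a) >= (1 - a / 2)^2,
    which leaves a^2 / 4 >= 49 z^2 / 4. The coefficient 7 is chosen so that 49 / 4 >= 12. *)
Lemma exp_gap (z a : R) : 0 <= z -> a = 12 * z ^+ 2 + 7 * z ->
  12 * z ^+ 2 <= a - 1 + expR (- a).
Proof.
move=> z0 aE; have z20 : 0 <= z ^+ 2 by exact: sqr_ge0.
have [z7|z7] := leP 1 (7 * z).
  by have := expR_ge0 (- a); lra.
have z2z : z ^+ 2 <= z / 7 by rewrite expr2 ler_wpM2l //; lra.
have a2 : a <= 2 by lra.
have : (1 - a / 2) ^+ 2 <= expR (- a).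
  have -> : expR (- a) = expR (- (a / 2)) ^+ 2.
    by rewrite -expRM_natl; congr expR; field.
  apply: lerXn2r; rewrite ?nnegrE ?expR_ge0 //; first lra.
  by have := expR_ge1Dx (- (a / 2)); lra.
have a7 : (7 * z) ^+ 2 <= a ^+ 2.
  by apply: lerXn2r; rewrite ?nnegrE; lra.
have -> : (1 - a / 2) ^+ 2 = 1 - a + a ^+ 2 / 4 by field.
by move: a7; rewrite exprMn; lra.
Qed.

(** The union runs over at most 2^p <= 4^m sets because p < 2 m. A single set fails with probability
    n^(-6m), the 6 being half of the 12 in [exp_gap], so the total is at most n^(-4m). *)
Lemma rare_variance_lower (m : nat) (z l a : R) : (1 < n)%N -> (p < m.*2)%N ->
  l = ln n%:R -> z = Num.sqrt (l / n%:R) -> a = 12 * z ^+ 2 + 7 * z ->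
  rare P [set o | exists2 S : {set 'I_p}, #|S| == m &
      \sum_(j in S) \sum_i Z (i, j) o ^+ 2 <=
      s ^+ 2 * (n * m)%:R * expR (- a)]%classic (n%:R ^- 2).
Proof.
move=> n1 pm lE zE aE.
have n0 : 0 < n%:R :> R by rewrite ltr0n ltnW.
have n2 : 2 <= n%:R :> R by rewrite ler_nat.
have m0 : (0 < m)%N by case: (m) pm.
have l0 : 0 < l by rewrite lE ln_gt0 // ltr1n.
have z0 : 0 < z by rewrite zE sqrtr_gt0 divr_gt0.
have z2 : z ^+ 2 = l / n%:R by rewrite zE sqr_sqrtr // ltW // divr_gt0.
have a0 : 0 < a by rewrite aE addr_gt0 ?mulr_gt0 ?exprn_gt0.
have rS (S : {set 'I_p}) : #|S| == m -> rare P [set o |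
    \sum_(j in S) \sum_i Z (i, j) o ^+ 2 <=
      s ^+ 2 * (n * m)%:R * expR (- a)]%classic ((n%:R ^- 6) ^+ m).
  move=> /eqP Sm; have := sqnorm_lower_tail gZ s0 S a0; rewrite Sm; apply: rareW.
  have -> : (n%:R ^- 6 : R) ^+ m = expR (- (m%:R * (6 * l))).
    by rewrite -mulrN expRM_natl expRN expRM_natl lE lnK.
  rewrite ler_expR lerN2 natrM.
  have := exp_gap (ltW z0) aE; rewrite z2 => H.
  apply: (@le_trans _ _ (n%:R * m%:R / 2 * (12 * (l / n%:R)))).
    by rewrite le_eqVlt; apply/orP; left; apply/eqP; field; rewrite gt_eqF.
  by apply: ler_wpM2l => //; rewrite divr_ge0 // mulr_ge0.
apply: rareW (rare_bigU rS).
have v0 : 0 <= n%:R ^- 6 :> R by rewrite invr_ge0 exprn_ge0 // ltW.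
apply: (@le_trans _ _ (\sum_(S : {set 'I_p}) (n%:R ^- 6) ^+ m)).
  rewrite big_mkcond; apply: ler_sum => S _.
  by case: ifP => _; [exact: lexx|exact: exprn_ge0].
rewrite sumr_const -[_ *+ _]mulr_natl -cardsT -powersetT card_powerset cardsT card_ord.
have n4 : 4 <= n%:R ^+ 2 :> R.
  have -> : 4 = 2 ^+ 2 :> R by ring.
  by apply: lerXn2r; rewrite ?nnegrE // ltW.
apply: (@le_trans _ _ ((4 * n%:R ^- 6) ^+ m)).
  rewrite exprMn ler_wpM2r ?exprn_ge0 //.
  have -> : 4 = (2 ^ 2)%:R :> R by [].
  rewrite -natrX ler_nat -expnM leq_exp2l // mul2n; exact: ltnW.
have h4 : 4 * n%:R ^- 6 <= n%:R ^- 4 :> R.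
  have -> : n%:R ^- 4 = n%:R ^+ 2 * n%:R ^- 6 :> R by field; rewrite gt_eqF.
  by rewrite ler_wpM2r.
apply: (@le_trans _ _ ((n%:R ^- 4) ^+ m)).
  by apply: lerXn2r; rewrite ?nnegrE ?mulr_ge0 ?invr_ge0 ?exprn_ge0 ?(ltW n0).
rewrite -exprVn -exprM -exprVn; apply: ler_wiXn2l.
- by rewrite invr_ge0 ltW.
- by rewrite invf_le1 //; lra.
- by case: (m) m0 => // m'; rewrite mulnS.
Qed.

End ColumnEvents.

(** * The estimator *)

Section Partitions.
Context (n K : nat).

Definition surj_fun (f : 'I_n -> 'I_K) := [forall k, exists i, f i == k].

Lemma surj_funP (f : 'I_n -> 'I_K) : reflect (forall k, exists i, f i = k) (surj_fun f).
Proof.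
apply: (iffP forallP) => H k; first by have /existsP[i /eqP] := H k; exists i.
by have [i fi] := H k; apply/existsP; exists i; apply/eqP.
Qed.

Definition classes (f : 'I_n -> 'I_K) (k : 'I_K) : {set 'I_n} := [set i | f i == k]%SET.

Lemma classes_Kpartition (f : 'I_n -> 'I_K) : (forall k, exists i, f i = k) ->
  is_Kpartition K (unlabelled (classes f)).
Proof.
move=> sf; rewrite /is_Kpartition /unlabelled; apply/andP; split; last first.
  rewrite card_imset ?card_ord //= => k k' kk'; have [i fi] := sf k.
  have : i \in classes f k' by rewrite -kk' inE fi.
  by rewrite inE fi => /eqP.
apply/and3P; split.
- rewrite finset.eqEsubset finset.subsetT; apply/fintype.subsetP => i _.
  by apply/bigcupP; exists (classes f (f i)); [exact: imset_f|rewrite inE].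
- apply/finset.trivIsetP => _ _ /imsetP[k _ ->] /imsetP[k' _ ->] kk'.
  rewrite -setI_eq0; apply/eqP/finset.setP => i; rewrite !inE; apply/negbTE.
  by apply: contra kk' => /andP[/eqP <- /eqP <-].
- apply/imsetP => -[k _ /finset.setP]; have [i fi] := sf k.
  by move=> /(_ i); rewrite !inE fi eqxx.
Qed.

Lemma classes_comp (f g : 'I_n -> 'I_K) (q : 'I_K -> 'I_K) : injective q ->
  q \o f =1 g -> unlabelled (classes f) = unlabelled (classes g).
Proof.
move=> injq fg; have E k : classes f k = classes g (q k).
  by apply/finset.setP => i; rewrite !inE -fg /= (inj_eq injq).
have [q' _ qK'] := injF_bij injq.
apply/finset.setP => A; apply/imsetP/imsetP => -[k _ ->].
  by exists (q k) => //; rewrite E.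
by exists (q' k) => //; rewrite E qK'.
Qed.

End Partitions.

Section Estimator.
Context (R : realType) (n p K s : nat).
Implicit Types (y : n.-tuple (p.-tuple R)) (S : {set 'I_p}).

Definition entry y (i : 'I_n) (j : 'I_p) : R := tnth (tnth y i) j.

Definition column_norm y S := \sum_(j in S) \sum_i entry y i j ^+ 2.

(** The default, the norm of all columns together, dominates every term, so it does not affect a
    minimum over a nonempty family. *)
Definition min_norm y (m : nat) : R :=
  \big[Order.min/column_norm y [set: 'I_p]%SET]_(S : {set 'I_p} | #|S| == m)
    column_norm y S.

Definition log_level : R := Num.sqrt (ln n%:R / n%:R).
(** Logarithm of the factor by which the columns of smallest norm may underestimate the variance,
    uniformly over the sets of columns; the penalty multiplies it back. *)
Definition inflation : R := 12 * log_level ^+ 2 + 7 * log_level.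
Definition column_level : R :=
  Num.sqrt (K%:R * ln (n * p)%:R) + ln (n * p)%:R.

(* At least p - s columns carry no signal: the p - s columns of smallest total
   norm estimate the variance, hence the noise level of a projected column. *)
Definition penalty y : R :=
  expR inflation * (min_norm y (p - s) / (n * (p - s))%:R) *
  (K%:R + 152 * column_level).

Definition candidate : finType := ({ffun 'I_n -> 'I_K} * {set 'I_p})%type.

Definition admissible (c : candidate) : bool :=
  surj_fun c.1 && (if (p <= s.*2)%N then c.2 == [set: 'I_p]%SET else (#|c.2| <= s)%N).

Definition score y (c : candidate) : R := crit c.1 (penalty y) (entry y) c.2.

Definition optimal y (c : candidate) : bool :=
  admissible c && [forall c', admissible c' ==> (score y c' <= score y c)].

(** Passing through the finite table [b] of optimality tests reduces measurability to that of each
    test. The fallback [f0] makes every table decode to a partition. *)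
Definition decode (f0 : {ffun 'I_n -> 'I_K}) (b : {ffun candidate -> bool}) :=
  unlabelled (classes (if [pick c | b c] is Some c then
    (if surj_fun c.1 then c.1 else f0) else f0)).

Definition estimate f0 y : {set {set 'I_n}} := decode f0 [ffun c => optimal y c].

Lemma measurable_entry i j : measurable_fun setT (fun y => entry y i j).
Proof.
apply: (measurableT_comp (f := fun t : p.-tuple R => tnth t j)).
  exact: measurable_tnth.
exact: measurable_tnth.
Qed.

Lemma measurable_column_norm S : measurable_fun setT (column_norm^~ S).
Proof.
apply: measurable_sum_in => j; apply: measurable_sum => i.
by apply: measurable_funX; exact: measurable_entry.
Qed.

Lemma measurable_min_norm m : measurable_fun setT (min_norm^~ m).
Proof.
rewrite /min_norm; elim: (index_enum _) => [|S r IH].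
  by under eq_fun do rewrite big_nil; exact: measurable_column_norm.
under eq_fun do rewrite big_cons; case: (#|S| == m) => //.
by apply: measurable_minr => //; exact: measurable_column_norm.
Qed.

Lemma measurable_score c : measurable_fun setT (score^~ c).
Proof.
apply: measurable_sum_in => j; apply: measurable_funB.
  apply: measurable_sum => i; apply: measurable_sum => i'.
  by apply: measurable_funM => //; apply: measurable_funM; exact: measurable_entry.
apply: measurable_funM => //; apply: measurable_funM => //.
by apply: measurable_funM => //; exact: measurable_min_norm.
Qed.

Lemma measurable_optimal c : measurable [set y | optimal y c]%classic.
Proof.
case: (boolP (admissible c)) => ac; last first.
  rewrite (_ : [set _ | _]%classic = set0) //.
  by apply/seteqP; split=> y //=; rewrite /optimal (negbTE ac).
rewrite (_ : [set _ | _] = \bigcap_(c' in [set c' | admissible c'])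
    [set y | (score y c' <= score y c)%R])%classic; last first.
  apply/seteqP; split=> y /=.
    by move=> /andP[_ /forallP H] c' /= ac'; have /implyP := H c'; apply.
  move=> H; rewrite /optimal ac; apply/forallP => c'; apply/implyP => ac'.
  exact: H.
apply: fin_bigcap_measurable => [|c' _]; first exact: finite_finset.
by apply: measurable_le_set; exact: measurable_score.
Qed.

Lemma measurable_estimate f0 (C : {set {set 'I_n}}) :
  measurable [set y | estimate f0 y = C]%classic.
Proof.
rewrite (_ : [set _ | _] = \bigcup_(b in [set b | decode f0 b = C])
  \bigcap_(c in [set: candidate]) [set y | optimal y c = b c])%classic; last first.
  apply/seteqP; split=> y /=.
    by move=> yC; exists [ffun c => optimal y c] => //= c _; rewrite ffunE.
  move=> [b /= bC H]; rewrite /estimate (_ : [ffun c => _] = b) //.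
  by apply/ffunP => c; rewrite ffunE; exact: H.
apply: fin_bigcup_measurable => [|b _]; first exact: finite_finset.
apply: fin_bigcap_measurable => [|c _]; first exact: finite_finset.
case: (b c).
  by rewrite (_ : [set _ | _]%classic = [set y | optimal y c]%classic) //; exact: measurable_optimal.
rewrite (_ : [set _ | _] = ~` [set y | optimal y c])%classic.
  by apply: measurableC; exact: measurable_optimal.
by apply/seteqP; split=> y /=; case: (optimal y c) => //= /(_ isT).
Qed.

Lemma estimate_Kpartition (f0 : {ffun 'I_n -> 'I_K}) y : surj_fun f0 -> is_Kpartition K (estimate f0 y).
Proof.
move=> sf0; apply: classes_Kpartition; case: pickP => [c _|_]; last exact/surj_funP.
by case: (boolP (surj_fun c.1)) => [/surj_funP|_] //; exact/surj_funP.
Qed.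

(** Ties are left to the choice operator: correctness is later shown for every maximiser. *)
Lemma estimateE f0 y c0 : admissible c0 ->
  exists c, [/\ admissible c, forall c', admissible c' -> score y c' <= score y c
    & estimate f0 y = unlabelled (classes c.1)].
Proof.
move=> ac0; rewrite /estimate /decode; case: pickP => [c|none].
  rewrite ffunE => /andP[ac /forallP H]; exists c; split=> //.
    by move=> c' ac'; have /implyP := H c'; apply.
  by move: (ac) => /andP[-> _].
have [c ac cmax] := @Order.TotalTheory.arg_maxP _ _ _ c0 admissible (score y) ac0.
by have := none c; rewrite ffunE /optimal ac /=; move=> /forallP[]; move=> c'; apply/implyP => /cmax.
Qed.

End Estimator.

Lemma exists_card_subset (T : finType) (A : {set T}) (m : nat) : (m <= #|A|)%N ->
  exists2 S : {set T}, S \subset A & #|S| = m.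
Proof.
move=> mA; pose t := take m (enum A); exists [set x in t]%SET.
  by apply/fintype.subsetP => x; rewrite inE => /mem_take; rewrite mem_enum.
rewrite cardsE; have /card_uniqP -> : uniq t by rewrite take_uniq // enum_uniq.
by rewrite size_take -cardE; case: ltngtP mA.
Qed.

(** * The clustering model as a Gaussian field *)

Section Model.
Context (R : realType) (n p K : nat) (G : 'I_K -> {set 'I_n}) (mu : 'M[R]_(K, p)).

Lemma labelled_partition_fun : labelled_partition G ->
  exists fs : 'I_n -> 'I_K, [/\ forall i k, (i \in G k) = (fs i == k),
    forall k, exists i, fs i = k & unlabelled G = unlabelled (classes fs)].
Proof.
case=> injG /and3P[/eqP covG trG G0].
have ex i : exists k, i \in G k.
  have : i \in finset.cover (unlabelled G) by rewrite covG inE.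
  by move=> /bigcupP[_ /imsetP[k _ ->]]; exists k.
pose fs i := xchoose (ex i).
have fsG i k : (i \in G k) = (fs i == k).
  apply/idP/eqP => [iGk|<-]; last exact: xchooseP (ex i).
  apply/eqP; apply: contraTT isT => fik.
  have /(_ (G (fs i)) (G k) (imset_f _ _) (imset_f _ _)) := finset.trivIsetP trG.
  rewrite (inj_eq injG) => /(_ isT isT fik) /pred0P /(_ i) /=.
  by rewrite iGk (xchooseP (ex i)).
exists fs; split=> // [k|].
  have : G k != finset.set0.
    by apply: contraNneq G0 => <-; exact: imset_f.
  by case/set0Pn => i; rewrite fsG => /eqP; exists i.
apply: eq_imset => k; apply/finset.setP => i; by rewrite fsG inE.
Qed.

Context (fs : 'I_n -> 'I_K).
Hypothesis fsG : forall i k, (i \in G k) = (fs i == k).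

Lemma card_class k : #|G k| = clsize fs k.
Proof. by apply: eq_card => i; rewrite fsG inE. Qed.

Lemma signalE i j : signal G mu i j = mu (fs i) j.
Proof.
rewrite mxE (eq_bigl (fun k => k == fs i)) ?big_pred1_eq // => k.
by rewrite fsG eq_sym.
Qed.

(** Here [b] is the smallest group size; [n] is at most K times the largest one, hence at most K
    gamma b. *)
Lemma balanced_sizes (gamma : R) : (0 < n)%N -> 1 <= gamma ->
  (forall k, exists i, fs i = k) -> balanced G gamma ->
  exists2 b : R, 0 < b & [/\ forall k, b <= (clsize fs k)%:R <= gamma * b &
    n%:R <= K%:R * (gamma * b)].
Proof.
move=> n0 gamma1 sfs; rewrite /balanced.
set b := (\big[minn/n]_(k < K) #|G k|)%N; set mx := (\max_(k < K) _)%N => bal.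
have size0 k : (0 < #|G k|)%N.
  by have [i fi] := sfs k; apply/card_gt0P; exists i; rewrite fsG fi.
have b0 : (0 < b)%N.
  rewrite /b; elim/big_ind: _ => // x y x0 y0.
  by rewrite leq_min x0.
have bk k : (b <= #|G k|)%N.
  rewrite /b; have := mem_index_enum k; elim: (index_enum _) => // k' r IH.
  rewrite inE big_cons => /orP[/eqP <-|/IH]; first exact: geq_minl.
  by apply: leq_trans; exact: geq_minr.
have mxk k : (#|G k| <= mx)%N by exact: leq_bigmax.
have bR : 0 < b%:R :> R by rewrite ltr0n.
have mxb : mx%:R <= gamma * b%:R :> R by rewrite -ler_pdivrMr.
exists b%:R => //; split=> [k|].
  rewrite -card_class ler_nat bk /=; apply: le_trans mxb; by rewrite ler_nat.
apply: (@le_trans _ _ (K%:R * mx%:R)); last by rewrite ler_wpM2l.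
rewrite -natrM ler_nat -[leqLHS](card_ord n) -sum1_card (partition_big fs predT) //=.
rewrite -[K in leqRHS](card_ord K) -sum_nat_const; apply: leq_sum => k _.
rewrite sum1_card; apply: leq_trans (mxk k); rewrite card_class /clsize.
by apply: subset_leq_card; apply/fintype.subsetP => i; rewrite inE unfold_in.
Qed.

Lemma model_field (sigma : R) (d : measure_display) (Omega : measurableType d)
    (P : probability Omega R) (Y : {mfun Omega >-> n.-tuple (p.-tuple R)}) :
  clustering_model G mu sigma P Y ->
  gaussian_field P (fun (ij : 'I_n * 'I_p) w => entry (Y w) ij.1 ij.2)
    (fun ij => mu (fs ij.1) ij.2) sigma.
Proof.
case=> indep rows; split=> [[i j]|B mB] /=.
  exact: (measurableT_comp (measurable_entry i j)).
pose B' i := box (fun j => B (i, j)).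
have mB' i : measurable (B' i) by apply: measurable_box => j; exact: mB.
transitivity (P [set w | forall i, i \in [set: 'I_n]%SET -> B' i (tnth (Y w) i)]%classic).
  congr (P _); apply/seteqP; split=> w /= H; first by move=> i _ j; exact: (H (i, j)).
  by move=> [i j]; exact: (H i (finset.in_setT i) j).
rewrite indep //.
transitivity (\prod_(i < n) \prod_(j < p) normal_prob (mu (fs i) j) sigma (B (i, j)))%E.
  apply: eq_big => [i|i _]; first by rewrite inE.
  have iG : i \in G (fs i) by rewrite fsG.
  exact: (rows _ _ iG (fun j => B (i, j)) (fun j => mB (i, j))).
by rewrite pair_bigA; apply: eq_bigr => -[i j].
Qed.

End Model.

(** * Correctness of the estimator *)

Section Constants.
Context (R : realType).

(** For z <= 1 the inflation is at most 19 z, and exp (19 z) <= 1 + k z with k = 19 exp 19.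
    Multiplying by 1 + 13 z and using z^2 <= z gives 14 k + 13. *)
Definition slack : R := 14 * (19 * expR 19) + 13.
(** From (1 + slack z) (K + 152 t), with z K <= t and z t <= t. *)
Definition penalty_cst : R := 152 + slack + slack * 152.

Lemma slack_gt0 : 0 < slack.
Proof. by rewrite /slack; have := expR_gt0 (19 : R); lra. Qed.

Lemma penalty_cst_gt0 : 0 < penalty_cst.
Proof. by rewrite /penalty_cst; have := slack_gt0; lra. Qed.

Lemma inflation_le (z a : R) : 0 <= z -> z <= 1 -> a = 12 * z ^+ 2 + 7 * z ->
  expR a * (1 + 13 * z) <= 1 + slack * z.
Proof.
move=> z0 z1 aE; pose k := 19 * expR (19 : R).
have k0 : 0 < k by rewrite mulr_gt0 // expR_gt0.
have z2 : z ^+ 2 <= z by rewrite expr2 ler_piMr.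
have e1 : expR a <= 1 + k * z.
  have : expR a <= expR (19 * z) by rewrite ler_expR aE; lra.
  move/le_trans; apply.
  have h1 : expR (19 * z) <= expR 19 by rewrite ler_expR; lra.
  have h2 : 1 - 19 * z <= expR (- (19 * z)) by have := expR_ge1Dx (- (19 * z)); lra.
  have h3 : expR (19 * z) * expR (- (19 * z)) = 1 by rewrite -expRD subrr expR0.
  have h4 : expR (19 * z) * (1 - 19 * z) <= 1 by rewrite -[leRHS]h3 ler_wpM2l // expR_ge0.
  have h5 : 19 * z * expR (19 * z) <= 19 * z * expR 19 by rewrite ler_wpM2l // mulr_ge0.
  by rewrite /k; lra.
have z13 : 0 <= 1 + 13 * z by lra.
apply: le_trans (ler_wpM2r z13 e1) _.
have -> : (1 + k * z) * (1 + 13 * z) = 1 + k * z + 13 * z + 13 * (k * z ^+ 2) by ring.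
have : k * z ^+ 2 <= k * z by rewrite ler_wpM2l // ltW.
have -> : slack * z = 14 * (k * z) + 13 * z by rewrite /slack /k; ring.
lra.
Qed.

(** The inflation cancels the worst underestimate of the variance, hence the lower bound. The
    overestimate is relative, of order z, and z K <= t turns its effect on K into a multiple of
    t. *)
Lemma penalty_bounds (K t z a V N v : R) : 0 < v -> 0 < N -> 0 <= z -> z <= 1 ->
  a = 12 * z ^+ 2 + 7 * z -> 0 <= K -> 0 <= t -> z * K <= t ->
  v * N * expR (- a) <= V -> V <= v * N * (1 + 13 * z) ->
  v * (K + 152 * t) <= expR a * (V / N) * (K + 152 * t) <= v * (K + penalty_cst * t).
Proof.
move=> v0 N0 z0 z1 aE K0 t0 zK Vlo Vhi.
have Kt : 0 <= K + 152 * t by lra.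
have ea : expR a * expR (- a) = 1 by rewrite -expRD subrr expR0.
apply/andP; split.
  apply: ler_wpM2r => //; rewrite mulrA ler_pdivlMr //.
  have -> : v * N = expR a * (v * N * expR (- a)) by rewrite mulrCA ea mulr1.
  by apply: ler_wpM2l => //; exact: expR_ge0.
apply: (@le_trans _ _ (v * (1 + slack * z) * (K + 152 * t))).
  apply: ler_wpM2r => //; rewrite mulrA ler_pdivrMr //.
  apply: (@le_trans _ _ (expR a * (v * N * (1 + 13 * z)))).
    by apply: ler_wpM2l => //; exact: expR_ge0.
  have -> : expR a * (v * N * (1 + 13 * z)) = v * N * (expR a * (1 + 13 * z)) by ring.
  have -> : v * (1 + slack * z) * N = v * N * (1 + slack * z) by ring.
  by apply: ler_wpM2l; [rewrite mulr_ge0 // ltW|exact: inflation_le].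
rewrite -mulrA; apply: ler_wpM2l; first exact: ltW.
have sl := slack_gt0.
have h1 : slack * (z * K) <= slack * t by apply: ler_wpM2l => //; exact: ltW.
have h2 : slack * (z * t) <= slack * t.
  by apply: ler_wpM2l; [exact: ltW|rewrite ler_piMl].
rewrite /penalty_cst; lra.
Qed.

End Constants.

Section MainEvent.
Context (R : realType) (n p K s : nat) (fs : 'I_n -> 'I_K) (mu : 'M[R]_(K, p))
  (J : {set 'I_p}) (sigma gamma b : R) (f0 : {ffun 'I_n -> 'I_K})
  (d : measure_display) (Omega : measurableType d) (P : probability Omega R)
  (Y : {mfun Omega >-> n.-tuple (p.-tuple R)}).
Local Notation X := (fun i j => mu (fs i) j).
Local Notation Z := (fun (ij : 'I_n * 'I_p) w => entry (Y w) ij.1 ij.2).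
Local Notation E := (noise Z X sigma).
Local Notation l := (ln n%:R : R).
Local Notation L := (ln (n * p)%:R : R).
Local Notation w := (Num.sqrt (K%:R * L)).
Local Notation s2 := ((2 * s)%:R : R).
Local Notation q := (Num.sqrt (s2 * K%:R / n%:R * l)).
Hypotheses (K2 : (2 <= K)%N) (Kn : (K <= n)%N) (s1 : (1 <= s)%N) (sp : (s <= p)%N)
  (sigma0 : 0 < sigma) (gamma1 : 1 <= gamma) (sfs : forall k, exists i, fs i = k)
  (b0 : 0 < b) (bal : forall k, b <= (clsize fs k)%:R <= gamma * b)
  (nb : n%:R <= K%:R * (gamma * b)) (Js : (#|J| <= s)%N) (suppJ : supported_on mu J)
  (gZ : gaussian_field P Z (fun ij => mu (fs ij.1) ij.2) sigma)
  (signalJ : forall j, j \in J ->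
    4 * (penalty_cst R + 168) * sigma ^+ 2 * (w + L) <= \sum_i X i j ^+ 2)
  (Delta : R) (sepX : forall k k', k != k' ->
    2 * sigma ^+ 2 * Delta <= \sum_j (mu k j - mu k' j) ^+ 2)
  (DeltaE : 2016 * gamma * (q + l) < Delta).

Let n1 : (1 < n)%N. Proof. exact: leq_trans K2 Kn. Qed.
Let p0 : (0 < p)%N. Proof. exact: leq_trans s1 sp. Qed.
Let K0 : (0 < K)%N. Proof. exact: leq_trans K2. Qed.
Let nR : 0 < n%:R :> R. Proof. by rewrite ltr0n ltnW. Qed.
Let KR : 0 < K%:R :> R. Proof. by rewrite ltr0n. Qed.
Let l0 : 0 < l. Proof. by rewrite ln_gt0 // ltr1n. Qed.
Let np1 : (1 < n * p)%N. Proof. by rewrite (leq_trans n1) // leq_pmulr. Qed.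
Let L0 : 0 < L. Proof. by rewrite ln_gt0 // ltr1n. Qed.
Let lL : l <= L.
Proof. by rewrite ler_ln ?posrE ?ltr0n ?muln_gt0 ?(ltnW n1) // ler_nat leq_pmulr. Qed.
Let w0 : 0 < w. Proof. by rewrite sqrtr_gt0 mulr_gt0. Qed.
Let s20 : 0 < s2. Proof. by rewrite ltr0n muln_gt0. Qed.
Let q0 : 0 < q. Proof. by rewrite sqrtr_gt0 mulr_gt0 // divr_gt0 // mulr_gt0. Qed.

Let entryE o : entry (Y o) = data X (E o) sigma.
Proof.
apply/funext => i; apply/funext => j.
by rewrite /data /noise /standardized /= mulrCA divff ?gt_eqF // mulr1 addrC subrK.
Qed.

Lemma level_proj_comp (f : 'I_n -> 'I_K) (pi : 'I_K -> 'I_K) : injective pi ->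
  level_proj R (pi \o f) = level_proj R f.
Proof.
move=> injpi; apply/funext => i; apply/funext => i'; rewrite /level_proj /= (inj_eq injpi).
congr (_ / _%:R); apply: eq_card => i2; by rewrite !inE /= (inj_eq injpi).
Qed.

(** Covers both regimes: [J0] is the true support when 2 s < p, and the set of all columns
    otherwise. This is why sizes are bounded by 2 s. *)
Lemma estimate_correct (J0 : {set 'I_p}) (o : Omega) :
  (forall i j, j \notin J0 -> X i j = 0) ->
  (#|J0| <= 2 * s)%N ->
  admissible s (finfun fs, J0) ->
  (forall c : candidate n p K, admissible s c -> (#|c.2| <= 2 * s)%N) ->
  ~ (exists2 gT, gT.1 != finfun fs & deviations Z X sigma fs J0 l L q w o gT) ->
  (forall (c : candidate n p K) j, admissible s c -> j \in c.2 :\: J0 ->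
    sigma ^+ 2 * quad fs ((E o)^~ j) - penalty K s (Y o) <=
      - (sigma ^+ 2 * (128 * (w + L)))) ->
  (forall (c : candidate n p K) j, admissible s c -> j \in J0 :\: c.2 ->
    penalty K s (Y o) - quad fs ((data X (E o) sigma)^~ j) <=
     - ((\sum_i X i j ^+ 2) / 4) - sigma ^+ 2 * (128 * (w + L))) ->
  estimate s f0 (Y o) = unlabelled (classes fs).
Proof.
move=> XJ0 cardJ0 adm0 cardc nodev colS colM.
have [[f Jh] [adm fmax ->]] := estimateE f0 (Y o) adm0.
have sf : forall k, exists i, f i = k by case/andP: (adm) => /surj_funP.
have gamma0 : 0 <= gamma by exact: le_trans ler01 gamma1.
have [pi injpi ham] := relabeling sf gamma0 bal.
apply: (classes_comp injpi).
pose g := finfun (pi \o f).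
have gE : (g : 'I_n -> 'I_K) = pi \o f by apply/funext => i; rewrite ffunE.
(* The relabelled [g] has the projection of the maximiser [f], hence the same score. *)
have projE : level_proj R g = level_proj R f by rewrite gE; exact: level_proj_comp.
rewrite -gE.
have sg : forall k, exists i, g i = k.
  have [pi' _ piK] := injF_bij injpi.
  by move=> k; have [i fi] := sf (pi' k); exists i; rewrite gE /= fi piK.
case: (eqVneq g (finfun fs)) => [->|gfs]; first by move=> i; rewrite ffunE.
have tr0 : \sum_i (level_proj R g i i - level_proj R fs i i) = 0.
  by rewrite sumrB !proj_trace // subrr.
have good T : ~ deviations Z X sigma fs J0 l L q w o (g, T).
  by move=> dv; apply: nodev; exists (g, T).
have impE : impurity R g fs = impurity R f fs by rewrite /impurity projE.
apply: (@recovery R n p K fs g X (E o) sigma (penalty K s (Y o)) b gamma Delta s2 l L J0 Jh) => //.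
- by move=> i i' j ->.
- exact: ltnW.
- by move=> k; case/andP: (bal k).
- rewrite impE {1}gE; apply: le_trans ham _.
  have D0 : 0 <= impurity R f fs.
    by apply: sumr_ge0 => i _; apply: sumr_ge0 => i' _; rewrite mulr_ge0 ?proj_ge0.
  by rewrite [leRHS]mulrA; rewrite ler_wpM2r // mulr_natl mulr2n lerD2r.
- by move=> i i' ii'; exact: sepX.
- by rewrite ler_nat.
- rewrite ler_nat; apply: leq_trans (cardc _ adm).
  by apply: subset_leq_card; exact: finset.subsetDl.
(* With the forgotten columns as [T], the set [J0] minus [T] is that of the common columns, and only
   the forgotten ones enter the budget. *)
- rewrite leNgt; apply/negP => H; apply: (good (J0 :\: Jh)); apply: Or41 => /=.
  by rewrite finset.setDDr finset.setDv finset.set0U; exact: ltW.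
(* [J0] is fixed, so its event is attached to the empty [T] and its budget has no column term. *)
- rewrite leNgt; apply/negP => H; apply: (good finset.set0); apply: Or42 => /=.
  split=> //; rewrite tr0 !mulr0 add0r cards0 mul0r addr0; exact: ltW.
- move=> T v _ vin; rewrite leNgt; apply/negP => H; apply: (good T).
  move: vin H; rewrite !inE => /or4P[] /eqP -> H.
  + by apply: Or43; left; rewrite /= tr0 !mulr0 add0r ltW.
  + by apply: Or43; right; rewrite /= tr0 !mulr0 add0r ltW.
  + by apply: Or44; left; rewrite /= tr0 !mulr0 add0r ltW.
  + by apply: Or44; right; rewrite /= tr0 !mulr0 add0r ltW.
- by move=> j jS; exact: (colS (f, Jh)).
- by move=> j jM; exact: (colM (f, Jh)).
- have := fmax _ adm0; rewrite /score entryE /=.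
  have -> : crit g (penalty K s (Y o)) (data X (E o) sigma) Jh =
      crit f (penalty K s (Y o)) (data X (E o) sigma) Jh.
    by rewrite /crit /quad projE.
  have -> // : crit (finfun fs) (penalty K s (Y o)) (data X (E o) sigma) J0 =
      crit fs (penalty K s (Y o)) (data X (E o) sigma) J0.
  by rewrite (_ : (finfun fs : 'I_n -> 'I_K) = fs) //; apply/funext => i; rewrite ffunE.
Qed.

Local Notation z := (log_level R n).
Local Notation a := (inflation R n).

Let z0 : 0 <= z. Proof. exact: sqrtr_ge0. Qed.

Let ln_le_n : l <= n%:R. Proof. by rewrite ltW // ln_sublinear. Qed.

Let z1 : z <= 1.
Proof. by rewrite /log_level -[leRHS]sqrtr1 ler_sqrt // ler_pdivrMr // mul1r. Qed.

(** Squared, z K is K^2 l / n <= K l <= K L, as K <= n. *)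
Let zK : z * K%:R <= w + L.
Proof.
have KnR : K%:R <= n%:R :> R by rewrite ler_nat.
apply: (@le_trans _ _ w); last by rewrite lerDl ltW.
have KE : K%:R = Num.sqrt (K%:R ^+ 2) :> R by rewrite sqrtr_sqr ger0_norm.
rewrite {1}KE.
rewrite /log_level -sqrtrM ?(divr_ge0 (ltW l0) (ltW nR)) // ler_sqrt ?mulr_ge0 ?(ltW L0) //.
rewrite mulrAC ler_pdivrMr // expr2.
have -> : l * (K%:R * K%:R) = K%:R * l * K%:R by ring.
apply: ler_pM => //; first by rewrite mulr_ge0 // ltW.
by apply: ler_wpM2l.
Qed.

(** The only admissible set of columns is the full one, so no column can be wrongly selected or
    forgotten and the conditions on the penalty are vacuous. *)
Lemma estimate_whole : (p <= s.*2)%N ->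
  rare P [set o | estimate s f0 (Y o) <> unlabelled (classes fs)]%classic (n%:R ^- 2).
Proof.
move=> ps.
apply: rare_sub; last exact: (@rare_deviations R d Omega P n p K Z X sigma fs gZ sigma0
  [set: 'I_p]%SET l L q w n1 Kn p0 erefl erefl q0 w0).
move=> o; apply: contra_notP => nodev.
have card_le (c : candidate n p K) : (#|c.2| <= 2 * s)%N.
  by rewrite mul2n (leq_trans _ ps) // -[leqRHS](card_ord p) max_card.
apply: (@estimate_correct [set: 'I_p]%SET o) => //.
- by move=> i j; rewrite inE.
- by rewrite cardsT card_ord mul2n.
- rewrite /admissible ps eqxx andbT /=; apply/surj_funP => k.
  by have [i fi] := sfs k; exists i; rewrite ffunE.
- move=> c j /andP[_]; rewrite ps => /eqP ->.
  by rewrite finset.setDv inE.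
- move=> c j /andP[_]; rewrite ps => /eqP ->.
  by rewrite finset.setDv inE.
Qed.

Lemma estimate_sparse : (s.*2 < p)%N ->
  rare P [set o | estimate s f0 (Y o) <> unlabelled (classes fs)]%classic
    (n%:R ^- 2 + n%:R ^- 2 + (n%:R ^- 2 + n%:R ^- 2)).
Proof.
move=> ps; pose m := (p - s)%N.
have m0 : (0 < m)%N by rewrite subn_gt0 (leq_ltn_trans _ ps) // -addnn leq_addl.
have pm : (p < m.*2)%N by rewrite doubleB ltn_subRL -[X in (_ < X)%N]addnn ltn_add2r.
(* A single set of [m] signal-free columns bounds the minimum from above, so the upper tail needs no
   union over sets. *)
have [S0 S0J S0m] : exists2 S : {set 'I_p}, S \subset ~: J & #|S| = m.
  by apply: exists_card_subset; rewrite cardsCs finset.setCK card_ord leq_sub2l.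
have S00 : (0 < #|S0|)%N by rewrite S0m.
apply: rare_sub; last apply: rareU; [|apply: rareU|apply: rareU]; last first.
- exact: (@rare_variance_lower R d Omega P n p Z X sigma gZ sigma0 m z l a n1 pm
    erefl erefl erefl).
- exact: (@rare_variance_upper R d Omega P n p Z X sigma gZ sigma0 S0 z l n1 S00
    erefl erefl).
- exact: (@rare_columns R d Omega P n p K Z X sigma fs gZ sigma0 sfs K0 L w n1 p0
    erefl erefl).
- exact: (@rare_deviations R d Omega P n p K Z X sigma fs gZ sigma0
    J l L q w n1 Kn p0 erefl erefl q0 w0).
move=> o; apply: contra_notP => good.
have nodev : ~ (exists2 gT, gT.1 != finfun fs & deviations Z X sigma fs J l L q w o gT).
  by move=> H; apply: good; left; left.
have quadE j : `|quad fs ((E o)^~ j) - K%:R| <= 24 * (w + L).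
  rewrite leNgt; apply/negP => H; apply: good; left; right; exists j => //; by left.
have linE j : - 2 * sigma * (\sum_i X i j * E o i j) <=
    (\sum_i X i j ^+ 2) / 2 + 16 * sigma ^+ 2 * L.
  rewrite leNgt; apply/negP => H; apply: good; left; right; exists j => //; right.
  exact: ltW.
have upper : \sum_(j in S0) \sum_i E o i j ^+ 2 <= (n * m)%:R * (1 + 13 * z).
  by rewrite leNgt; apply/negP => H; apply: good; right; left; rewrite /= S0m.
have lower (S : {set 'I_p}) : #|S| == m ->
    sigma ^+ 2 * (n * m)%:R * expR (- a) < column_norm (Y o) S.
  by move=> Sm; rewrite ltNge; apply/negP => H; apply: good; right; right; exists S.
have XJ i j : j \notin J -> X i j = 0 by move=> jJ; rewrite suppJ.
have sg2 : 0 < sigma ^+ 2 by rewrite exprn_gt0.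
have Vlo : sigma ^+ 2 * (n * m)%:R * expR (- a) <= min_norm (Y o) m.
  apply: le_bigmin => [|S Sm]; last exact: ltW (lower S Sm).
  (* The default value of the minimum also has to satisfy the bound; it dominates the norm of
     [S0]. *)
  apply: le_trans (ltW (lower S0 _)) _; first by rewrite S0m.
  rewrite /column_norm [leRHS](bigID (mem S0)) /=.
  rewrite [X in _ <= X + _](eq_bigl (mem S0)) => [|j]; last by rewrite inE.
  rewrite lerDl; apply: sumr_ge0 => j _; apply: sumr_ge0 => i _; exact: sqr_ge0.
have Vhi : min_norm (Y o) m <= sigma ^+ 2 * (n * m)%:R * (1 + 13 * z).
  apply: (@le_trans _ _ (column_norm (Y o) S0)).
    by apply: bigmin_le_cond; rewrite S0m.
  rewrite -mulrA; apply: le_trans (ler_wpM2l (ltW sg2) upper).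
  rewrite /column_norm mulr_sumr le_eqVlt; apply/orP; left; apply/eqP.
  apply: eq_bigr => j jS; rewrite mulr_sumr; apply: eq_bigr => i _.
  have /fintype.subsetP/(_ j jS) := S0J; rewrite inE => jJ.
  by rewrite entryE /data XJ // add0r exprMn.
have nm0 : 0 < (n * m)%:R :> R by rewrite ltr0n muln_gt0 (ltnW n1).
have tau0 : 0 <= w + L by rewrite addr_ge0 // ltW.
have /andP[plo phi] := penalty_bounds sg2 nm0 z0 z1 erefl (ltW KR) tau0 zK Vlo Vhi.
rewrite -/(penalty K s (Y o)) in plo phi.
apply: (@estimate_correct J o) => //.
- by rewrite (leq_trans Js) // mul2n -addnn leq_addl.
- rewrite /admissible leqNgt ps /= Js andbT; apply/surj_funP => k.
  by have [i fi] := sfs k; exists i; rewrite ffunE.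
- move=> c /andP[_]; rewrite leqNgt ps /= => cs.
  by rewrite (leq_trans cs) // mul2n -addnn leq_addl.
(* 152 = 24 + 128: the fluctuation of a projected noise column plus the margin required by
   [recovery]. *)
- move=> c j _ _; have := quadE j; rewrite ler_norml => /andP[_ H].
  have : sigma ^+ 2 * quad fs ((E o)^~ j) <= sigma ^+ 2 * (K%:R + 24 * (w + L)).
    by apply: ler_wpM2l; [exact: ltW|lra].
  move: plo; set t := w + L; lra.
- move=> c j _; rewrite inE => /andP[_ jJ].
  have := quadE j; rewrite ler_norml => /andP[H _].
  have h1 : sigma ^+ 2 * (K%:R - 24 * (w + L)) <= sigma ^+ 2 * quad fs ((E o)^~ j).
    by apply: ler_wpM2l; [exact: ltW|lra].
  (* 168 = 16 + 24 + 128: the cross term, which also uses half of the signal, the fluctuation of the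
     projected noise, and the margin. The remaining quarter of the signal must exceed these plus the
     penalty excess. *)
  have h2 := signalJ jJ; have h3 := linE j.
  have h4 : sigma ^+ 2 * L <= sigma ^+ 2 * (w + L).
    by apply: ler_wpM2l; [exact: ltW|rewrite lerDr ltW].
  have -> : quad fs ((data X (E o) sigma)^~ j) = \sum_i X i j ^+ 2 +
     2 * sigma * \sum_i X i j * E o i j + sigma ^+ 2 * quad fs ((E o)^~ j).
    have cst i : \sum_i' level_proj R fs i i' * X i' j = X i j.
      by rewrite (@proj_const _ _ _ fs (X^~ j)) // => i1 i2 ->.
    rewrite /data quad_add quad_sqr; congr (_ + _ * _ + _).
      by apply: eq_bigr => i _; rewrite cst.
    by apply: eq_bigr => i _; rewrite /resid cst subrr subr0.
  move: h1 h2 h3 h4 phi; set SX := \sum_i X i j ^+ 2; set XE := \sum_i X i j * _.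
  set Q := quad _ _; set pen := penalty _ _ _; set t := w + L; set cB := penalty_cst R.
  lra.
Qed.

Lemma estimate_probability :
  ((1 - 4 / n%:R ^+ 2)%:E <=
    P [set o | estimate s f0 (Y o) = unlabelled (classes fs)]%classic)%E.
Proof.
apply: rare_prob.
  have := @measurable_funPT _ _ _ _ Y measurableT _
    (measurable_estimate s f0 (unlabelled (classes fs))).
  by rewrite classical_sets.setTI.
have n20 : 0 <= n%:R ^- 2 :> R by rewrite invr_ge0 exprn_ge0 // ltW.
case: (leqP p s.*2) => ps.
  by apply: rareW (estimate_whole ps); lra.
by apply: rareW (estimate_sparse ps); lra.
Qed.

End MainEvent.

Lemma exists_surj_fun (n K : nat) : (0 < K)%N -> (K <= n)%N ->
  exists f : {ffun 'I_n -> 'I_K}, surj_fun f.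
Proof.
move=> K0 Kn; exists [ffun i => insubd (Ordinal K0) (val i)].
apply/surj_funP => k; exists (widen_ord Kn k); rewrite ffunE.
by apply: val_inj; rewrite /= insubdK // unfold_in ltn_ord.
Qed.

Theorem proposition4p6 (R : realType) :
  exists c1 c2 : R, 0 < c1 /\ 0 < c2 /\
  forall n p K s : nat,
    (2 <= K)%N -> (K <= n)%N -> (1 <= s)%N -> (s <= p)%N ->
  exists (dU : measure_display) (U : measurableType dU) (Q : probability U R)
    (Ghat : n.-tuple (p.-tuple R) -> U -> {set {set 'I_n}}),
    estimator K Ghat /\
  forall (G : 'I_K -> {set 'I_n}) (mu : 'M[R]_(K, p)) (J : {set 'I_p})
    (sigma gamma : R)
    (d : measure_display) (Omega : measurableType d) (P : probability Omega R)
    (Y : {mfun Omega >-> n.-tuple (p.-tuple R)}),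
    0 < sigma -> 1 <= gamma ->
    labelled_partition G -> balanced G gamma ->
    (#|J| <= s)%N -> supported_on mu J ->
    clustering_model G mu sigma P Y ->
    ((c1 * gamma ^+ 2 *
      (Num.sqrt (K%:R * ln (n * p)%:R) + ln (n * p)%:R))%:E
      <= omega2 (signal G mu) J sigma)%E ->
    ((c2 * gamma `^ (5 / 2) *
      (Num.sqrt ((s * K)%:R / n%:R * ln n%:R) + ln n%:R))%:E
      <= Delta2 mu sigma)%E ->
    ((1 - 4 / n%:R ^+ 2)%:E
      <= (P \x Q) [set wu : Omega * U | Ghat (Y wu.1) wu.2 = unlabelled G]%classic)%E.
Proof.
have [c1 c1E] : exists c1 : R, c1 = 4 * (penalty_cst R + 168).
  by exists (4 * (penalty_cst R + 168)).
have c10 : 0 < c1 by have := penalty_cst_gt0 R; rewrite c1E; lra.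
(* Any constant above 2 * 2016 would do: replacing s by 2 s under the square root costs at most a
   factor 2. *)
have [c2 c2E] : exists c2 : R, c2 = 5000 by exists 5000.
have c20 : 0 < c2 by rewrite c2E; lra.
exists c1, c2; split; first exact: c10.
split; first exact: c20.
move=> n p K s K2 Kn s1 sp.
have K0 : (0 < K)%N by exact: leq_trans K2.
have n0 : (0 < n)%N by exact: leq_trans Kn.
have [f0 sf0] := exists_surj_fun K0 Kn.
(* The estimator is deterministic: the auxiliary space is a point with its Dirac mass. *)
exists _, unit, (@dirac _ unit tt R), (fun y _ => estimate s f0 y); split.
  split=> [y _|C]; first exact: estimate_Kpartition.
  have := @measurable_fst _ _ (n.-tuple (p.-tuple R)) unit measurableT _
    (measurable_estimate s f0 C).
  by rewrite classical_sets.setTI.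
move=> G mu J sigma gamma d Omega P Y sigma0 gamma1 partG balG Js suppJ model omegaE DeltaE.
have [fs [fsG sfs ->]] := labelled_partition_fun partG.
have [b b0 [bal nb]] := balanced_sizes fsG n0 gamma1 sfs balG.
have gZ := model_field fsG model.
have gamma0 : 0 < gamma by exact: lt_le_trans gamma1.
have n1 : (1 < n)%N by exact: leq_trans K2 Kn.
have l0 : 0 < ln n%:R :> R by rewrite ln_gt0 // ltr1n.
have L0 : 0 < ln (n * p)%:R :> R.
  by rewrite ln_gt0 // ltr1n (leq_trans n1) // leq_pmulr // (leq_trans s1).
have sg2 : 0 < sigma ^+ 2 by rewrite exprn_gt0.
have signalJ j : j \in J -> c1 * sigma ^+ 2 *
    (Num.sqrt (K%:R * ln (n * p)%:R) + ln (n * p)%:R) <= \sum_i mu (fs i) j ^+ 2.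
  move=> jJ; have := le_trans omegaE (bigmin_le_cond _ _ jJ).
  rewrite lee_fin ler_pdivlMr // => H.
  have -> : \sum_i mu (fs i) j ^+ 2 = \sum_i signal G mu i j ^+ 2.
    by apply: eq_bigr => i _; rewrite (signalE _ fsG).
  apply: le_trans H.
  have g2 : 1 <= gamma ^+ 2 by rewrite exprn_ege1.
  set t := _ + _; have t0 : 0 <= t by rewrite addr_ge0 ?sqrtr_ge0 // ltW.
  have -> : c1 * gamma ^+ 2 * t * sigma ^+ 2 = (c1 * sigma ^+ 2 * t) * gamma ^+ 2 by ring.
  rewrite ler_peMr //; apply: mulr_ge0 => //; apply: mulr_ge0; exact: ltW.
rewrite c1E in signalJ.
pose Delta := c2 * gamma `^ (5 / 2) *
  (Num.sqrt ((s * K)%:R / n%:R * ln n%:R) + ln n%:R).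
have sepX k k' : k != k' ->
    2 * sigma ^+ 2 * Delta <= \sum_j (mu k j - mu k' j) ^+ 2.
  move=> kk'; have := le_trans DeltaE (bigmin_le_cond (j := (k, k')) _ _ kk').
  by rewrite lee_fin ler_pdivlMr ?mulr_gt0 //= mulrC.
have DeltaB : 2016 * gamma * (Num.sqrt ((2 * s)%:R * K%:R / n%:R * ln n%:R) + ln n%:R)
    < Delta.
  have gle : gamma <= gamma `^ (5 / 2).
    rewrite -[leLHS](powRr1 (ltW gamma0)); apply: ler_powR => //; clear; lra.
  have r0 : 0 <= Num.sqrt ((s * K)%:R / n%:R * ln n%:R) :> R by exact: sqrtr_ge0.
  have r2 : Num.sqrt ((2 * s)%:R * K%:R / n%:R * ln n%:R) <=
      2 * Num.sqrt ((s * K)%:R / n%:R * ln n%:R) :> R.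
    have -> : 2 = Num.sqrt (2 ^+ 2) :> R by rewrite sqrtr_sqr ger0_norm.
    rewrite -sqrtrM ?sqr_ge0 // ler_sqrt; last first.
      by rewrite !mulr_ge0 ?invr_ge0 // ltW.
    rewrite !natrM; set u := s%:R * K%:R / n%:R * ln n%:R.
    have u0 : 0 <= u by rewrite !mulr_ge0 ?invr_ge0 // ltW.
    have -> : 2 * s%:R * K%:R / n%:R * ln n%:R = 2 * u :> R by rewrite /u; ring.
    by rewrite ler_wpM2r //; clear; lra.
  apply: (@lt_le_trans _ _ (c2 * gamma *
      (Num.sqrt ((s * K)%:R / n%:R * ln n%:R) + ln n%:R))); last first.
    rewrite /Delta; apply: ler_wpM2r; first by rewrite addr_ge0 // ltW.
    by apply: ler_wpM2l => //; exact: ltW.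
  move: r2 r0 l0; rewrite c2E; set u := Num.sqrt _; set v := Num.sqrt _.
  move: (ln n%:R) => l uv v0 l0.
  rewrite ![_ * gamma]mulrC -!mulrA ltr_pM2l //.
  by move: u v l uv v0 l0 => u v l; clear; lra.
have main := estimate_probability f0 K2 Kn s1 sp sigma0 gamma1 sfs b0 bal nb
  Js suppJ gZ signalJ sepX DeltaB.
apply: le_trans main _.
set A := [set o | estimate s f0 (Y o) = unlabelled (classes fs)]%classic.
have mA : measurable A.
  have := @measurable_funPT _ _ _ _ Y measurableT _
    (measurable_estimate s f0 (unlabelled (classes fs))).
  by rewrite classical_sets.setTI.
rewrite (_ : [set wu | _]%classic = (A `*` setT)%classic); last first.
  by apply/seteqP; split=> [[x u] H|[x u] [H _]].
rewrite product_measure1E // -[leLHS]mule1; apply: lee_wpmul2l => //.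
have dT : dirac tt [set: unit]%classic = 1%E :> \bar R by exact: diracT.
by rewrite [leRHS]dT.
Qed.
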